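(* Let $\epsilon_1,\epsilon_2>0$ be such that $\epsilon_1<\min(\epsilon_1^*,K_{m,1})$ and $\epsilon_2<\min(\epsilon_2^*,K_{m,2})$. Then the operator $\mathcal{A}$ generates a $C_0$-semigroup on both $(\mathcal{H},\langle\cdot,\cdot\rangle_{\mathcal{H},1})$ and $(\mathcal{H},\langle\cdot,\cdot\rangle_{\mathcal{H},2})$.
   Context: Constants: $l,\rho,I_w,m_s,J_s,c_\omega,c_\phi,\eta_\omega,\eta_\phi,k_1,k_2$ are positive real numbers, $x_c\in\mathbb{R}$, and $\alpha_\omega,\beta_\omega,\gamma_\omega,\alpha_\phi,\beta_\phi,\gamma_\phi\ge 0$. Put $I_w^*=I_w+\rho x_c^2$, $J_s^*=J_s+m_sx_c^2$, and define the symmetric positive definite matrices $M=\begin{bmatrix}\rho&\rho x_c\\ \rho x_c&I_w^*\end{bmatrix}$, $M_s=\begin{bmatrix}m_s&m_sx_c\\ m_sx_c&J_s^*\end{bmatrix}$. $\lambda_m(\cdot)$ denotes the smallest eigenvalue. Spaces: $H^m(0,l)$ is the usual real Sobolev space of functions in $L^2(0,l)$ with $m$ weak derivatives in $L^2(0,l)$, $\mathrm{AC}[0,l]$ is the set of absolutely continuous functions on $[0,l]$, and $H_L^m(0,l)=\{f\in H^m(0,l): f(0)=f'(0)=\dots=f^{(m-1)}(0)=0\}$ (elements of $H^1(0,l)$ are identified with their absolutely continuous representatives). Let $\mathcal{H}=H_L^2(0,l)\times L^2(0,l)\times H_L^1(0,l)\times L^2(0,l)\times\mathbb{R}\times\mathbb{R}$.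 For $X_i=(f_i,g_i,h_i,z_i,\zeta_{\omega,i},\zeta_{\phi,i})\in\mathcal{H}$ define $$\langle X_1,X_2\rangle_{\mathcal{H},1}=\int_0^l\big[\rho c_\omega^2f_1''f_2''+I_wc_\phi^2h_1'h_2'\big]dy+\int_0^l\begin{bmatrix}g_1\\ z_1\end{bmatrix}^\top M\begin{bmatrix}g_2\\ z_2\end{bmatrix}dy+\begin{bmatrix}\zeta_{\omega,1}\\ \zeta_{\phi,1}\end{bmatrix}^\top M_s\begin{bmatrix}\zeta_{\omega,2}\\ \zeta_{\phi,2}\end{bmatrix},$$ $$\Psi(X_1,X_2)=\int_0^l\Big(\begin{bmatrix}g_1\\ z_1\end{bmatrix}^\top M\begin{bmatrix}\epsilon_1f_2\\ \epsilon_2h_2\end{bmatrix}+\begin{bmatrix}g_2\\ z_2\end{bmatrix}^\top M\begin{bmatrix}\epsilon_1f_1\\ \epsilon_2h_1\end{bmatrix}\Big)dy+\begin{bmatrix}\zeta_{\omega,1}\\ \zeta_{\phi,1}\end{bmatrix}^\top M_s\begin{bmatrix}\epsilon_1f_2(l)\\ \epsilon_2h_2(l)\end{bmatrix}+\begin{bmatrix}\zeta_{\omega,2}\\ \zeta_{\phi,2}\end{bmatrix}^\top M_s\begin{bmatrix}\epsilon_1f_1(l)\\ \epsilon_2h_1(l)\end{bmatrix},$$ and $\langle X_1,X_2\rangle_{\mathcal{H},2}=\langle X_1,X_2\rangle_{\mathcal{H},1}+\Psi(X_1,X_2)$ (for $\epsilon_i\in(0,K_{m,i})$ this is an inner product on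 $\mathcal{H}$ whose norm is equivalent to that of $\langle\cdot,\cdot\rangle_{\mathcal{H},1}$). Thresholds (if $x_c=0$, terms with $|x_c|$ as a factor of the denominator are read as $+\infty$, i.e. omitted): $$K_{m,1}=\min\Big(\tfrac{\pi^4\rho c_\omega^2}{4l^3(1+|x_c|)\{4l\rho^{3/2}c_\omega+\pi^2m_s\}},\tfrac{c_\omega\lambda_m(M)}{2\sqrt\rho},\tfrac{c_\omega\lambda_m(M)}{2\sqrt\rho|x_c|},\tfrac{\lambda_m(M_s)}{2m_s},\tfrac{\lambda_m(M_s)}{2m_s|x_c|}\Big),$$ $$K_{m,2}=\min\Big(\tfrac{\pi^2I_wc_\phi^2}{4l^2(I_w^*+\rho|x_c|)\sqrt{I_w}c_\phi+\pi^2l(J_s^*+m_s|x_c|)},\tfrac{\sqrt{I_w}c_\phi\lambda_m(M)}{2\rho|x_c|},\tfrac{\sqrt{I_w}c_\phi\lambda_m(M)}{2I_w^*},\tfrac{\lambda_m(M_s)}{2m_s|x_c|},\tfrac{\lambda_m(M_s)}{2J_s^*}\Big),$$ $$\epsilon_1^*=\min\Big(\tfrac{\pi^2I_w\eta_\phi c_\phi^2}{l|x_c|(4l\rho+\pi^2m_s)},\tfrac{2\pi^4\rho\eta_\omega c_\omega^2}{32l^4(2+|x_c|)\rho+8\pi^2l^3(2+|x_c|)m_s+\pi^4\rho\eta_\omega^2c_\omega^2}\Big),$$ $$\epsilon_2^*=\min\Big(\tfrac{\pi^4\rho\eta_\omega c_\omega^2}{4l^3|x_c|(4l\rho+\pi^2m_s)},\tfrac{2\pi^2I_w\eta_\phi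 c_\phi^2}{8l^2(2I_w^*+|x_c|\rho)+2\pi^2l(2J_s^*+|x_c|m_s)+\pi^2I_w\eta_\phi^2c_\phi^2}\Big).$$ Operators: $D(\mathcal{A})=D(\mathcal{A}_1)$ is the set of $(f,g,h,z,\zeta_\omega,\zeta_\phi)\in\mathcal{H}$ such that $g\in H_L^2(0,l)$, $z\in H_L^1(0,l)$, $f''+\eta_\omega g''\in H^2(0,l)$, $h'+\eta_\phi z'\in H^1(0,l)$, $(f''+\eta_\omega g'')(l)=0$, $\zeta_\omega=g(l)$, $\zeta_\phi=z(l)$, and $f,f',g,g',h,z,(f''+\eta_\omega g''),(f''+\eta_\omega g'')',(h'+\eta_\phi z')\in\mathrm{AC}[0,l]$. On it, $\mathcal{A}=\mathcal{A}_1+\mathcal{A}_2$, where $\mathcal{A}_1(f,g,h,z,\zeta_\omega,\zeta_\phi)=(g,\tilde g,z,\tilde z,\tilde\zeta_\omega,\tilde\zeta_\phi)$ with $$\begin{bmatrix}\tilde g\\ \tilde z\end{bmatrix}=-M^{-1}\begin{bmatrix}\rho c_\omega^2(f''+\eta_\omega g'')''\\ -I_wc_\phi^2(h'+\eta_\phi z')'\end{bmatrix},\qquad \begin{bmatrix}\tilde\zeta_\omega\\ \tilde\zeta_\phi\end{bmatrix}=M_s^{-1}\begin{bmatrix}\rho c_\omega^2(f''+\eta_\omega g'')'(l)-k_1(g(l)+\epsilon_1f(l))\\ -I_wc_\phi^2(h'+\eta_\phi z')(l)-k_2(z(l)+\epsilon_2h(l))\end{bmatrix},$$ and $\mathcal{A}_2$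 (defined on all of $\mathcal{H}$) is $\mathcal{A}_2(f,g,h,z,\zeta_\omega,\zeta_\phi)=(0,\tilde F_a,0,\tilde M_a,0,0)$ with $$\begin{bmatrix}\tilde F_a\\ \tilde M_a\end{bmatrix}=M^{-1}\begin{bmatrix}\alpha_\omega h+\beta_\omega z+\gamma_\omega g\\ \alpha_\phi h+\beta_\phi z+\gamma_\phi g\end{bmatrix}.$$ *)

(* Defs.v *)
From HB Require Import structures.
From mathcomp Require Import all_boot all_order all_algebra.
From mathcomp Require Import generic_quotient ring_quotient.
From mathcomp Require Import all_classical all_reals all_analysis.
From mathcomp Require Import measurable_realfun.

Set Implicit Arguments.
Unset Strict Implicit.
Unset Printing Implicit Defensive.

Import Order.TTheory GRing.Theory Num.Theory.
Import numFieldNormedType.Exports.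

Local Open Scope classical_set_scope.
Local Open Scope ring_scope.
Local Open Scope quotient_scope.

Section lebesgue_space.
Context {R : realType}.

(* Lebesgue measure restricted to ]0, l[ *)
Definition leb (l : R) : {measure set (measurableTypeR R) -> \bar R} :=
  mrestr (@lebesgue_measure R) (measurable_itv `]0, l[).

Lemma leb_fin (l : R) : leb l setT \is a fin_num.
Proof.
rewrite /leb /= /mrestr setTI ge0_fin_numE//.
by rewrite lebesgue_measure_itv/=; case: ifP => // _; rewrite -EFinB ltry.
Qed.

Local Notation calL2 l := (LfunType (leb l) (lee1n 2)).

Definition null2 (l : R) : {pred calL2 l} :=
  fun f => `[< {ae leb l, forall y, f y = 0} >].

Lemma null2_closed l : zmod_closed (@null2 l).
Proof.
split; first by apply/asboolP; apply: aeW.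
move=> f g /asboolP f0 /asboolP g0; apply/asboolP.
apply: filterS2 f0 g0 => y f0 g0.
by rewrite [LHS](_ : _ = f y - g y)// f0 g0 subr0.
Qed.
HB.instance Definition _ l :=
  GRing.isZmodClosed.Build (calL2 l) (@null2 l) (null2_closed l).

(* L^2(0,l): square-integrable functions modulo equality almost everywhere on
   ]0, l[. *)
Definition L2 (l : R) : Type := Quotient.quot (@null2 l).
HB.instance Definition _ l := ZmodQuotient.on (L2 l).

Lemma ae_mono3 l (P1 P2 P3 S : R -> Prop) :
  (forall y, P1 y -> P2 y -> P3 y -> S y) -> {ae leb l, forall y, P1 y} ->
  {ae leb l, forall y, P2 y} -> {ae leb l, forall y, P3 y} ->
  {ae leb l, forall y, S y}.
Proof. exact: (@filterS3 _ _ (ae_filter_ringOfSetsType (leb l))). Qed.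

Lemma ae_mono l (P S : R -> Prop) : (forall y, P y -> S y) ->
  {ae leb l, forall y, P y} -> {ae leb l, forall y, S y}.
Proof. by move=> PS P_ae; exact: (ae_mono3 (fun y Py _ _ => PS y Py) P_ae P_ae P_ae). Qed.

Lemma L2_ext_repr l (f g : calL2 l) :
  {ae leb l, forall y, f y = g y} <-> \pi_(L2 l) f = \pi_(L2 l) g.
Proof.
split=> [fg|/eqP].
  apply/eqP; rewrite -Quotient.idealrBE; apply/asboolP.
  by apply: ae_mono fg => y E; apply/eqP; rewrite subr_eq0; apply/eqP.
rewrite -Quotient.idealrBE => /asboolP.
by apply: ae_mono => y /eqP; rewrite subr_eq0 => /eqP.
Qed.

Definition L2fun l (u : L2 l) : R -> R := repr u.

Definition L2scale l (a : R) (u : L2 l) : L2 l := \pi_(L2 l) (a *: repr u).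

Lemma L2scale_pi l a (f : calL2 l) :
  L2scale a (\pi_(L2 l) f) = \pi_(L2 l) (a *: f).
Proof.
apply/L2_ext_repr.
have /L2_ext_repr : repr (\pi_(L2 l) f) = f %[mod L2 l] by rewrite reprK.
apply: ae_mono => y E; rewrite -[LHS]/(a * (repr (\pi_(L2 l) f) : calL2 l) y) E.
by [].
Qed.

Lemma L2add_pi l (f g : calL2 l) :
  \pi_(L2 l) f + \pi_(L2 l) g = \pi_(L2 l) (f + g).
Proof. by rewrite [RHS](Quotient.pi_add (@null2 l)). Qed.

Lemma L2scalerA l a b (v : L2 l) : L2scale a (L2scale b v) = L2scale (a * b) v.
Proof. by elim/quotW: v => f; rewrite (L2scale_pi b f) !L2scale_pi scalerA. Qed.

Lemma L2scale1r l : left_id 1 (@L2scale l).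
Proof. by elim/quotW => f; rewrite L2scale_pi scale1r. Qed.

Lemma L2scalerDr l : right_distributive (@L2scale l) +%R.
Proof.
move=> a; elim/quotW=> f; elim/quotW=> g.
by rewrite (L2scale_pi a f) (L2scale_pi a g) !L2add_pi L2scale_pi scalerDr.
Qed.

Lemma L2scalerDl l (v : L2 l) : {morph (@L2scale l)^~ v : a b / a + b}.
Proof.
by elim/quotW: v => f a b; rewrite !(L2scale_pi _ f) L2add_pi scalerDl.
Qed.

HB.instance Definition _ l := GRing.Zmodule_isLmodule.Build R (L2 l)
  (@L2scalerA l) (@L2scale1r l) (@L2scalerDr l) (@L2scalerDl l).


Lemma L2funZD l a (u v : L2 l) :
  {ae leb l, forall y, L2fun (a *: u + v) y = a * L2fun u y + L2fun v y}.
Proof.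
suff -> : a *: u + v = \pi_(L2 l) (a *: repr u + repr v).
  have : repr (\pi_(L2 l) (a *: repr u + repr v)) = a *: repr u + repr v
    %[mod L2 l] by rewrite reprK.
  by move=> /L2_ext_repr.
by rewrite -[u in LHS]reprK -[v in LHS]reprK [_ *: _]L2scale_pi L2add_pi.
Qed.

Definition test_function (l : R) (phi : R -> R) : Prop :=
  (forall n x, derivable (derive1n n phi) x 1) /\
  exists a b, [/\ 0 < a, b < l & forall x, x \notin `[a, b] -> phi x = 0].

Definition weak_deriv (l : R) (m : nat) (u v : L2 l) : Prop :=
  forall phi, test_function l phi ->
    \int[leb l]_y (L2fun u y * (derive1n m phi) y)
    = (-1) ^+ m * \int[leb l]_y (L2fun v y * phi y).

Lemma test_continuous l phi n : test_function l phi -> continuous (derive1n n phi).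
Proof.
move=> [dphi _] x; apply: differentiable_continuous.
exact/derivable1_diffP.
Qed.

Lemma test_bounded l phi n : test_function l phi ->
  [bounded derive1n n phi x | x in [set: R]].
Proof.
move=> tphi; have [dphi [a [b [a0 bl phi0]]]] := tphi.
have phin0 x : x \notin `[a, b] -> (derive1n n phi) x = 0.
  elim: n x => [|n IH] x xab; first exact: phi0.
  rewrite derive1nS derive1E -(derive_cst (0 : R) x 1).
  apply: near_eq_derive.
  have oC : open (~` [set` `[a, b]]) by apply: closed_openC; exact: itv_closed.
  have : nbhs x (~` [set` `[a, b]]).
    by apply: open_nbhs_nbhs; split => //; exact/negP.
  by apply: filterS => y /negP; exact: IH.
have cw : {within [set` `[a, b]], continuous (derive1n n phi)}.
  exact: (continuous_subspaceT (@test_continuous l phi n tphi)).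
have [M [Mr MP]] := compact_bounded (continuous_compact cw (@segment_compact R a b)).
exists (Num.max M 0); split; first by rewrite num_real.
move=> N; rewrite gt_max => /andP[MN N0] x _ /=.
have [xab|/phin0 ->] := boolP (x \in `[a, b]); last by rewrite normr0 ltW.
by apply: (MP N MN); exists x.
Qed.

Lemma L2_test_integrable l (u : L2 l) phi n : test_function l phi ->
  (leb l).-integrable setT (EFin \o (fun y => L2fun u y * (derive1n n phi) y)).
Proof.
move=> tphi.
have ui : (leb l).-integrable setT (EFin \o L2fun u).
  apply/Lfun1_integrable; apply: (Lfun_subset12 (leb_fin l)).
  exact: LfunP.
apply: (integrableMl measurableT ui).
  by apply: continuous_measurable_fun; exact: (@test_continuous l phi n tphi).
exact: (@test_bounded l phi n tphi).
Qed.

Lemma test_intZD l phi n a (u v : L2 l) : test_function l phi ->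
  \int[leb l]_y (L2fun (a *: u + v) y * (derive1n n phi) y) =
  a * \int[leb l]_y (L2fun u y * (derive1n n phi) y)
  + \int[leb l]_y (L2fun v y * (derive1n n phi) y).
Proof.
move=> tphi.
have iu := @L2_test_integrable l u phi n tphi.
have iv := @L2_test_integrable l v phi n tphi.
have iau : (leb l).-integrable setT
    (EFin \o (fun y => a * (L2fun u y * (derive1n n phi) y))).
  by have := integrableZl measurableT a iu.
rewrite -RintegralZl// -RintegralD//.
congr fine; apply: ae_eq_integral => //.
- exact: measurable_int (@L2_test_integrable l _ phi n tphi).
- exact: measurable_int (integrableD measurableT iau iv).
apply: ae_mono (L2funZD a u v) => y -> _ /=.
by rewrite mulrDl mulrA.
Qed.

Lemma weak_derivZD l m a (u v u' v' : L2 l) :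
  weak_deriv m u u' -> weak_deriv m v v' ->
  weak_deriv m (a *: u + v) (a *: u' + v').
Proof.
move=> wu wv phi tphi.
have E0 := @test_intZD l phi 0 a u' v' tphi.
rewrite test_intZD// E0 (wu _ tphi) (wv _ tphi).
by rewrite mulrDr mulrCA.
Qed.

Lemma weak_deriv0 l m : weak_deriv m (0 : L2 l) 0.
Proof.
have I0 n phi : test_function l phi ->
    \int[leb l]_y (L2fun (0 : L2 l) y * (derive1n n phi) y) = 0.
  move=> tphi; have := @test_intZD l phi n 1 0 0 tphi.
  rewrite scaler0 addr0 mul1r => /eqP.
  by rewrite -subr_eq0 opprD addNKr oppr_eq0 => /eqP.
move=> phi tphi; rewrite I0//.
by have := I0 0%N phi tphi; rewrite derive1n0 => ->; rewrite mulr0.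
Qed.

(* the m-th weak derivative, and the junk value 0 if there is none *)
Definition wderiv (l : R) (m : nat) (u : L2 l) : L2 l :=
  xget 0 [set v | weak_deriv m u v].

Definition sobolev (l : R) (m : nat) (u : L2 l) : Prop :=
  forall k, (k <= m)%N -> exists v, weak_deriv k u v.

Definition abs_cont (a b : R) (f : R -> R) : Prop :=
  forall e, 0 < e -> exists2 d, 0 < d &
    forall n (s t : 'I_n -> R),
      (forall i, [/\ a <= s i, s i <= t i & t i <= b]) ->
      trivIset setT (fun i => `]s i, t i[%classic) ->
      \sum_i (t i - s i) < d -> \sum_i `|f (t i) - f (s i)| < e.

Lemma abs_contZD a b c f g : abs_cont a b f -> abs_cont a b g ->
  abs_cont a b (fun y => c * f y + g y).
Proof.
move=> acf acg e e0.
have c0 : 0 < `|c| + 1 by rewrite ltr_wpDl.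
have e20 : 0 < e / 2 by rewrite divr_gt0.
have [d1 d10 H1] := acf (e / 2 / (`|c| + 1)) (divr_gt0 e20 c0).
have [d2 d20 H2] := acg (e / 2) e20.
exists (Num.min d1 d2); first by rewrite lt_min d10.
move=> n s t st dis; rewrite lt_min => /andP[lt1 lt2].
have {}H1 := H1 n s t st dis lt1; have {}H2 := H2 n s t st dis lt2.
have le_sum : \sum_i `|c * f (t i) + g (t i) - (c * f (s i) + g (s i))| <=
    `|c| * \sum_i `|f (t i) - f (s i)| + \sum_i `|g (t i) - g (s i)|.
  rewrite mulr_sumr -big_split/=; apply: ler_sum => i _.
  by rewrite -normrM mulrBr opprD addrACA ler_normD.
rewrite (le_lt_trans le_sum)// [ltRHS]splitr ler_ltD//.
have S0 : 0 <= \sum_i `|f (t i) - f (s i)| by apply: sumr_ge0.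
apply: le_trans (_ : (`|c| + 1) * \sum_i `|f (t i) - f (s i)| <= _).
  by rewrite ler_wpM2r// lerDl.
by rewrite mulrC -ler_pdivlMr// ltW.
Qed.

Definition ac_rep (l : R) (u : L2 l) (f : R -> R) : Prop :=
  abs_cont 0 l f /\ {ae leb l, forall y, L2fun u y = f y}.

(* The values of a class are those of its absolutely continuous representative
   on [0, l]. *)
Definition has_value (l : R) (u : L2 l) (x y : R) : Prop :=
  exists2 f, ac_rep u f & f x = y.

Lemma has_valueZD l a (u v : L2 l) x c d :
  has_value u x c -> has_value v x d -> has_value (a *: u + v) x (a * c + d).
Proof.
move=> [f [acf uf] <-] [g [acg vg] <-]; exists (fun y => a * f y + g y) => //.
split; first exact: abs_contZD.
by apply: ae_mono3 (L2funZD a u v) uf vg => y -> -> ->.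
Qed.

Lemma has_value0 l x : has_value (0 : L2 l) x 0.
Proof.
exists (cst 0) => //; split.
  move=> e e0; exists 1 => // n s t _ _ _.
  by rewrite big1// => i _; rewrite subrr normr0.
have := L2funZD (-1) (0 : L2 l) 0; rewrite scaler0 addr0.
by apply: ae_mono => y; rewrite mulN1r addNr.
Qed.

Definition value (l : R) (u : L2 l) (x : R) : R :=
  xget 0 [set y | has_value u x y].

(* H^m_L(0,l): the traces at 0 of the derivatives of order < m vanish. *)
Definition sobolevL (m : nat) (l : R) : {pred L2 l} := fun u =>
  `[< sobolev m u /\ forall k, (k < m)%N ->
      exists2 v, weak_deriv k u v & has_value v 0 0 >].

Lemma sobolevL_submod_closed m l : submod_closed (@sobolevL m l).
Proof.
split.
  apply/asboolP; split=> k _; exists 0; first exact: weak_deriv0.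
  - exact: weak_deriv0.
  - exact: has_value0.
move=> a u v /asboolP[su tu] /asboolP[sv tv]; apply/asboolP; split=> k km.
  have [u' wu] := su k km; have [v' wv] := sv k km.
  by exists (a *: u' + v'); exact: weak_derivZD.
have [u' wu u0] := tu k km; have [v' wv v0] := tv k km.
exists (a *: u' + v'); first exact: weak_derivZD.
by have := has_valueZD a u0 v0; rewrite mulr0 addr0.
Qed.
HB.instance Definition _ m l :=
  GRing.isSubmodClosed.Build R (L2 l) (@sobolevL m l)
    (@sobolevL_submod_closed m l).

Record HL (m : nat) (l : R) : Type := MkHL {
  HLval :> L2 l;
  HLvalP : HLval \in @sobolevL m l }.
HB.instance Definition _ m l := [isSub for @HLval m l].
HB.instance Definition _ m l := [Choice of HL m l by <:].
HB.instance Definition _ m l := [SubChoice_isSubLmodule of HL m l by <:].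

End lebesgue_space.

Section semigroup.
Context {R : realType} {V : lmodType R} (ip : V -> V -> R).

Definition ip_norm (x : V) : R := Num.sqrt (ip x x).

Record C0_semigroup (T : R -> V -> V) : Prop := {
  semigroup_linear : forall t, 0 <= t -> linear (T t);
  semigroup_bounded : forall t, 0 <= t ->
    exists C, forall x, ip_norm (T t x) <= C * ip_norm x;
  semigroup0 : forall x, T 0 x = x;
  semigroupD : forall s t x, 0 <= s -> 0 <= t -> T (s + t) x = T s (T t x);
  semigroup_cont : forall x, ip_norm (T t x - x) @[t --> 0^'+] --> 0 }.

(* (x, y) belongs to the graph of the infinitesimal generator of T *)
Definition generator_graph (T : R -> V -> V) (x y : V) : Prop :=
  ip_norm (t^-1 *: (T t x - x) - y) @[t --> 0^'+] --> 0.

(* A is a total function, of which only the restriction to D is meaningful. *)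
Definition generates_C0_semigroup (D : set V) (A : V -> V) : Prop :=
  exists2 T, C0_semigroup T &
    forall x y, generator_graph T x y <-> D x /\ A x = y.

End semigroup.

(* len is the length l of the beam; the suffixes _om and _ph stand for the
   subscripts omega and phi, and al, be, ga for alpha, beta, gamma. *)
Record beam (R : realType) := Beam {
  len : R; rho : R; Iw : R; ms : R; Js : R; xc : R;
  c_om : R; c_ph : R; eta_om : R; eta_ph : R; k1 : R; k2 : R;
  al_om : R; be_om : R; ga_om : R; al_ph : R; be_ph : R; ga_ph : R;
  len_gt0 : 0 < len; rho_gt0 : 0 < rho; Iw_gt0 : 0 < Iw;
  ms_gt0 : 0 < ms; Js_gt0 : 0 < Js;
  c_om_gt0 : 0 < c_om; c_ph_gt0 : 0 < c_ph;
  eta_om_gt0 : 0 < eta_om; eta_ph_gt0 : 0 < eta_ph;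
  k1_gt0 : 0 < k1; k2_gt0 : 0 < k2;
  al_om_ge0 : 0 <= al_om; be_om_ge0 : 0 <= be_om; ga_om_ge0 : 0 <= ga_om;
  al_ph_ge0 : 0 <= al_ph; be_ph_ge0 : 0 <= be_ph; ga_ph_ge0 : 0 <= ga_ph }.

Section matrices.
Context {R : realType}.

Definition mx22 (a b c d : R) : 'M[R]_2 :=
  \matrix_(i, j) if i == 0 then (if j == 0 then a else b)
                 else (if j == 0 then c else d).

Definition col2 (a b : R) : 'cV[R]_2 := \col_i if i == 0 then a else b.

Definition bil (A : 'M[R]_2) (u v : 'cV[R]_2) : R := (u^T *m A *m v) 0 0.

(* the action of a 2x2 matrix on a column with entries in a vector space *)
Definition act2 {V : lmodType R} (A : 'M[R]_2) (a b : V) : V * V :=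
  (A 0 0 *: a + A 0 1 *: b, A 1 0 *: a + A 1 1 *: b).

Definition min_eigenvalue n (A : 'M[R]_n) : R := inf [set a | eigenvalue A a].

(* a quotient, read as +oo when its denominator vanishes *)
Definition quo (a b : R) : \bar R := if b == 0 then +oo%E else (a / b)%:E.

Definition min_list (s : seq (\bar R)) : \bar R :=
  \big[Order.min/+oo%E]_(x <- s) x.

End matrices.

(* Stated for abstract modules: checking the instance of this identity on the
   concrete state space below by unfolding is prohibitively slow. *)
Lemma tuple6ZD (R : realType) (V1 V2 V3 V4 V5 V6 : lmodType R) (a : R)
    (X Y : V1 * V2 * V3 * V4 * V5 * V6) :
  a *: X + Y = (a *: X.1.1.1.1.1 + Y.1.1.1.1.1, a *: X.1.1.1.1.2 + Y.1.1.1.1.2,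
                a *: X.1.1.1.2 + Y.1.1.1.2, a *: X.1.1.2 + Y.1.1.2,
                a *: X.1.2 + Y.1.2, a *: X.2 + Y.2).
Proof. by []. Qed.

Section beam_operator.
Context {R : realType} (B : beam R) (e1 e2 : R).

Local Notation l := (len B).
Local Notation rho := (rho B).
Local Notation Iw := (Iw B).
Local Notation ms := (ms B).
Local Notation Js := (Js B).
Local Notation xc := (xc B).
Local Notation c_om := (c_om B).
Local Notation c_ph := (c_ph B).
Local Notation eta_om := (eta_om B).
Local Notation eta_ph := (eta_ph B).

(* Iws and Jss are I_w^* and J_s^*; Mb and Mt are the mass matrices M and M_s
   of the beam and of the tip. *)
Definition Iws : R := Iw + rho * xc ^+ 2.
Definition Jss : R := Js + ms * xc ^+ 2.
Definition Mb : 'M[R]_2 := mx22 rho (rho * xc) (rho * xc) Iws.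
Definition Mt : 'M[R]_2 := mx22 ms (ms * xc) (ms * xc) Jss.

Definition Hsp : lmodType R :=
  (HL 2 l * L2 l * HL 1 l * L2 l * R^o * R^o)%type.

Definition ip1 (X1 X2 : Hsp) : R :=
  let: (f1, g1, h1, z1, zo1, zp1) := X1 in
  let: (f2, g2, h2, z2, zo2, zp2) := X2 in
  \int[leb l]_y
    (rho * c_om ^+ 2 * L2fun (wderiv 2 f1) y * L2fun (wderiv 2 f2) y
     + Iw * c_ph ^+ 2 * L2fun (wderiv 1 h1) y * L2fun (wderiv 1 h2) y)
  + \int[leb l]_y
    bil Mb (col2 (L2fun g1 y) (L2fun z1 y)) (col2 (L2fun g2 y) (L2fun z2 y))
  + bil Mt (col2 zo1 zp1) (col2 zo2 zp2).

Definition Psi (X1 X2 : Hsp) : R :=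
  let: (f1, g1, h1, z1, zo1, zp1) := X1 in
  let: (f2, g2, h2, z2, zo2, zp2) := X2 in
  \int[leb l]_y
    (bil Mb (col2 (L2fun g1 y) (L2fun z1 y))
            (col2 (e1 * L2fun f2 y) (e2 * L2fun h2 y))
     + bil Mb (col2 (L2fun g2 y) (L2fun z2 y))
              (col2 (e1 * L2fun f1 y) (e2 * L2fun h1 y)))
  + bil Mt (col2 zo1 zp1) (col2 (e1 * value f2 l) (e2 * value h2 l))
  + bil Mt (col2 zo2 zp2) (col2 (e1 * value f1 l) (e2 * value h1 l)).

Definition ip2 (X1 X2 : Hsp) : R := ip1 X1 X2 + Psi X1 X2.

Definition Km1 : \bar R :=
  let lM := min_eigenvalue Mb in let lMs := min_eigenvalue Mt in
  min_list
    [:: quo (pi ^+ 4 * rho * c_om ^+ 2)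
            (4 * l ^+ 3 * (1 + `|xc|)
             * (4 * l * rho `^ (3 / 2) * c_om + pi ^+ 2 * ms));
        quo (c_om * lM) (2 * Num.sqrt rho);
        quo (c_om * lM) (2 * Num.sqrt rho * `|xc|);
        quo lMs (2 * ms);
        quo lMs (2 * ms * `|xc|)].

Definition Km2 : \bar R :=
  let lM := min_eigenvalue Mb in let lMs := min_eigenvalue Mt in
  min_list
    [:: quo (pi ^+ 2 * Iw * c_ph ^+ 2)
            (4 * l ^+ 2 * (Iws + rho * `|xc|) * Num.sqrt Iw * c_ph
             + pi ^+ 2 * l * (Jss + ms * `|xc|));
        quo (Num.sqrt Iw * c_ph * lM) (2 * rho * `|xc|);
        quo (Num.sqrt Iw * c_ph * lM) (2 * Iws);
        quo lMs (2 * ms * `|xc|);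
        quo lMs (2 * Jss)].

Definition eps1_star : \bar R :=
  min_list
    [:: quo (pi ^+ 2 * Iw * eta_ph * c_ph ^+ 2)
            (l * `|xc| * (4 * l * rho + pi ^+ 2 * ms));
        quo (2 * pi ^+ 4 * rho * eta_om * c_om ^+ 2)
            (32 * l ^+ 4 * (2 + `|xc|) * rho
             + 8 * pi ^+ 2 * l ^+ 3 * (2 + `|xc|) * ms
             + pi ^+ 4 * rho * eta_om ^+ 2 * c_om ^+ 2)].

Definition eps2_star : \bar R :=
  min_list
    [:: quo (pi ^+ 4 * rho * eta_om * c_om ^+ 2)
            (4 * l ^+ 3 * `|xc| * (4 * l * rho + pi ^+ 2 * ms));
        quo (2 * pi ^+ 2 * Iw * eta_ph * c_ph ^+ 2)
            (8 * l ^+ 2 * (2 * Iws + `|xc| * rho)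
             + 2 * pi ^+ 2 * l * (2 * Jss + `|xc| * ms)
             + pi ^+ 2 * Iw * eta_ph ^+ 2 * c_ph ^+ 2)].

Definition has_ac (u : L2 l) : Prop := exists f, ac_rep u f.

(* f'' + eta_om g'' and h' + eta_ph z' *)
Definition bend (f g : L2 l) : L2 l := wderiv 2 f + eta_om *: wderiv 2 g.
Definition twist (h z : L2 l) : L2 l := wderiv 1 h + eta_ph *: wderiv 1 z.

Definition domA : set Hsp := fun X =>
  let: (f, g, h, z, zo, zp) := X in
  [/\ g \in @sobolevL R 2 l /\ z \in @sobolevL R 1 l,
      sobolev 2 (bend f g) /\ sobolev 1 (twist h z),
      value (bend f g) l = 0,
      zo = value g l /\ zp = value z l &
      {in [:: HLval f; wderiv 1 f; g; wderiv 1 g; HLval h; z;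
              bend f g; wderiv 1 (bend f g); twist h z],
        forall u, has_ac u}].

(* On domA, g and z lie in the spaces required of the first and third
   components, so that insubd 0 only retypes them. *)
Definition opA1 (X : Hsp) : Hsp :=
  let: (f, g, h, z, zo, zp) := X in
  let: (gt, zt) := act2 (invmx Mb)
    ((rho * c_om ^+ 2) *: wderiv 2 (bend f g))
    (- ((Iw * c_ph ^+ 2) *: wderiv 1 (twist h z))) in
  let: (zot, zpt) := act2 (invmx Mt)
    (rho * c_om ^+ 2 * value (wderiv 1 (bend f g)) l
     - k1 B * (value g l + e1 * value f l) : R^o)
    (- (Iw * c_ph ^+ 2 * value (twist h z) l)
     - k2 B * (value z l + e2 * value h l)) in
  (insubd 0 g, - gt, insubd 0 z, - zt, zot, zpt).

Definition opA2 (X : Hsp) : Hsp :=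
  let: (f, g, h, z, zo, zp) := X in
  let: (Fa, Ma) := act2 (invmx Mb)
    (al_om B *: HLval h + be_om B *: z + ga_om B *: g)
    (al_ph B *: HLval h + be_ph B *: z + ga_ph B *: g) in
  (0, Fa, 0, Ma, 0, 0).

Definition opA (X : Hsp) : Hsp := opA1 X + opA2 X.

End beam_operator.

Arguments Hsp {R} B.
Arguments ip1 {R} B X1 X2.
Arguments Psi {R} B e1 e2 X1 X2.
Arguments ip2 {R} B e1 e2 X1 X2.
Arguments domA {R} B X.
Arguments opA1 {R} B e1 e2 X.
Arguments opA2 {R} B X.
Arguments opA {R} B e1 e2 X.

(* Main.v *)
Require Import Defs.
From HB Require Import structures.
From mathcomp Require Import all_boot all_order all_algebra.
From mathcomp Require Import all_classical all_reals all_analysis.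
From mathcomp Require Import measurable_realfun.
From mathcomp Require Import ring lra.

(** In the coordinates (f'', h'), (g, z), (zeta_omega, zeta_phi), the space H is the
    Hilbert sum of a space of strains and a space of velocities. Up to a bounded
    perturbation (the couplings and the boundary feedback), the operator A maps (a, u)
    to (b, w) when u = K b and K^* w = - (a + S b), where K is a bounded injective map
    which integrates the strain rates and S >= 0 is the viscous damping. The form
    <(a, u), (b, w)> equals - <b, S b>, and the range condition reduces to a coercive
    equation in b, so the theorem of Lumer and Phillips applies; the semigroup is the
    limit of the iterated resolvents J_{2^-k}^{floor(2^k t)}.

    The thresholds only serve to compare the two inner products: Psi(X, X) is twice the
    kinetic inner product of the velocities of X with (e1 f, e2 h, e1 f(l), e2 h(l)),
    and e1 < K_{m,1}, e2 < K_{m,2} give |Psi(X, X)| <= th |X|_1^2 for some th < 1. *)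

Set Implicit Arguments.
Unset Strict Implicit.
Unset Printing Implicit Defensive.

Import Order.TTheory GRing.Theory Num.Theory.
Import numFieldNormedType.Exports.

Local Open Scope classical_set_scope.
Local Open Scope ring_scope.

(** * Inner product spaces *)

(** The obstacle is that the domain of A asks for further derivatives of the sums f'' + eta_om g''
    and h' + eta_ph z' only, never of f'' or h' alone, so its components cannot be treated one at a
    time. Written as K^* w = - (a + S b), the conditions become one equation: K^* integrates momenta
    back from the free end, so the functions in its range have the required derivatives, and its
    integration constants are the tip momenta. The tip velocities zeta_omega, zeta_phi are state
    variables of their own; the boundary feedback is therefore bounded, although g -> g(l) is not
    bounded on L^2.

    The coordinates exist because H^1_L and H^2_L are the ranges of J and J o J, where J integrates
    from 0. This rests on the du Bois-Reymond lemma, hence on explicit bump functions. Density of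
    the domain is not checked on the beam: it follows from completeness, the range condition and the
    injectivity of K and K^*. Inner products are plain functions satisfying a predicate, because the
    same space carries two of them. *)

Record inner_product (R : realType) (V : lmodType R) (ip : V -> V -> R) : Prop := {
  ipC : forall x y, ip x y = ip y x;
  ipZDl : forall a x y z, ip (a *: x + y) z = a * ip x z + ip y z;
  ip_gt0 : forall x, x != 0 -> 0 < ip x x }.

Section inner_product_theory.
Context {R : realType} {V : lmodType R} (ip : V -> V -> R).
Hypothesis ipP : inner_product ip.
Local Notation nrm := (ip_norm ip).
Implicit Types (x y z : V) (u v : nat -> V).

Lemma ip0l z : ip 0 z = 0.
Proof.
have := ipZDl ipP (-1) 0 0 z; rewrite scaler0 addr0 => e.
lra.
Qed.

Lemma ipDl x y z : ip (x + y) z = ip x z + ip y z.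
Proof. by rewrite -[x in LHS]scale1r ipZDl// mul1r. Qed.

Lemma ipZl a x z : ip (a *: x) z = a * ip x z.
Proof. by rewrite -[_ *: _]addr0 ipZDl// ip0l addr0. Qed.

Lemma ipNl x z : ip (- x) z = - ip x z.
Proof. by rewrite -scaleN1r ipZl mulN1r. Qed.

Lemma ip0r z : ip z 0 = 0.
Proof. by rewrite ipC// ip0l. Qed.

Lemma ipDr x y z : ip z (x + y) = ip z x + ip z y.
Proof. by rewrite ipC// ipDl !(ipC ipP z). Qed.

Lemma ipZr a x z : ip z (a *: x) = a * ip z x.
Proof. by rewrite ipC// ipZl (ipC ipP z). Qed.

Lemma ipNr x z : ip z (- x) = - ip z x.
Proof. by rewrite ipC// ipNl (ipC ipP z). Qed.

Definition ipE := (ip0l, ip0r, ipNl, ipNr, ipDl, ipDr, ipZl, ipZr).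

Lemma ip_ge0 x : 0 <= ip x x.
Proof. by have [->|/(ip_gt0 ipP)/ltW//] := eqVneq x 0; rewrite ip0l. Qed.

(** Pairing with an arbitrary vector turns an identity in an abstract module into one in R, where
    [ring], [field] and [lra] apply. Most vector identities below are settled this way. *)
Lemma ip_inj x y : (forall z, ip x z = ip y z) -> x = y.
Proof.
move=> xy; apply/eqP; rewrite -subr_eq0; apply/negPn/negP => /(ip_gt0 ipP).
by rewrite ipDl xy -ipDl addrN ip0l ltxx.
Qed.

Lemma nrm_ge0 x : 0 <= nrm x. Proof. exact: sqrtr_ge0. Qed.

Lemma sqr_nrm x : nrm x ^+ 2 = ip x x.
Proof. by rewrite sqr_sqrtr// ip_ge0. Qed.

Lemma nrm_eq0 x : nrm x = 0 -> x = 0.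
Proof.
move=> x0; apply/eqP/negPn/negP => /(ip_gt0 ipP).
by rewrite -sqr_nrm x0 expr0n ltxx.
Qed.

Lemma nrm0 : nrm 0 = 0. Proof. by rewrite /ip_norm ip0l sqrtr0. Qed.

Lemma nrmZ a x : nrm (a *: x) = `|a| * nrm x.
Proof. by rewrite /ip_norm !ipE mulrA -expr2 sqrtrM ?sqr_ge0// sqrtr_sqr. Qed.

Lemma nrmN x : nrm (- x) = nrm x.
Proof. by rewrite -scaleN1r nrmZ normrN1 mul1r. Qed.

Lemma nrmB x y : nrm (x - y) = nrm (y - x).
Proof. by rewrite -nrmN opprB. Qed.

Lemma nrm_le x y : (nrm x <= nrm y) = (ip x x <= ip y y).
Proof. by rewrite ler_sqrt// ip_ge0. Qed.

(** Expanding the squared norm of |y| x - |x| y gives 2 |x| |y| (|x| |y| - <x, y>) >= 0. Vanishing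
    norms are treated apart, so that |x| |y| can be divided out. *)
Lemma cauchy_schwarz x y : ip x y <= nrm x * nrm y.
Proof.
have [->|y0] := eqVneq y 0; first by rewrite ip0r nrm0 mulr0.
have yy := ip_gt0 ipP y0.
have ny : 0 < nrm y by rewrite sqrtr_gt0.
have [xn|nx] := leP (nrm x) 0.
  have x0 : nrm x = 0 by apply/eqP; rewrite eq_le xn nrm_ge0.
  by rewrite (nrm_eq0 x0) ip0l nrm0 mul0r.
have := ip_ge0 ((nrm y) *: x - (nrm x) *: y).
rewrite !ipE (ipC ipP y x) -!sqr_nrm => H.
have {}H : 0 <= 2 * (nrm x * nrm y) * (nrm x * nrm y - ip x y) by lra.
rewrite -subr_ge0; move: H; rewrite pmulr_rge0//.
by rewrite mulr_gt0// mulr_gt0.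
Qed.

Lemma abs_cauchy_schwarz x y : `|ip x y| <= nrm x * nrm y.
Proof.
rewrite ler_norml cauchy_schwarz andbT lerNl -ipNl -(nrmN x).
exact: cauchy_schwarz.
Qed.

Lemma sqr_cauchy_schwarz x y : ip x y ^+ 2 <= ip x x * ip y y.
Proof.
rewrite -!sqr_nrm -exprMn -(real_normK (num_real (ip x y))).
by rewrite lerXn2r ?nnegrE ?mulr_ge0 ?nrm_ge0// abs_cauchy_schwarz.
Qed.

Lemma ler_nrmD x y : nrm (x + y) <= nrm x + nrm y.
Proof.
rewrite -(@ler_pXn2r _ 2)// ?nnegrE ?addr_ge0 ?nrm_ge0//.
rewrite sqr_nrm !ipE (ipC ipP y x) sqrrD !sqr_nrm.
have := cauchy_schwarz x y; lra.
Qed.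

Lemma ler_nrm_dist y x z : nrm (x - z) <= nrm (x - y) + nrm (y - z).
Proof.
have -> : x - z = (x - y) + (y - z) by rewrite addrA subrK.
exact: ler_nrmD.
Qed.

Definition tends u x := nrm (u n - x) @[n --> \oo] --> 0.

Definition cauchy_ip u := forall e, 0 < e -> exists N, forall m n,
  (N <= m)%N -> (N <= n)%N -> nrm (u m - u n) < e.

Lemma tends_squeeze u x (b : nat -> R) : (forall n, nrm (u n - x) <= b n) ->
  b n @[n --> \oo] --> 0 -> tends u x.
Proof.
move=> ub b0; apply: (squeeze_cvgr _ (cvg_cst 0) b0).
by apply: nearW => n; rewrite nrm_ge0 ub.
Qed.

Lemma tendsP u x : tends u x <->
  forall e, 0 < e -> exists N, forall n, (N <= n)%N -> nrm (u n - x) < e.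
Proof.
split=> [/cvgrPdist_lt H e /H [N _ HN]|H].
  by exists N => n /HN /=; rewrite sub0r normrN ger0_norm// nrm_ge0.
apply/cvgrPdist_lt => e /H [N HN]; exists N => // n /HN /=.
by rewrite sub0r normrN ger0_norm// nrm_ge0.
Qed.

Lemma tends_cst x : tends (fun=> x) x.
Proof. by rewrite /tends subrr nrm0; exact: cvg_cst. Qed.

Lemma tendsZD a u v x y : tends u x -> tends v y ->
  tends (fun n => a *: u n + v n) (a *: x + y).
Proof.
move=> ux vy.
apply: (tends_squeeze (b := fun n => `|a| * nrm (u n - x) + nrm (v n - y))).
  move=> n; rewrite -nrmZ; apply: le_trans (ler_nrmD _ _).
  by rewrite scalerBr opprD addrACA.
rewrite -[0]addr0 -[X in _ --> X + _](mulr0 `|a|).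
by apply: cvgD => //; apply: cvgMr.
Qed.

Lemma tendsB u v x y : tends u x -> tends v y ->
  tends (fun n => u n - v n) (x - y).
Proof.
move=> ux vy; have := tendsZD (-1) vy ux; rewrite /tends scaleN1r addrC.
by under eq_cvg do rewrite scaleN1r (addrC (- _)).
Qed.

Lemma tends_nrm u x : tends u x -> nrm (u n) @[n --> \oo] --> nrm x.
Proof.
move=> ux; apply/cvgrPdist_lt => e e0.
have /cvgrPdist_lt/(_ e e0) := ux; apply: filterS => n.
rewrite sub0r normrN ger0_norm ?nrm_ge0//; apply: le_lt_trans.
rewrite ler_norml; apply/andP; split.
  have := ler_nrm_dist x (u n) 0; rewrite !subr0; lra.
have := ler_nrm_dist (u n) x 0; rewrite !subr0 nrmB; lra.
Qed.

Lemma tends_le u x (b : nat -> R) c : tends u x -> (forall n, nrm (u n) <= b n) ->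
  b n @[n --> \oo] --> c -> nrm x <= c.
Proof.
move=> /tends_nrm ux ub bc; rewrite -(cvg_lim _ ux)// -(cvg_lim _ bc)//.
apply: ler_lim; [by apply/cvg_ex; eexists; exact: ux| |exact: nearW].
by apply/cvg_ex; eexists; exact: bc.
Qed.

Lemma tends_uniq u x y : tends u x -> tends u y -> x = y.
Proof.
move=> ux uy; apply/eqP; rewrite -subr_eq0; apply/eqP/nrm_eq0/eqP.
rewrite eq_le nrm_ge0 andbT.
have := tendsZD (-1) ux uy.
rewrite scaleN1r addrC -(nrmB y) => /(tends_le (b := fun=> 0)); apply.
  by move=> n; rewrite scaleN1r addNr nrm0.
exact: cvg_cst.
Qed.

Lemma geometric_dist u (K q : R) m n : 0 <= q < 1 ->
  (forall n, nrm (u n.+1 - u n) <= K * q ^+ n) -> (m <= n)%N ->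
  nrm (u n - u m) <= K / (1 - q) * q ^+ m.
Proof.
move=> /andP[q0 q1] uq /subnKC <-; pose C := K / (1 - q).
(* The bound is kept in telescoped form: K / (1 - q) * q ^ m alone would not be preserved by the
   induction. *)
have H p : nrm (u (m + p)%N - u m) <= C * (q ^+ m - q ^+ (m + p)).
  elim: p => [|p IH]; first by rewrite addn0 !subrr mulr0 nrm0.
  rewrite addnS; apply: le_trans (ler_nrm_dist (u (m + p)%N) _ _) _.
  have := uq (m + p)%N.
  suff -> : C * (q ^+ m - q ^+ (m + p).+1) =
    K * q ^+ (m + p) + C * (q ^+ m - q ^+ (m + p)) by move=> ?; apply: lerD.
  by rewrite /C exprS; field; rewrite subr_eq0 gt_eqF.
have K0 : 0 <= K.
  by have := uq 0%N; rewrite expr0 mulr1; apply: le_trans; exact: nrm_ge0.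
apply: le_trans (H _) _; apply: ler_wpM2l; first by rewrite divr_ge0// subr_ge0 ltW.
by rewrite gerBl exprn_ge0.
Qed.

Lemma geometric_cauchy u (K q : R) : 0 <= q < 1 ->
  (forall n, nrm (u n.+1 - u n) <= K * q ^+ n) -> cauchy_ip u.
Proof.
move=> q01 uq e e0; pose C := K / (1 - q); have /andP[q0 q1] := q01.
have K0 : 0 <= K.
  by have := uq 0%N; rewrite expr0 mulr1; apply: le_trans; exact: nrm_ge0.
have C0 : 0 <= C by rewrite divr_ge0// subr_ge0 ltW.
have := @cvg_expr R q; rewrite ger0_norm// => /(_ q1).
have C1 : 0 < e / (C + 1) by rewrite divr_gt0// ltr_wpDl.
move=> /cvgrPdist_lt/(_ _ C1)[N _ HN]; exists N.
have {}H p n : (N <= p)%N -> (p <= n)%N -> nrm (u n - u p) < e.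
  move=> /HN /=; rewrite sub0r normrN ger0_norm ?exprn_ge0// => qp pn.
  apply: le_lt_trans (geometric_dist q01 uq pn) _.
  move: qp; rewrite -/C ltr_pdivlMr ?ltr_wpDl//; have := exprn_ge0 p q0; nra.
move=> m n Nm Nn; have [mn|/ltnW nm] := leqP m n; last exact: H.
by rewrite nrmB; exact: H.
Qed.

End inner_product_theory.

Definition complete_ip (R : realType) (V : lmodType R) (ip : V -> V -> R) :=
  forall u, cauchy_ip ip u -> exists x, tends ip u x.

(** A Cauchy sequence with a convergent subsequence converges, and a subsequence can be extracted
    whose successive distances are at most 2^-k. Completeness of L^2 is then checked on such fast
    sequences. *)
Lemma geometric_complete (R : realType) (V : lmodType R) (ip : V -> V -> R) :
  inner_product ip ->
  (forall u, (forall n, ip_norm ip (u n.+1 - u n) <= 2^-1 ^+ n) ->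
    exists x, tends ip u x) -> complete_ip ip.
Proof.
move=> ipP fast u uc.
have q0 n : 0 < 2^-1 ^+ n :> R by rewrite exprn_gt0// invr_gt0.
have /choice[N HN] : forall k, exists N, forall m n, (N <= m)%N -> (N <= n)%N ->
    ip_norm ip (u m - u n) < 2^-1 ^+ k by move=> k; exact: uc (q0 k).
(* Summing the moduli [N i] makes the indices nondecreasing and keeps [N k <= s k]. *)
pose s k := (\sum_(i < k.+1) N i)%N.
have sN k : (N k <= s k)%N by rewrite /s big_ord_recr leq_addl.
have [|x sx] := fast (fun k => u (s k)).
  move=> k; apply/ltW/HN => //; apply: leq_trans (sN k) _.
  by rewrite /s [leqRHS]big_ord_recr leq_addr.
exists x; apply/tendsP => e e0; have e20 : 0 < e / 2 by lra.
have /tendsP/(_ _ e20)[K HK] := sx.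
have q1 : `|2^-1 : R| < 1 by rewrite ger0_norm; lra.
have /cvgrPdist_lt/(_ _ e20)[M _ HM] := cvg_expr q1.
pose k := maxn K M.
have := HM k (leq_maxr _ _); rewrite /= sub0r normrN (ger0_norm (ltW (q0 k))) => qk.
exists (N k) => n Nn; apply: le_lt_trans (ler_nrm_dist ipP (u (s k)) _ _) _.
have := HN k n (s k) Nn (sN k); have := HK k (leq_maxl _ _); lra.
Qed.

Definition bounded_op (R : realType) (V W : lmodType R) (ipv : V -> V -> R)
    (ipw : W -> W -> R) (f : V -> W) :=
  linear f /\ exists2 C, 0 <= C & forall x, ip_norm ipw (f x) <= C * ip_norm ipv x.

Section bounded_op.
Context {R : realType} {U V W : lmodType R}.
Variables (ipu : U -> U -> R) (ipv : V -> V -> R) (ipw : W -> W -> R).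
Hypothesis ipwP : inner_product ipw.

Lemma bounded_op_id : bounded_op ipv ipv id.
Proof. by split=> //; exists 1 => // x; rewrite mul1r. Qed.

Lemma bounded_op_comp g f : bounded_op ipv ipw g -> bounded_op ipu ipv f ->
  bounded_op ipu ipw (fun x => g (f x)).
Proof.
move=> [gl [C C0 gC]] [fl [D D0 fD]]; split.
  by move=> a x y /=; rewrite fl gl.
exists (C * D) => [|x]; first exact: mulr_ge0.
by apply: le_trans (gC _) _; rewrite -mulrA ler_wpM2l.
Qed.

Lemma bounded_opD f g : bounded_op ipv ipw f -> bounded_op ipv ipw g ->
  bounded_op ipv ipw (fun x => f x + g x).
Proof.
move=> [fl [C C0 fC]] [gl [D D0 gD]]; split.
  by move=> a x y /=; rewrite fl gl scalerDr addrACA.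
exists (C + D) => [|x]; first exact: addr_ge0.
by apply: le_trans (ler_nrmD ipwP _ _) _; rewrite mulrDl lerD.
Qed.

Lemma bounded_opZ c f : bounded_op ipv ipw f -> bounded_op ipv ipw (fun x => c *: f x).
Proof.
move=> [fl [C C0 fC]]; split.
  by move=> a x y /=; rewrite fl scalerDr !scalerA mulrC.
exists (`|c| * C) => [|x]; first exact: mulr_ge0.
by rewrite nrmZ// -mulrA ler_wpM2l.
Qed.

Lemma bounded_opN f : bounded_op ipv ipw f -> bounded_op ipv ipw (fun x => - f x).
Proof.
move=> /(bounded_opZ (-1)) [fl fC]; split.
  by move=> a x y; have := fl a x y; rewrite !scaleN1r.
by case: fC => C C0 fC; exists C => // x; have := fC x; rewrite scaleN1r.
Qed.

Lemma bounded_op0 : bounded_op ipv ipw (fun=> 0).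
Proof.
split; first by move=> a x y; rewrite scaler0 addr0.
by exists 0 => // x; rewrite nrm0// mul0r.
Qed.

End bounded_op.

(** * Contraction semigroups *)

Section lumer_phillips.
Context {R : realType} {V : lmodType R} (ip : V -> V -> R).
Hypotheses (ipP : inner_product ip) (ip_complete : complete_ip ip).
Local Notation nrm := (ip_norm ip).
(** The operator is given by its graph. The range condition is assumed for every h > 0 and
    single-valuedness at 0; density of the domain is a consequence, proved in [graph_dense]. *)
Variable G : V -> V -> Prop.
Hypotheses (Glin : forall a x y x' y', G x y -> G x' y' -> G (a *: x + x') (a *: y + y'))
  (Gdis : forall x y, G x y -> ip x y <= 0)
  (Grange : forall (h : R) (v : V), 0 < h -> exists x y, G x y /\ v = x - h *: y)
  (Gfun : forall y, G 0 y -> y = 0).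
Implicit Types (x y z v : V) (h a t e : R).

Local Notation ipE := (ipE ipP).

Lemma graph0 : G 0 0.
Proof.
have [x [y [Gxy _]]] := Grange 0 (@ltr01 R).
by have := Glin (-1) Gxy Gxy; rewrite !scaleN1r !addNr.
Qed.

Lemma graphZ a x y : G x y -> G (a *: x) (a *: y).
Proof. by move=> /(Glin a)/(_ graph0); rewrite !addr0. Qed.

Lemma graphD x y x' y' : G x y -> G x' y' -> G (x + x') (y + y').
Proof. by move=> /(Glin 1) H /H; rewrite !scale1r. Qed.

Lemma graphB x y x' y' : G x y -> G x' y' -> G (x - x') (y - y').
Proof. by move=> Gxy /(graphZ (-1)); rewrite !scaleN1r; exact: graphD. Qed.

(** |x - h y|^2 = |x|^2 - 2 h <x, y> + h^2 |y|^2, and the last two terms are nonnegative. Uniqueness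
    and contractivity of the resolvent both come from this. *)
Lemma graph_nrm_le h x y : 0 < h -> G x y -> nrm x <= nrm (x - h *: y).
Proof.
move=> h0 /Gdis Gxy; rewrite nrm_le// !ipE (ipC ipP y x).
have := ip_ge0 ipP y; nra.
Qed.

(** This is (1 - h A)^-1 v: in x - h y = v the image y is eliminated. For h > 0 the range condition
    excludes the default branch of [xget]. *)
Definition resolvent h v : V := xget 0 [set x | G x (h^-1 *: (x - v))].

Lemma resolvent_graph h v : 0 < h -> G (resolvent h v) (h^-1 *: (resolvent h v - v)).
Proof.
move=> h0; rewrite /resolvent; case: xgetP => [x _ //|/=].
have [x [y [Gxy ->]]] := Grange v h0.
move=> /(_ x); rewrite opprB addrCA subrr addr0 scalerA mulVf ?gt_eqF//.
by rewrite scale1r.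
Qed.

Lemma resolventK h x y : 0 < h -> G x y -> resolvent h (x - h *: y) = x.
Proof.
move=> h0 Gxy; have := graphB (resolvent_graph (x - h *: y) h0) Gxy.
set r := resolvent _ _ => /(graph_nrm_le h0).
suff -> : r - x - h *: (h^-1 *: (r - (x - h *: y)) - y) = 0.
  rewrite nrm0// => H; apply/eqP; rewrite -subr_eq0; apply/eqP.
  by apply: (nrm_eq0 ipP); apply/eqP; rewrite eq_le H nrm_ge0.
rewrite scalerBr scalerA mulfV ?gt_eqF// scale1r.
by apply: (ip_inj ipP) => z; rewrite !ipE; ring.
Qed.

Lemma resolvent_eq h v y : 0 < h -> G y (h^-1 *: (y - v)) -> resolvent h v = y.
Proof.
move=> h0 /(resolventK h0) e; rewrite -[RHS]e; congr resolvent.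
by rewrite scalerA mulfV ?gt_eqF// scale1r opprB addrCA subrr addr0.
Qed.

Lemma resolvent_linear h : 0 < h -> linear (resolvent h).
Proof.
move=> h0 a u v; apply: resolvent_eq => //.
have := Glin a (resolvent_graph u h0) (resolvent_graph v h0).
congr G; apply: (ip_inj ipP) => z; rewrite !ipE; ring.
Qed.

Lemma resolvent_le h v : 0 < h -> nrm (resolvent h v) <= nrm v.
Proof.
move=> h0; apply: le_trans (graph_nrm_le h0 (resolvent_graph v h0)) _.
by rewrite scalerA mulfV ?gt_eqF// scale1r opprB addrCA subrr addr0.
Qed.

Lemma resolvent_sub h x y : 0 < h -> G x y ->
  resolvent h x - x = h *: resolvent h y.
Proof.
move=> h0 Gxy; suff -> : resolvent h y = h^-1 *: (resolvent h x - x).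
  by rewrite scalerA mulfV ?gt_eqF// scale1r.
apply: resolvent_eq => //.
by apply: graphZ; apply: graphB => //; exact: resolvent_graph.
Qed.

Lemma graph_resolvent h x y : 0 < h -> G x y -> G (resolvent h x) (resolvent h y).
Proof.
move=> h0 Gxy; have := resolvent_graph x h0.
by rewrite (resolvent_sub h0 Gxy) scalerA mulVf ?gt_eqF// scale1r.
Qed.

(** The range condition at h = 1 provides a pair (x', y') of the graph with x' - y' = x - y. By
    [graph_nrm_le] the distance from u n to x' is at most that from u n - w n to x - y, so u n tends
    to x' and x' = x. *)
Lemma graph_closed (u w : nat -> V) x y : (forall n, G (u n) (w n)) ->
  tends ip u x -> tends ip w y -> G x y.
Proof.
move=> Guw ux wy; have [x' [y' [Gxy e]]] := Grange (x - y) (@ltr01 R).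
rewrite scale1r in e.
suff xx' : x = x'.
  by move: e Gxy; rewrite -xx' => /addrI/oppr_inj <-.
apply: (tends_uniq ipP ux).
apply: (tends_squeeze (b := fun n => nrm (u n - w n - (x - y)))).
- move=> n; rewrite e.
  apply: le_trans (graph_nrm_le (@ltr01 R) (graphB (Guw n) Gxy)) _.
  rewrite scale1r le_eqVlt; apply/orP; left; apply/eqP; congr nrm.
  by apply: (ip_inj ipP) => z; rewrite !ipE; ring.
- exact: tendsB.
Qed.

(* For mu < la the dissipativity of A at the points u and v yields
   |u - v|^2 <= (la - mu) / (la + mu) * (|u|^2 - |v|^2). *)
Lemma resolvent_dist (la mu : R) v : 0 < mu -> mu < la ->
  nrm ((resolvent la v - v) - (resolvent mu v - v)) ^+ 2
  <= nrm (resolvent la v - v) ^+ 2 - nrm (resolvent mu v - v) ^+ 2.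
Proof.
move=> mu0 lm; have la0 : 0 < la by lra.
have := Gdis (graphB (resolvent_graph v la0) (resolvent_graph v mu0)).
have -> : resolvent la v - resolvent mu v =
  (resolvent la v - v) - (resolvent mu v - v).
  by rewrite opprB addrA subrK.
move: (resolvent la v - v) (resolvent mu v - v) => a b.
rewrite !(sqr_nrm ipP) => H; move: H; rewrite !ipE (ipC ipP b a) => H.
have : la * mu * (la^-1 * ip a a - mu^-1 * ip a b - (la^-1 * ip a b - mu^-1 * ip b b)) <= 0.
  by rewrite pmulr_rle0 ?mulr_gt0//; lra.
have -> : la * mu * (la^-1 * ip a a - mu^-1 * ip a b - (la^-1 * ip a b - mu^-1 * ip b b))
  = mu * ip a a + la * ip b b - (la + mu) * ip a b.
  by field; rewrite !gt_eqF.
have := ip_ge0 ipP (a - b); rewrite !ipE (ipC ipP b a) => H1 H2.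
nra.
Qed.

(** With u n = J_h v - v and h = 1 / (n + 1), the norms |u n| decrease, so [resolvent_dist] makes u
    n a Cauchy sequence, with a limit w. The pairs (h (u n + v), u n) lie in the graph and tend to
    (0, w); closedness and single-valuedness at 0 give w = 0. Density of the domain comes from
    here. *)
Lemma resolvent_tends v : tends ip (fun n => resolvent n.+1%:R^-1 v) v.
Proof.
pose u n := resolvent n.+1%:R^-1 v - v.
have hp n : 0 < n.+1%:R^-1 :> R by rewrite invr_gt0 ltr0n.
have dist m n : (m <= n)%N -> nrm (u m - u n) ^+ 2 <= nrm (u m) ^+ 2 - nrm (u n) ^+ 2.
  rewrite leq_eqVlt => /predU1P[->|mn]; first by rewrite !subrr nrm0// expr0n.
  by apply: resolvent_dist => //; rewrite ltf_pV2 ?posrE ?ltr0n// ltr_nat ltnS.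
have dec : {homo (fun n => nrm (u n) ^+ 2) : m n / (m <= n)%N >-> n <= m}.
  by move=> m n /dist; have := sqr_ge0 (nrm (u m - u n)); lra.
have cvu : cvgn (fun n => nrm (u n) ^+ 2).
  apply: nonincreasing_is_cvgn => //.
  by exists 0 => _ [n _ <-]; exact: sqr_ge0.
have /(ip_complete)[w uw] : cauchy_ip ip u.
  move=> e e0; have e20 : 0 < e ^+ 2 / 2 by rewrite divr_gt0// exprn_gt0.
  have /cvgrPdist_lt/(_ _ e20)[N _ HN] := cvu.
  exists N => m n Nm Nn.
  have H p q : (N <= p)%N -> (p <= q)%N -> nrm (u p - u q) < e.
    move=> Np pq; rewrite -(@ltr_pXn2r _ 2)// ?nnegrE ?nrm_ge0 ?ltW//.
    apply: le_lt_trans (dist _ _ pq) _.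
    have := HN _ Np; have := HN _ (leq_trans Np pq).
    by rewrite /= !ltr_norml => /andP[? ?] /andP[? ?]; lra.
  by have [mn|/ltnW nm] := leqP m n; [exact: H|rewrite nrmB//; exact: H].
have w0 : w = 0.
  apply: Gfun; apply: (@graph_closed (fun n => n.+1%:R^-1 *: (u n + v)) u) => //.
    move=> n; have := graphZ n.+1%:R^-1 (resolvent_graph v (hp n)).
    by rewrite invrK scalerA mulVf// scale1r /u subrK.
  have /tendsP ub : tends ip (fun n => u n + v) (w + v).
    have := tendsZD ipP 1 uw (tends_cst ipP v); rewrite scale1r /tends.
    by under eq_cvg do rewrite scale1r.
  apply/tendsP => // e e0.
  have [N HN] := ub _ (@ltr01 R).
  have C0 : 0 < 1 + nrm (w + v) by have := nrm_ge0 ip (w + v); lra.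
  have [M [_ HM]] : exists M, True /\ forall n, (M <= n)%N -> n.+1%:R^-1 < e / (1 + nrm (w
    + v)).
    have /cvgrPdist_lt/(_ _ (divr_gt0 e0 C0))[M _ HM] := @cvg_harmonic R.
    by exists M; split => // n /HM /=; rewrite sub0r normrN ger0_norm// ltW.
  exists (maxn N M) => n; rewrite geq_max => /andP[/HN H1 /HM H2].
  rewrite subr0 nrmZ// gtr0_norm//.
  have H3 : nrm (u n + v) <= 1 + nrm (w + v).
    have := ler_nrm_dist ipP (w + v) (u n + v) 0; rewrite !subr0; lra.
  apply: le_lt_trans (_ : n.+1%:R^-1 * (1 + nrm (w + v)) < e).
    by rewrite ler_wpM2l// ltW.
  by rewrite -ltr_pdivlMr.
by move: uw; rewrite w0 /tends; under eq_cvg do rewrite subr0.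
Qed.

Lemma graph_dense v (e : R) : 0 < e -> exists x y, G x y /\ nrm (v - x) < e.
Proof.
have /tendsP/(_ e) := resolvent_tends v; move=> H /H[N /(_ N (leqnn N))].
rewrite nrmB// => H1; have hp : 0 < N.+1%:R^-1 :> R by rewrite invr_gt0 ltr0n.
by do 2!eexists; split; [exact: resolvent_graph hp|exact: H1].
Qed.

(** If x is in the domain with image y, then J_h x is in the domain of the square and lies within h
    |y| of x; the choice of h makes h |y| < e / 2. *)
Lemma graph2_dense v (e : R) : 0 < e ->
  exists x y z, [/\ G x y, G y z & nrm (v - x) < e].
Proof.
move=> e0; have e20 : 0 < e / 2 by lra.
have [x [y [Gxy vx]]] := graph_dense v e20.
pose h := e / 2 / (1 + nrm y).
have y1 : 0 < 1 + nrm y by have := nrm_ge0 ip y; lra.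
have h0 : 0 < h by rewrite divr_gt0.
exists (resolvent h x), (resolvent h y), (h^-1 *: (resolvent h y - y)); split.
- exact: graph_resolvent.
- exact: resolvent_graph.
apply: le_lt_trans (ler_nrm_dist ipP x _ _) _.
suff : nrm (x - resolvent h x) < e / 2 by lra.
rewrite nrmB// (resolvent_sub h0 Gxy) nrmZ// gtr0_norm//.
apply: le_lt_trans (_ : h * nrm y < _).
  by rewrite ler_wpM2l ?resolvent_le// ltW.
rewrite /h mulrAC ltr_pdivrMr//; nra.
Qed.

Lemma iter_resolvent_linear h n : 0 < h -> linear (iter n (resolvent h)).
Proof. by move=> h0 a u v; elim: n => //= n ->; exact: resolvent_linear. Qed.

Lemma iter_resolvent_le h n v : 0 < h -> nrm (iter n (resolvent h) v) <= nrm v.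
Proof.
move=> h0; elim: n => //= n; apply: le_trans; exact: resolvent_le.
Qed.

Lemma iter_resolventB h n u v : 0 < h ->
  iter n (resolvent h) u - iter n (resolvent h) v = iter n (resolvent h) (u - v).
Proof.
move=> h0; have := iter_resolvent_linear n h0 (-1) v u.
by rewrite !scaleN1r !(addrC (- _)) => ->.
Qed.

Lemma graph_iter h n x y : 0 < h -> G x y ->
  G (iter n (resolvent h) x) (iter n (resolvent h) y).
Proof. by move=> h0 Gxy; elim: n => //= n; exact: graph_resolvent. Qed.

Lemma iter_resolvent_sub h n x y : 0 < h -> G x y ->
  nrm (iter n (resolvent h) x - x) <= n%:R * h * nrm y.
Proof.
move=> h0 Gxy; elim: n => [|n IH] /=; first by rewrite subrr nrm0// !mul0r.
apply: le_trans (ler_nrm_dist ipP (iter n (resolvent h) x) _ _) _.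
rewrite -(natr1 n) !mulrDl mul1r addrC lerD//.
rewrite (resolvent_sub h0 (graph_iter n h0 Gxy)) nrmZ// gtr0_norm//.
apply: ler_wpM2l; first exact: ltW.
exact: le_trans (resolvent_le _ h0) (iter_resolvent_le _ _ h0).
Qed.

(** Each step adds h (J^k y - y) to the remainder. Since y need not be in the domain, it is compared
    with a point y' of the domain: J^k moves y' by at most k h |y''|, and replacing y by y' costs 2
    |y - y'|. *)
Lemma iter_resolvent_taylor h n x y y' y'' : 0 < h -> G x y -> G y' y'' ->
  nrm (iter n (resolvent h) x - x - (n%:R * h) *: y)
  <= n%:R * h * (2 * nrm (y - y') + n%:R * h * nrm y'').
Proof.
move=> h0 Gxy Gy; elim: n => [|n IH] /=.
  by rewrite subrr !mul0r scale0r subr0 nrm0.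
set r := iter n _; set J := resolvent h in r *.
have -> : J (r x) - x - (n.+1%:R * h) *: y =
    (r x - x - (n%:R * h) *: y) + h *: (J (r y) - y).
  rewrite -(subrK (r x) (J (r x))) (resolvent_sub h0 (graph_iter n h0 Gxy)).
  by apply: (ip_inj ipP) => z; rewrite !ipE -natr1; ring.
apply: le_trans (ler_nrmD ipP _ _) _; rewrite nrmZ// gtr0_norm//.
have H : nrm (J (r y) - y) <= 2 * nrm (y - y') + n.+1%:R * h * nrm y''.
  have := iter_resolvent_sub n.+1 h0 Gy; have := iter_resolvent_le n.+1 (y - y') h0.
  rewrite -(iter_resolventB _ _ _ h0) /= -/J -/r.
  set p := J (r y); set q := J (r y') => H1 H2.
  have := ler_nrm_dist ipP q p y; have := ler_nrm_dist ipP y' q y.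
  rewrite (nrmB ipP y' y); lra.
have {}H := ler_wpM2l (ltW h0) H.
have := nrm_ge0 ip y''; have := nrm_ge0 ip (y - y'); have := ler0n R n.
move: IH H; rewrite -(natr1 n) => IH H n0 y0 z0.
have := mulr_ge0 (mulr_ge0 n0 (mulr_ge0 (ltW h0) (ltW h0))) z0.
move: (nrm _) (nrm _) IH H y0 z0 => A B; nra.
Qed.

(** One step of length 2a against two of length a. Since J_{2a} inverts 1 - 2a A, J_a^2 x = J_{2a}
    (J_a^2 x - 2a J_a^2 y), and the difference is J_{2a} applied to x - J_a^2 x + 2a J_a^2 y = a^2
    J_a^2 z. Over about t / a steps the local error a^2 accumulates to order a. *)
Lemma resolvent_half (a : R) x y z : 0 < a -> G x y -> G y z ->
  nrm (resolvent (2 * a) x - resolvent a (resolvent a x)) <= a ^+ 2 * nrm z.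
Proof.
move=> a0 Gxy Gyz; have h0 : 0 < 2 * a by rewrite mulr_gt0.
set J := resolvent a.
have GJ := graph_resolvent a0 Gxy; have GJ2 := graph_resolvent a0 GJ.
rewrite -/J in GJ GJ2.
rewrite -{1}(resolventK h0 GJ2).
have := resolvent_linear h0 (-1) (J (J x) - (2 * a) *: J (J y)) x.
rewrite !scaleN1r addrC => <-; apply: le_trans (resolvent_le _ h0) _.
suff -> : - (J (J x) - (2 * a) *: J (J y)) + x = (a ^+ 2) *: J (J z).
  rewrite nrmZ// ger0_norm ?sqr_ge0// ler_wpM2l ?sqr_ge0//.
  by rewrite (le_trans (resolvent_le _ a0))// resolvent_le.
have E1 := resolvent_sub a0 Gxy; have E2 := resolvent_sub a0 GJ.
have E3 := resolvent_sub a0 (graph_resolvent a0 Gyz).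
rewrite -/J in E1 E2 E3.
have -> : a ^+ 2 *: J (J z) = a *: (a *: J (J z)) by rewrite scalerA.
rewrite -E3 -(subrK (J x) (J (J x))) E2 -(subrK x (J x)) E1.
by apply: (ip_inj ipP) => w; rewrite !ipE; ring.
Qed.

Lemma iter_resolvent_half a n x y z : 0 < a -> G x y -> G y z ->
  nrm (iter n (resolvent (2 * a)) x - iter n.*2 (resolvent a) x)
  <= n%:R * (a ^+ 2 * nrm z).
Proof.
move=> a0 Gxy Gyz; have h0 : 0 < 2 * a by rewrite mulr_gt0.
elim: n => [|n IH]; first by rewrite subrr nrm0// mul0r.
rewrite doubleS !iterS.
apply: le_trans (ler_nrm_dist ipP (resolvent (2 * a) (iter n.*2 (resolvent a) x)) _ _) _.
rewrite -[in leRHS](natr1 n) [leRHS]mulrDl mul1r lerD//.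
  rewrite (_ : _ - _ = resolvent (2 * a) (iter n (resolvent (2 * a)) x - iter n.*2
    (resolvent a) x)).
    exact: le_trans (resolvent_le _ h0) IH.
  exact: (@iter_resolventB _ 1 _ _ h0).
apply: le_trans (resolvent_half a0 (graph_iter n.*2 a0 Gxy) (graph_iter n.*2 a0 Gyz)) _.
by rewrite ler_wpM2l ?sqr_ge0// iter_resolvent_le.
Qed.

(** Dyadic step sizes allow consecutive approximations to be compared by [resolvent_half]: when the
    step is halved, n steps become 2n or 2n + 1. *)
Definition mesh (k : nat) : R := 2^-1 ^+ k.

Definition steps (t : R) (k : nat) : nat := Num.truncn (t / mesh k).

Lemma mesh_gt0 k : 0 < mesh k. Proof. by rewrite exprn_gt0// invr_gt0. Qed.

Lemma meshS k : mesh k = 2 * mesh k.+1.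
Proof. by rewrite /mesh exprS mulrA mulfV ?mul1r. Qed.

Lemma mesh_cvg0 : mesh k @[k --> \oo] --> 0.
Proof. by apply: cvg_expr; rewrite ger0_norm; lra. Qed.

Lemma stepsP t k : 0 <= t -> t - mesh k < (steps t k)%:R * mesh k <= t.
Proof.
move=> t0; have m0 := mesh_gt0 k.
have := truncn_itv (divr_ge0 t0 (ltW m0)); rewrite -/(steps t k).
by rewrite ler_pdivlMr// ltr_pdivrMr// -natr1 mulrDl mul1r => /andP[? ?]; apply/andP;
  split; lra.
Qed.

Lemma stepsS t k : 0 <= t -> exists b : bool, steps t k.+1 = (b + (steps t k).*2)%N.
Proof.
move=> t0; have := stepsP k t0; have := stepsP k.+1 t0; rewrite (meshS k).
have := mesh_gt0 k.+1; move: (mesh k.+1) => a a0.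
move: (steps t k) (steps t k.+1) => n m /andP[A1 A2] /andP[B1 B2].
have C1 : (m%:R < (n.*2 + 2)%:R :> R).
  by rewrite -(ltr_pM2r a0) natrD -mul2n natrM; lra.
have C2 : ((n.*2)%:R < m.+1%:R :> R).
  by rewrite -(ltr_pM2r a0) -(natr1 m) -mul2n natrM; lra.
move: C1 C2; rewrite !ltr_nat => C1 C2; exists (m == (n.*2).+1).
case: eqP => [->//|/eqP C3]; rewrite add0n.
by apply/eqP; rewrite eqn_leq; move: C1 C2 C3; rewrite addn2 !ltnS leq_eqVlt =>
  /orP[->//|]; rewrite ltnS => -> ->.
Qed.

Definition approx t k x : V := iter (steps t k) (resolvent (mesh k)) x.

(** With a = 2^-(k+1), the possible extra step costs a |y|, and halving the at most t / (2a) steps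
    of length 2a costs at most t a |z| / 2. The total is geometric in k, hence summable. *)
Lemma approx_step t k x y z : 0 <= t -> G x y -> G y z ->
  nrm (approx t k.+1 x - approx t k x) <= (nrm y + t * nrm z) * 2^-1 ^+ k.
Proof.
move=> t0 Gxy Gyz; rewrite /approx; have [b ->] := stepsS k t0.
have a0 := mesh_gt0 k.+1; have /andP[_ H] := stepsP k t0.
rewrite iterD; apply: le_trans (ler_nrm_dist ipP (iter (steps t k).*2 (resolvent (mesh
  k.+1)) x) _ _) _.
rewrite mulrDl; apply: lerD.
  apply: le_trans (iter_resolvent_sub b a0 (graph_iter _ a0 Gxy)) _.
  rewrite [leRHS]mulrC; apply: ler_pM; rewrite ?nrm_ge0 ?mulr_ge0 ?ler0n ?(ltW a0)//;
    last exact: iter_resolvent_le.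
  apply: le_trans (_ : 1 * mesh k.+1 <= _); first by rewrite ler_wpM2r ?(ltW a0)//; case: b.
  by rewrite mul1r -/(mesh k) (meshS k); lra.
rewrite nrmB// (meshS k); apply: le_trans (iter_resolvent_half _ a0 Gxy Gyz) _.
move: H; rewrite -/(mesh k) (meshS k); have := nrm_ge0 ip z.
move: (_%:R) (nrm z) (mesh k.+1) a0 => n N m a0 N0 H.
have := ler_wpM2r (mulr_ge0 N0 (ltW a0)) H.
have := mulr_ge0 t0 (mulr_ge0 N0 (ltW a0)).
lra.
Qed.

Lemma approx_le t k x : nrm (approx t k x) <= nrm x.
Proof. exact: iter_resolvent_le (mesh_gt0 k). Qed.

Lemma approxB t k x y : approx t k x - approx t k y = approx t k (x - y).
Proof. exact: iter_resolventB (mesh_gt0 k). Qed.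

(** The approximations are contractions, so an e / 3 argument extends the estimate from the domain
    of the square, which is dense, to every x. *)
Lemma approx_cauchy t x : 0 <= t -> cauchy_ip ip (fun k => approx t k x).
Proof.
move=> t0 e e0; have e30 : 0 < e / 3 by lra.
have [x' [y [z [Gxy Gyz xx']]]] := graph2_dense x e30.
have q01 : 0 <= (2^-1 : R) < 1 by apply/andP; split; lra.
have [N HN] := geometric_cauchy ipP q01 (fun k => approx_step k t0 Gxy Gyz) e30.
exists N => m n Nm Nn; have {}HN := HN _ _ Nm Nn.
have Hm := approx_le t m (x - x'); have Hn := approx_le t n (x - x').
rewrite -approxB in Hm; rewrite -approxB in Hn.
have := ler_nrm_dist ipP (approx t m x') (approx t m x) (approx t n x).
have := ler_nrm_dist ipP (approx t n x') (approx t m x') (approx t n x).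
rewrite (nrmB ipP (approx t n x')); lra.
Qed.

Definition semigrp t x : V := xget 0 [set y | tends ip (fun k => approx t k x) y].

Lemma semigrp_tends t x : 0 <= t -> tends ip (fun k => approx t k x) (semigrp t x).
Proof.
move=> t0; have [y xy] := ip_complete (approx_cauchy x t0).
by rewrite /semigrp; case: xgetP => [//|/(_ y)].
Qed.

Lemma semigrp_le t x : 0 <= t -> nrm (semigrp t x) <= nrm x.
Proof.
move=> t0; apply: (tends_le ipP (semigrp_tends x t0) (b := fun=> nrm x)).
  by move=> n; exact: approx_le.
exact: cvg_cst.
Qed.

Lemma semigrp_linear t : 0 <= t -> linear (semigrp t).
Proof.
move=> t0 a x y; apply: (tends_uniq ipP (semigrp_tends _ t0)).
have := tendsZD ipP a (semigrp_tends x t0) (semigrp_tends y t0).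
apply: cvg_trans; apply: near_eq_cvg; near=> k; congr (nrm (_ - _)).
by rewrite /approx (iter_resolvent_linear _ (mesh_gt0 k)).
Unshelve. all: by end_near. Qed.

Lemma semigrp0 x : semigrp 0 x = x.
Proof.
apply: (tends_uniq ipP (semigrp_tends x (lexx 0))).
rewrite /approx /steps; under [fun k => _]eq_fun do rewrite mul0r truncn0.
exact: tends_cst.
Qed.

Lemma semigrpB t x y : 0 <= t -> semigrp t x - semigrp t y = semigrp t (x - y).
Proof.
move=> t0; have := semigrp_linear t0 (-1) y x.
by rewrite !scaleN1r !(addrC (- _)) => ->.
Qed.

Lemma stepsD s t k : 0 <= s -> 0 <= t ->
  exists b : bool, steps (s + t) k = (b + (steps s k + steps t k))%N.
Proof.
move=> s0 t0; have := stepsP k s0; have := stepsP k t0.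
have := stepsP k (addr_ge0 s0 t0); have := mesh_gt0 k.
move: (mesh k) (steps s k) (steps t k) (steps (s + t) k) => a m n p a0.
move=> /andP[A1 A2] /andP[B1 B2] /andP[C1 C2].
have D1 : (p%:R < (m + n + 2)%:R :> R).
  by rewrite -(ltr_pM2r a0) !natrD; lra.
have D2 : ((m + n)%:R < p.+1%:R :> R).
  by rewrite -(ltr_pM2r a0) natrD -(natr1 p); lra.
move: D1 D2; rewrite !ltr_nat => D1 D2; exists (p == (m + n).+1).
case: eqP => [->//|/eqP D3]; rewrite add0n.
apply/eqP; rewrite eqn_leq; move: D1 D2 D3.
by rewrite addn2 !ltnS leq_eqVlt => /orP[->//|]; rewrite ltnS => -> ->.
Qed.

(** The steps for s and for t add up to those for s + t except for at most one, which moves a point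
    of the domain by at most [mesh k] times the norm of its image. Contractivity and density extend
    the identity to all x. *)
Lemma semigrpD s t x : 0 <= s -> 0 <= t -> semigrp (s + t) x = semigrp s (semigrp t x).
Proof.
move=> s0 t0; have st0 := addr_ge0 s0 t0.
have core y z : G y z -> semigrp (s + t) y = semigrp s (semigrp t y).
  move=> Gyz; apply: (tends_uniq ipP (semigrp_tends y st0)).
  pose b k := mesh k * nrm z + nrm (approx t k y - semigrp t y)
    + nrm (approx s k (semigrp t y) - semigrp s (semigrp t y)).
  apply: (tends_squeeze (b := b)) => [k|]; last first.
    rewrite -[0]addr0 -[X in _ --> X + _]addr0; apply: cvgD; last exact: semigrp_tends.
    apply: cvgD; last exact: semigrp_tends.
    by rewrite -(mul0r (nrm z)); apply: cvgMl; exact: mesh_cvg0.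
  apply: le_trans (ler_nrm_dist ipP (approx s k (semigrp t y)) _ _) _.
  rewrite lerD2r; apply: le_trans (ler_nrm_dist ipP (approx s k (approx t k y)) _ _) _.
  apply: lerD; last by rewrite approxB approx_le.
  have [b' e] := stepsD k s0 t0.
  have m0 := mesh_gt0 k.
  rewrite /approx e !iterD.
  apply: le_trans (iter_resolvent_sub b' m0 (graph_iter _ m0 (graph_iter _ m0 Gyz))) _.
  apply: ler_pM; rewrite ?nrm_ge0 ?mulr_ge0 ?ler0n ?(ltW m0)//; last first.
    exact: le_trans (iter_resolvent_le _ _ m0) (iter_resolvent_le _ _ m0).
  by case: (b'); rewrite ?mul1r// mul0r ltW.
apply/eqP; rewrite -subr_eq0; apply/eqP/(nrm_eq0 ipP)/eqP.
rewrite eq_le nrm_ge0 andbT; apply/ler_addgt0Pr => e e0; rewrite add0r.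
have e20 : 0 < e / 2 by lra.
have [y [z [Gyz xy]]] := graph_dense x e20.
apply: le_trans (ler_nrm_dist ipP (semigrp (s + t) y) _ _) _.
rewrite semigrpB// (core _ _ Gyz) !semigrpB//.
have := semigrp_le (x - y) st0.
have := semigrp_le (semigrp t (y - x)) s0; have := semigrp_le (y - x) t0.
rewrite (nrmB ipP y x); lra.
Qed.

Lemma semigrp_taylor t x y y' y'' : 0 <= t -> G x y -> G y' y'' ->
  nrm (semigrp t x - x - t *: y) <= t * (2 * nrm (y - y') + t * nrm y'').
Proof.
move=> t0 Gxy Gy; pose n k := (steps t k)%:R * mesh k.
have nt : n k @[k --> \oo] --> t.
  apply: (@squeeze_cvgr _ _ _ _ (fun k => t - mesh k) (cst t)); last exact: cvg_cst.
    by apply: nearW => k; have /andP[/ltW -> ->] := stepsP k t0.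
  by rewrite -[X in _ --> X]subr0; apply: cvgB; [exact: cvg_cst|exact: mesh_cvg0].
have T : tends ip (fun k => approx t k x - x - n k *: y) (semigrp t x - x - t *: y).
  apply: (tends_squeeze (b := fun k => nrm (approx t k x - semigrp t x) + `|n k - t| * nrm
    y)) => [k|].
    rewrite -nrmZ//; have -> : approx t k x - x - n k *: y - (semigrp t x - x - t *: y)
      = approx t k x - semigrp t x - (n k - t) *: y.
      by apply: (ip_inj ipP) => z; rewrite !ipE; ring.
    by apply: le_trans (ler_nrmD ipP _ _) _; rewrite nrmN.
  rewrite -[0]addr0; apply: cvgD; first exact: semigrp_tends.
  rewrite -(mul0r (nrm y)); apply: cvgMl.
  rewrite -[X in _ --> X](@normr0 _ R); apply: cvg_norm.
  by rewrite -(subrr t); apply: cvgB => //; exact: cvg_cst.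
apply: (tends_le ipP T (b := fun k => n k * (2 * nrm (y - y') + n k * nrm y''))).
  by move=> k; exact: iter_resolvent_taylor (mesh_gt0 k) Gxy Gy.
apply: cvgM => //; apply: cvgD; first exact: cvg_cst.
by apply: cvgMl.
Qed.

Lemma semigrp_cont x : nrm (semigrp t x - x) @[t --> 0^'+] --> 0.
Proof.
apply/cvgrPdist_lt => e e0; have e40 : 0 < e / 4 by lra.
have [y [z [Gyz xy]]] := graph_dense x e40.
have z1 : 0 < 4 * (nrm z + 1) by have := nrm_ge0 ip z; lra.
near=> t; rewrite sub0r normrN ger0_norm ?nrm_ge0//.
have t0 : 0 < t by near: t; exact: nbhs_right_gt.
have tz : t < e / (4 * (nrm z + 1)).
  by near: t; apply: nbhs_right_lt; rewrite divr_gt0.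
have {}tz : t * nrm z < e / 4.
  by move: tz; rewrite ltr_pdivlMr//; lra.
apply: le_lt_trans (ler_nrm_dist ipP (semigrp t y) _ _) _.
have := ler_nrm_dist ipP y (semigrp t y) x.
rewrite (nrmB ipP y x) (semigrpB _ _ (ltW t0)).
have := semigrp_le (x - y) (ltW t0).
suff : nrm (semigrp t y - y) <= t * nrm z by lra.
have T := tendsB ipP (semigrp_tends y (ltW t0)) (tends_cst ipP y).
apply: (tends_le ipP T (b := fun=> t * nrm z)); last exact: cvg_cst.
move=> k; apply: le_trans (iter_resolvent_sub _ (mesh_gt0 k) Gyz) _.
rewrite ler_wpM2r ?nrm_ge0//.
by have /andP[_ ->] := stepsP k (ltW t0).
Unshelve. all: by end_near. Qed.

Lemma semigrp_C0 : C0_semigroup ip semigrp.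
Proof.
split.
- exact: semigrp_linear.
- by move=> t t0; exists 1 => x; rewrite mul1r semigrp_le.
- exact: semigrp0.
- exact: semigrpD.
- exact: semigrp_cont.
Qed.

Lemma graph_generator x y : G x y -> generator_graph ip semigrp x y.
Proof.
move=> Gxy; apply/cvgrPdist_lt => e e0; have e40 : 0 < e / 4 by lra.
have [y' [y'' [Gy yy']]] := graph_dense y e40.
have z1 : 0 < 4 * (nrm y'' + 1) by have := nrm_ge0 ip y''; lra.
near=> t; rewrite sub0r normrN ger0_norm ?nrm_ge0//.
have t0 : 0 < t by near: t; exact: nbhs_right_gt.
have tz : t < e / (4 * (nrm y'' + 1)).
  by near: t; apply: nbhs_right_lt; rewrite divr_gt0.
have {}tz : t * nrm y'' < e / 4.
  by move: tz; rewrite ltr_pdivlMr//; lra.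
have -> : t^-1 *: (semigrp t x - x) - y = t^-1 *: (semigrp t x - x - t *: y).
  by rewrite [RHS]scalerBr scalerA mulVf ?gt_eqF// scale1r.
rewrite nrmZ// gtr0_norm ?invr_gt0//.
rewrite -ltr_pdivlMl ?invr_gt0// invrK.
apply: le_lt_trans (semigrp_taylor (ltW t0) Gxy Gy) _.
by rewrite ltr_pM2l//; lra.
Unshelve. all: by end_near. Qed.

(** By contractivity <x, T t x - x> <= |x| |T t x| - |x|^2 <= 0, and this passes to the limit of the
    difference quotients. The statement concerns the generator itself, which at this stage is only
    known to extend G. *)
Lemma generator_dissipative x y : generator_graph ip semigrp x y -> ip x y <= 0.
Proof.
move=> Gxy; apply/ler_addgt0Pr => e e0; rewrite add0r.
have x1 : 0 < nrm x + 1 by have := nrm_ge0 ip x; lra.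
have /cvgrPdist_lt/(_ _ (divr_gt0 e0 x1)) := Gxy.
move=> H; near ((0 : R)^'+) => t.
have t0 : 0 < t by near: t; exact: nbhs_right_gt.
have : `|0 - nrm (t^-1 *: (semigrp t x - x) - y)| < e / (nrm x + 1).
  by near: t; exact: H.
rewrite sub0r normrN ger0_norm ?nrm_ge0//.
set q := t^-1 *: _; rewrite ltr_pdivlMr// => xq.
have q0 : ip x q <= 0.
  rewrite ipZr// pmulr_rle0 ?invr_gt0// ipDr// ipNr// -sqr_nrm// subr_le0.
  apply: le_trans (cauchy_schwarz ipP _ _) _; rewrite expr2.
  by rewrite ler_wpM2l ?nrm_ge0// semigrp_le// ltW.
have := cauchy_schwarz ipP x (y - q); rewrite ipDr// ipNr// nrmB//.
have := nrm_ge0 ip (q - y); nra.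
Unshelve. all: by end_near. Qed.

End lumer_phillips.

(** A relation is easier to transport than a domain together with a function; for
    [fun x y => D x /\ A x = y] this is [generates_C0_semigroup] by conversion. *)
Definition generates (R : realType) (V : lmodType R) (ip : V -> V -> R)
    (G : V -> V -> Prop) :=
  exists2 T, C0_semigroup ip T & forall x y, generator_graph ip T x y <-> G x y.

Record m_dissipative (R : realType) (V : lmodType R) (ip : V -> V -> R)
    (G : V -> V -> Prop) : Prop := {
  graph_linear : forall a x y x' y', G x y -> G x' y' -> G (a *: x + x') (a *: y + y');
  graph_dissipative : forall x y, G x y -> ip x y <= 0;
  graph_range : forall (h : R) v, 0 < h -> exists x y, G x y /\ v = x - h *: y;
  graph_functional : forall y, G 0 y -> y = 0 }.

Section generation.
Context {R : realType} {V : lmodType R} (ip : V -> V -> R).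
Hypotheses (ipP : inner_product ip) (ip_complete : complete_ip ip).
Local Notation nrm := (ip_norm ip).
Local Notation ipE := (ipE ipP).

Lemma generator_graph_linear T a x y x' y' : C0_semigroup ip T ->
  generator_graph ip T x y -> generator_graph ip T x' y' ->
  generator_graph ip T (a *: x + x') (a *: y + y').
Proof.
move=> TP Gxy Gxy'.
pose b t := `|a| * nrm (t^-1 *: (T t x - x) - y) + nrm (t^-1 *: (T t x' - x') - y').
apply: (@squeeze_cvgr _ _ _ _ (fun=> 0) b); last 2 first.
- exact: cvg_cst.
- rewrite -[X in _ --> X](_ : `|a| * 0 + 0 = 0); last by rewrite mulr0 addr0.
  by apply: cvgD => //; apply: cvgMr.
near=> t; have t0 : 0 < t by near: t; exact: nbhs_right_gt.
rewrite nrm_ge0 /= /b -nrmZ//; apply: le_trans (ler_nrmD ipP _ _).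
rewrite le_eqVlt; apply/orP; left; apply/eqP; congr nrm.
rewrite (semigroup_linear TP (ltW t0)).
by apply: (ip_inj ipP) => z; rewrite !ipE; ring.
Unshelve. all: by end_near. Qed.

(** That the generator is no larger than G is a maximality argument: for (x, y) in the generator,
    the range condition gives (x', y') in G with x' - y' = x - y. The difference of the two pairs is
    (x - x', x - x'), and dissipativity of the generator forces x = x'. *)
Theorem lumer_phillips G : m_dissipative ip G -> generates ip G.
Proof.
case=> Glin Gdis Grange Gfun.
have TP := semigrp_C0 ipP ip_complete Glin Gdis Grange Gfun.
exists (semigrp ip G) => // x y; split=> [Gxy|]; last first.
  exact: graph_generator.
have [x' [y' [Gxy' e]]] := Grange 1 (x - y) (@ltr01 R).
rewrite scale1r in e.
have := generator_graph_linear (-1) TP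
  (graph_generator ipP ip_complete Glin Gdis Grange Gfun Gxy') Gxy.
move=> /(generator_dissipative ipP ip_complete Glin Gdis Grange Gfun).
rewrite !scaleN1r !(addrC (- _)).
have -> : y - y' = x - x'.
  by apply: (ip_inj ipP) => z; move/(congr1 (ip^~ z)): e; rewrite !ipE; lra.
move=> H; suff xx' : x = x' by move: e Gxy'; rewrite -xx' => /addrI/oppr_inj <-.
apply/eqP; rewrite -subr_eq0; apply/negPn/negP => /(ip_gt0 ipP).
by rewrite ltNge H.
Qed.

Lemma expR_quotient_cvg (c : R) : t^-1 * (expR (c * t) - 1) @[t --> 0^'+] --> c.
Proof.
have dc : is_derive (0 : R) (1 : R) (fun t : R => expR (c * t)) c.
  have H : is_derive (0 : R) (1 : R) ( *%R c) c.
    have := @is_deriveZ R R^o R^o id c 0 1 1 (is_derive_id _ _).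
    by rewrite /GRing.scale/= mulr1.
  have := @is_derive1_comp _ expR _ 0 _ c (is_derive_expR (c * 0)) H.
  by rewrite mulr0 expR0 mul1r.
have [/cvg_ex[d dd] e] := dc.
have dE : d = c by rewrite -e /derive; apply/esym/cvg_lim.
rewrite dE in dd.
have : h^-1 *: ((expR (c * h) : R^o) - 1) @[h --> (0 : R)^'] --> c.
  move: dd; apply: cvg_trans; apply: near_eq_cvg; near=> t.
  by rewrite /shift/= /GRing.scale/= addr0 mulr1 mulr0 expR0.
apply: cvg_trans; apply: cvg_app.
move=> A; change (nbhs (0 : R) (fun y => y != 0 -> A y) ->
  nbhs (0 : R) (fun y => 0 < y -> A y)).
by apply: filterS => x Ax x0; apply: Ax; rewrite gt_eqF.
Unshelve. all: by end_near. Qed.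

(** Product rule at 0: the difference quotient minus its limit splits into e^(ct) (t^-1 (T t x - x)
    - y), (e^(ct) - 1) y and (t^-1 (e^(ct) - 1) - c) x, whose norms make up [b]. *)
Lemma shift_generator c T x y : generator_graph ip T x y ->
  generator_graph ip (fun t x => expR (c * t) *: T t x) x (y + c *: x).
Proof.
move=> Gxy.
pose b t := expR (c * t) * nrm (t^-1 *: (T t x - x) - y)
  + `|expR (c * t) - 1| * nrm y + `|t^-1 * (expR (c * t) - 1) - c| * nrm x.
have cE : expR (c * t) @[t --> 0^'+] --> (1 : R).
  rewrite -[X in _ --> X](expR0 R); apply: continuous_cvg; first exact: continuous_expR.
  rewrite -[X in _ --> X](mulr0 c); apply: cvgMr.
  exact: cvg_at_right_filter.
have cb : b t @[t --> 0^'+] --> 0.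
  rewrite -[X in _ --> X](_ : 1 * 0 + `|1 - 1| * nrm y + `|c - c| * nrm x = 0).
    apply: cvgD.
      apply: cvgD; first exact: cvgM.
      apply: cvgMl; apply: cvg_norm; apply: cvgB => //; exact: cvg_cst.
    apply: cvgMl; apply: cvg_norm; apply: cvgB; last exact: cvg_cst.
    exact: expR_quotient_cvg.
  by rewrite !subrr normr0 !mul0r mulr0 !addr0.
apply: (@squeeze_cvgr _ _ _ _ (fun=> 0) b) => //; last exact: cvg_cst.
near=> t; have t0 : 0 < t by near: t; exact: nbhs_right_gt.
rewrite nrm_ge0 /= /b -[X in X * _ + _](ger0_norm (expR_ge0 (c * t))) -!(nrmZ ipP).
apply: le_trans (lerD (ler_nrmD ipP _ _) (lexx _)).
apply: le_trans (ler_nrmD ipP _ _).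
rewrite le_eqVlt; apply/orP; left; apply/eqP; congr nrm.
by apply: (ip_inj ipP) => z; rewrite !ipE; ring.
Unshelve. all: by end_near. Qed.

Lemma shift_C0 c T : C0_semigroup ip T ->
  C0_semigroup ip (fun t x => expR (c * t) *: T t x).
Proof.
case=> Tl Tb T0 TD Tc; split.
- by move=> t t0 a x y; rewrite Tl// scalerDr !scalerA (mulrC _ a).
- move=> t t0; have [C HC] := Tb t t0; exists (expR (c * t) * C) => x.
  by rewrite nrmZ// ger0_norm ?expR_ge0// -mulrA ler_wpM2l ?expR_ge0.
- by move=> x; rewrite mulr0 expR0 scale1r.
- move=> s t x s0 t0; rewrite TD// mulrDr expRD -scalerA; congr (_ *: _).
  have := Tl s s0 (expR (c * t)) (T t x) 0; rewrite !addr0 => ->.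
  suff -> : T s 0 = 0 by rewrite addr0.
  have := Tl s s0 (-1) 0 0; rewrite scaler0 addr0 => {1}->.
  by rewrite scaleN1r addNr.
- move=> x; pose b t := expR (c * t) * nrm (T t x - x) + `|expR (c * t) - 1| * nrm x.
  have cE : expR (c * t) @[t --> 0^'+] --> (1 : R).
    rewrite -[X in _ --> X](expR0 R); apply: continuous_cvg; first exact: continuous_expR.
    rewrite -[X in _ --> X](mulr0 c); apply: cvgMr.
    exact: cvg_at_right_filter.
  have cb : b t @[t --> 0^'+] --> 0.
    rewrite -[X in _ --> X](_ : 1 * 0 + `|1 - 1| * nrm x = 0).
      apply: cvgD; first exact: cvgM.
      by apply: cvgMl; apply: cvg_norm; apply: cvgB => //; exact: cvg_cst.
    by rewrite subrr normr0 mulr0 mul0r addr0.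
  apply: (@squeeze_cvgr _ _ _ _ (fun=> 0) b) => //; last exact: cvg_cst.
  near=> t; rewrite nrm_ge0 /= /b -[X in X * _ + _](ger0_norm (expR_ge0 (c * t))).
  rewrite -!(nrmZ ipP); apply: le_trans (ler_nrmD ipP _ _).
  rewrite le_eqVlt; apply/orP; left; apply/eqP; congr nrm.
  by apply: (ip_inj ipP) => z; rewrite !ipE; ring.
Unshelve. all: by end_near. Qed.

Lemma generates_shift c G : generates ip G ->
  generates ip (fun x y => G x (y - c *: x)).
Proof.
move=> [T TP TG]; exists (fun t x => expR (c * t) *: T t x).
  exact: shift_C0.
move=> x y; split=> [H|/TG/(shift_generator c)]; last by rewrite subrK.
(* Conversely, shifting by - c cancels the exponential factor and returns to T. *)
apply/TG; have := shift_generator (- c) H; rewrite scaleNr.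
rewrite /generator_graph; apply: cvg_trans; apply: near_eq_cvg; near=> t.
by rewrite scalerA -expRD mulNr addNr expR0 scale1r.
Unshelve. all: by end_near. Qed.

Lemma contraction_fixpoint (f : V -> V) q : 0 <= q < 1 ->
  (forall x y, nrm (f x - f y) <= q * nrm (x - y)) -> exists x, f x = x.
Proof.
move=> q01 fq; have /andP[q0 q1] := q01; pose u n := iter n f 0.
have [n|x ux] := ip_complete (geometric_cauchy ipP q01 (u := u) (K := nrm (f 0 - 0)) _).
  elim: n => [|n IH] /=; first by rewrite mulr1.
  apply: le_trans (fq _ _) _; rewrite exprS mulrCA; exact: ler_wpM2l IH.
exists x; apply: (tends_uniq ipP (u := fun n => u n.+1)); last first.
  by move: ux; rewrite /tends -(cvg_shiftS (fun n => nrm (u n - x))).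
apply: (tends_squeeze (b := fun n => q * nrm (u n - x))) => [n|]; first exact: fq.
by rewrite -(mulr0 q); apply: cvgMr.
Qed.

(** If c bounds P, then <x, P x> <= c |x|^2 and A + P - c is dissipative. The shift by c is undone
    by multiplying the semigroup by e^(ct). *)
Lemma bounded_perturbation G (P : V -> V) : m_dissipative ip G ->
  bounded_op ip ip P -> generates ip (fun x y => G x (y - P x)).
Proof.
move=> [Glin Gdis Grange Gfun] [Plin [c c0 Pc]].
have G0 : G 0 0 by exact: graph0 Glin Grange.
have GZ a x y : G x y -> G (a *: x) (a *: y).
  by move=> /(Glin a)/(_ G0); rewrite !addr0.
have PB x y : P x - P y = P (x - y).
  by have := Plin (-1) y x; rewrite !scaleN1r !(addrC (- _)) => ->.
have P0 : P 0 = 0 by have := PB 0 0; rewrite !subrr.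
suff : generates ip (fun x y => G x (y - P x + c *: x)).
  move=> /(generates_shift c) [T TP TG]; exists T => // x y; rewrite TG.
  by rewrite addrAC subrK.
apply: lumer_phillips => //; split.
- move=> a x y x' y' Gxy Gxy'; have := Glin a _ _ _ _ Gxy Gxy'.
  by congr G; rewrite Plin; apply: (ip_inj ipP) => z; rewrite !ipE; ring.
- move=> x y /Gdis; rewrite !ipE -sqr_nrm//.
  have := cauchy_schwarz ipP x (P x); have := nrm_ge0 ip x; have := Pc x.
  nra.
- move=> h v h0; have hc : 0 < 1 + h * c by rewrite ltr_wpDr// mulr_ge0// ltW.
  (* Solving x - h (A x + P x - c x) = v amounts to x = (1 - k A)^-1 ((v + h P x) / (1 + h c)), a
     fixed point of a map with Lipschitz constant h c / (1 + h c) < 1. *)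
  pose k := h / (1 + h * c); have k0 : 0 < k by rewrite divr_gt0.
  pose f x := resolvent G k ((1 + h * c)^-1 *: (v + h *: P x)).
  have q01 : 0 <= h * c / (1 + h * c) < 1.
    by rewrite divr_ge0 ?mulr_ge0 ?(ltW h0) ?(ltW hc)//= ltr_pdivrMr// mul1r ltrDr.
  have [x fx] : exists x, f x = x.
    apply: (contraction_fixpoint q01) => x y; rewrite /f.
    have rl := resolvent_linear ipP Glin Gdis Grange k0 (-1)
      ((1 + h * c)^-1 *: (v + h *: P y)) ((1 + h * c)^-1 *: (v + h *: P x)).
    move: rl; rewrite !scaleN1r !(addrC (- _)) => <-.
    apply: le_trans (resolvent_le ipP Gdis Grange _ k0) _.
    have -> : (1 + h * c)^-1 *: (v + h *: P x) - (1 + h * c)^-1 *: (v + h *: P y) =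
        (h / (1 + h * c)) *: P (x - y).
      by rewrite -PB; apply: (ip_inj ipP) => z; rewrite !ipE; field; rewrite gt_eqF.
    rewrite nrmZ// gtr0_norm//.
    apply: le_trans (ler_wpM2l (ltW k0) (Pc _)) _.
    by rewrite /k mulrA (mulrAC h).
  have := resolvent_graph Grange ((1 + h * c)^-1 *: (v + h *: P x)) k0.
  rewrite -/(f x) fx; set y := k^-1 *: _ => Gxy.
  exists x, (y + P x - c *: x); split.
    by rewrite addrAC subrK addrK.
  rewrite /y /k; apply: (ip_inj ipP) => z; rewrite !ipE; field.
  by rewrite !gt_eqF.
- by move=> y; rewrite P0 scaler0 addr0 subr0; exact: Gfun.
Qed.

End generation.

(** * Hilbert sums, coercive equations and damped systems *)

Definition ip_sum (R : realType) (E H : lmodType R) (ipe : E -> E -> R)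
    (iph : H -> H -> R) (X Y : E * H) : R :=
  ipe X.1 Y.1 + iph X.2 Y.2.

Section ip_sum.
Context {R : realType} {E H : lmodType R} (ipe : E -> E -> R) (iph : H -> H -> R).
Hypotheses (ipeP : inner_product ipe) (iphP : inner_product iph).

Lemma ip_sum_inner_product : inner_product (ip_sum ipe iph).
Proof.
split.
- by move=> X Y; rewrite /ip_sum (ipC ipeP) (ipC iphP).
- by move=> a X Y Z; rewrite /ip_sum /= (ipZDl ipeP) (ipZDl iphP); ring.
- move=> [x y] xy; rewrite /ip_sum /=.
  have [x0|/(ip_gt0 ipeP) x0] := eqVneq x 0; last by rewrite ltr_pwDl ?ip_ge0.
  rewrite ltr_wpDl ?ip_ge0//; apply: (ip_gt0 iphP).
  by apply: contraNneq xy => ->; rewrite x0.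
Qed.

Lemma ip_sum_norm X :
  [/\ ip_norm ipe X.1 <= ip_norm (ip_sum ipe iph) X,
      ip_norm iph X.2 <= ip_norm (ip_sum ipe iph) X &
      ip_norm (ip_sum ipe iph) X <= ip_norm ipe X.1 + ip_norm iph X.2].
Proof.
have He := ip_ge0 ipeP X.1; have Hh := ip_ge0 iphP X.2.
split.
- by rewrite /ip_norm /ip_sum ler_sqrt ?addr_ge0// lerDl.
- by rewrite /ip_norm /ip_sum ler_sqrt ?addr_ge0// lerDr.
- rewrite -(@ler_pXn2r _ 2)// ?nnegrE ?addr_ge0 ?nrm_ge0//.
  rewrite (sqr_nrm ip_sum_inner_product) sqrrD (sqr_nrm ipeP) (sqr_nrm iphP).
  rewrite /ip_sum -addrA lerD2l lerDr mulrn_wge0// mulr_ge0 ?nrm_ge0//.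
Qed.

Lemma ip_sum_complete : complete_ip ipe -> complete_ip iph ->
  complete_ip (ip_sum ipe iph).
Proof.
move=> Ec Hc u uc.
have [|x ux] := Ec (fun n => (u n).1).
  move=> e /uc[N HN]; exists N => m n Nm Nn.
  by apply: le_lt_trans (HN m n Nm Nn); have [] := ip_sum_norm (u m - u n).
have [|y uy] := Hc (fun n => (u n).2).
  move=> e /uc[N HN]; exists N => m n Nm Nn.
  by apply: le_lt_trans (HN m n Nm Nn); have [] := ip_sum_norm (u m - u n).
exists (x, y); apply: (tends_squeeze (b := fun n =>
  ip_norm ipe ((u n).1 - x) + ip_norm iph ((u n).2 - y))) => [n|].
  by have [] := ip_sum_norm (u n - (x, y)).
by rewrite -[0]addr0; apply: cvgD.
Qed.

End ip_sum.

Section coercive.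
Context {R : realType} {E : lmodType R} (ip : E -> E -> R).
Hypotheses (ipP : inner_product ip) (ip_complete : complete_ip ip).
Local Notation nrm := (ip_norm ip).

(* For small tau the map x |-> x - tau (T x - y) is a contraction. *)
Lemma coercive_surjective (T : E -> E) (a C : R) : linear T -> 0 < a ->
  (forall x, nrm (T x) <= C * nrm x) -> (forall x, a * ip x x <= ip (T x) x) ->
  forall y, exists x, T x = y.
Proof.
move=> Tlin a0 TC Ta y.
(* |f x - f z|^2 is at most (1 - 2 a t + D^2 t^2) |x - z|^2. This factor is minimal at t = a / D^2,
   where it equals 1 - (a / D)^2; taking D >= a keeps it nonnegative. *)
pose D := Num.max C a; have D0 : 0 < D by rewrite lt_max a0 orbT.
have aD : a <= D by rewrite le_max lexx orbT.
have TD x : nrm (T x) <= D * nrm x.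
  by apply: le_trans (TC x) _; rewrite ler_wpM2r ?nrm_ge0// le_max lexx.
pose t := a / D ^+ 2; have t0 : 0 < t by rewrite divr_gt0 ?exprn_gt0.
pose f x := x - t *: (T x - y).
pose q := Num.sqrt (1 - (a / D) ^+ 2).
have aD1 : (a / D) ^+ 2 <= 1.
  by rewrite expr_le1 ?divr_ge0 ?(ltW a0) ?(ltW D0)// ler_pdivrMr// mul1r.
have q01 : 0 <= q < 1.
  rewrite sqrtr_ge0 -[ltRHS]sqrtr1 ltr_sqrt// ltrBlDr ltrDl exprn_gt0// divr_gt0//.
have [x fx] : exists x, f x = x.
  apply: (contraction_fixpoint ipP ip_complete q01) => x z.
  have -> : f x - f z = (x - z) - t *: T (x - z).
    have -> : T (x - z) = T x - T z.
      by have := Tlin (-1) z x; rewrite !scaleN1r !(addrC (- _)).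
    by apply: (ip_inj ipP) => w; rewrite /f !(ipE ipP); ring.
  move: (x - z) => w.
  rewrite -(@ler_pXn2r _ 2)// ?nnegrE ?mulr_ge0 ?nrm_ge0 ?sqrtr_ge0//.
  rewrite (sqr_nrm ipP) exprMn (sqr_nrm ipP) sqr_sqrtr ?subr_ge0//.
  rewrite !(ipE ipP) (ipC ipP w (T w)).
  have H : ip (T w) (T w) <= D ^+ 2 * ip w w.
    rewrite -!(sqr_nrm ipP) -exprMn.
    by rewrite ler_pXn2r// nnegrE ?mulr_ge0 ?nrm_ge0 ?(ltW D0).
  have H1 := Ta w.
  have H2 : t ^+ 2 * ip (T w) (T w) <= t ^+ 2 * (D ^+ 2 * ip w w).
    by rewrite ler_wpM2l// sqr_ge0.
  have H3 : t * (a * ip w w) <= t * ip (T w) w by rewrite ler_wpM2l// ltW.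
  have E1 : t ^+ 2 * (D ^+ 2 * ip w w) = (a / D) ^+ 2 * ip w w.
    by rewrite /t; field; rewrite gt_eqF.
  have E2 : t * (a * ip w w) = (a / D) ^+ 2 * ip w w.
    by rewrite /t; field; rewrite gt_eqF.
  move: H2 H3; rewrite E1 E2 expr2; lra.
exists x; apply/eqP; rewrite -subr_eq0; apply/eqP.
have : t *: (T x - y) = 0.
  apply: (ip_inj ipP) => w; move/(congr1 (ip^~ w)): fx.
  by rewrite /f !(ipE ipP); lra.
by move=> /eqP; rewrite scaler_eq0 gt_eqF//= => /eqP.
Qed.

End coercive.

(* In the variables (a, u) the equation of a strongly damped system
   a_t = b, u = K b, K^* u_t = - (a + S b). *)
Section damped_system.
Context {R : realType} {E H : lmodType R} (ipe : E -> E -> R) (iph : H -> H -> R).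
Hypotheses (ipeP : inner_product ipe) (iphP : inner_product iph).
Hypotheses (ipe_complete : complete_ip ipe).
Variables (K : E -> H) (Ks : H -> E) (S : E -> E).
Hypotheses (K_bounded : bounded_op ipe iph K) (Ks_bounded : bounded_op iph ipe Ks)
  (S_bounded : bounded_op ipe ipe S)
  (K_adj : forall b w, iph (K b) w = ipe b (Ks w))
  (S_ge0 : forall b, 0 <= ipe b (S b))
  (K_inj : forall b, K b = 0 -> b = 0) (Ks_inj : forall w, Ks w = 0 -> w = 0).

Definition damped_graph (X Y : E * H) :=
  X.2 = K Y.1 /\ Ks Y.2 = - (X.1 + S Y.1).

Lemma damped_m_dissipative : m_dissipative (ip_sum ipe iph) damped_graph.
Proof.
have [Klin _] := K_bounded; have [Kslin _] := Ks_bounded; have [Slin _] := S_bounded.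
split.
- move=> a [x u] [b w] [x' u'] [b' w'] [/= -> e] [/= -> e']; split => /=.
    by rewrite Klin.
  by rewrite Kslin e e' Slin; apply: (ip_inj ipeP) => z; rewrite !(ipE ipeP); ring.
- move=> [x u] [b w] [/= -> e]; rewrite /ip_sum /= K_adj e !(ipE ipeP).
  have := S_ge0 b; rewrite (ipC ipeP x b); lra.
- move=> h [F G] h0.
  (* For the right-hand side (F, G), the unknowns are a = F + h b, u = K b and w = (K b - G) / h.
     Inserted in K^* w = - (a + S b) and multiplied by h, they leave T b = K^* G - h F, where T is
     coercive with constant h^2. *)
  pose T b := Ks (K b) + (h ^+ 2) *: b + h *: S b.
  have [Tlin [C _ TC]] : bounded_op ipe ipe T.
    apply: (bounded_opD ipeP) (bounded_opZ ipeP _ S_bounded).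
    apply: (bounded_opD ipeP) (bounded_opZ ipeP _ (bounded_op_id ipe)).
    exact: bounded_op_comp Ks_bounded K_bounded.
  have Ta b : h ^+ 2 * ipe b b <= ipe (T b) b.
    rewrite (ipC ipeP) /T !(ipE ipeP) -K_adj.
    have := mulr_ge0 (ltW h0) (S_ge0 b); have := ip_ge0 iphP (K b); lra.
  have [b Tb] := coercive_surjective ipeP ipe_complete Tlin (exprn_gt0 2 h0) TC Ta
    (Ks G - h *: F).
  exists (F + h *: b, K b), (b, h^-1 *: (K b - G)); split; last first.
    rewrite /GRing.add /= /GRing.opp/=; congr pair => /=.
      by rewrite addrK.
    by rewrite scalerA mulfV ?gt_eqF// scale1r opprB addrCA subrr addr0.
  split => //=; have KsZ a w w' : Ks (a *: (w - w')) = a *: (Ks w - Ks w').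
    have Ks0 : Ks 0 = 0.
      have := Kslin (-1) 0 0; rewrite scaler0 addr0 => {1}->.
      by rewrite scaleN1r addNr.
    have := Kslin a (w - w') 0; rewrite !addr0 Ks0 addr0 => ->; congr (_ *: _).
    by have := Kslin (-1) w' w; rewrite !scaleN1r !(addrC (- _)).
  rewrite KsZ; have -> : Ks (K b) = Ks G - h *: F - (h ^+ 2) *: b - h *: S b.
    by rewrite -Tb /T addrAC addrK addrK.
  apply: (ip_inj ipeP) => z; rewrite !(ipE ipeP); field; by rewrite gt_eqF.
- move=> [b w] [/= /esym/K_inj b0 /eqP]; rewrite b0 add0r.
  have -> : S 0 = 0.
    have := Slin (-1) 0 0; rewrite scaler0 addr0 => {1}->.
    by rewrite scaleN1r addNr.
  by rewrite oppr0 => /eqP/Ks_inj ->.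
Qed.

End damped_system.

Section ip_sum_operators.
Context {R : realType} {U E H : lmodType R}.
Variables (ipu : U -> U -> R) (ipe : E -> E -> R) (iph : H -> H -> R).
Hypotheses (ipeP : inner_product ipe) (iphP : inner_product iph).

Lemma bounded_op_fst : bounded_op (ip_sum ipe iph) ipe fst.
Proof.
by split=> //; exists 1 => // X; rewrite mul1r; have [] := ip_sum_norm ipeP iphP X.
Qed.

Lemma bounded_op_snd : bounded_op (ip_sum ipe iph) iph snd.
Proof.
by split=> //; exists 1 => // X; rewrite mul1r; have [] := ip_sum_norm ipeP iphP X.
Qed.

Lemma bounded_op_pair f g : bounded_op ipu ipe f -> bounded_op ipu iph g ->
  bounded_op ipu (ip_sum ipe iph) (fun x => (f x, g x)).
Proof.
move=> [fl [C C0 fC]] [gl [D D0 gD]]; split.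
  by move=> a x y; rewrite fl gl.
exists (C + D) => [|x]; first exact: addr_ge0.
have [_ _] := ip_sum_norm ipeP iphP (f x, g x); move/le_trans; apply.
by rewrite mulrDl; apply: lerD; [exact: fC|exact: gD].
Qed.

End ip_sum_operators.

(** * Equivalent norms, isometries and matrix-weighted forms *)

Lemma complete_equiv (R : realType) (V : lmodType R) (ip ip' : V -> V -> R) C :
  (forall x, ip_norm ip x <= C * ip_norm ip' x) ->
  (forall x, ip_norm ip' x <= C * ip_norm ip x) ->
  complete_ip ip -> complete_ip ip'.
Proof.
move=> le1 le2 cip u uc; have C1 : 0 < `|C| + 1 by rewrite ltr_wpDl.
have [|x ux] := cip u.
  move=> e e0; have [N HN] := uc _ (divr_gt0 e0 C1).
  exists N => m n Nm Nn; have := HN m n Nm Nn; rewrite ltr_pdivlMr//.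
  apply: le_lt_trans; apply: le_trans (le1 _) _.
  rewrite mulrC ler_wpM2l ?sqrtr_ge0//.
  by rewrite (le_trans (ler_norm _))// lerDl.
exists x; apply: (tends_squeeze (b := fun n => C * ip_norm ip (u n - x))) => [n|].
  exact: le2.
by rewrite -(mulr0 C); apply: cvgMr.
Qed.

(** Each T t has only to be bounded, not contractive, so the same semigroup with the same generator
    serves for every equivalent norm. *)
Lemma generates_equiv (R : realType) (V : lmodType R) (ip ip' : V -> V -> R) C G :
  (forall x, ip_norm ip x <= C * ip_norm ip' x) ->
  (forall x, ip_norm ip' x <= C * ip_norm ip x) ->
  generates ip G -> generates ip' G.
Proof.
move=> le1 le2 [T [Tl Tb T0 TD Tc] TG].
have n0 p x : 0 <= @ip_norm R V p x by exact: sqrtr_ge0.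
have equiv0 p p' (f : R -> V) : (forall x, @ip_norm R V p' x <= C * @ip_norm R V p x) ->
    ip_norm p (f t) @[t --> 0^'+] --> 0 -> ip_norm p' (f t) @[t --> 0^'+] --> 0.
  move=> pp' pf; apply: (squeeze_cvgr (f := fun=> 0) (h := fun t => C * ip_norm p (f t))).
  - by apply: nearW => t; rewrite n0 pp'.
  - exact: cvg_cst.
  - by rewrite -[X in _ --> X](mulr0 C); apply: cvgMr.
exists T; last first.
  move=> x y; rewrite -TG; split; apply: (equiv0 _ _ (fun t => t^-1 *: (T t x - x) - y)) => //.
split=> //.
- move=> t t0; have [D HD] := Tb t t0; exists (`|C| * `|D| * `|C|) => x.
  have absle p p' y : (forall x, @ip_norm R V p' x <= C * @ip_norm R V p x) ->
    @ip_norm R V p' y <= `|C| * @ip_norm R V p y.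
    by move=> H; apply: le_trans (H y) _; rewrite ler_wpM2r ?n0// ler_norm.
  apply: le_trans (absle _ _ _ le2) _.
  rewrite -!mulrA ler_wpM2l//.
  apply: le_trans (HD _) _; apply: le_trans (_ : `|D| * ip_norm ip x <= _).
    by rewrite ler_wpM2r ?n0// ler_norm.
  by rewrite ler_wpM2l// absle.
- by move=> x; apply: (equiv0 _ _ (fun t => T t x - x)).
Qed.

Lemma generates_iso (R : realType) (V W : lmodType R) (ip : V -> V -> R)
    (ip' : W -> W -> R) (phi : V -> W) (psi : W -> V) G :
  linear phi -> cancel phi psi -> cancel psi phi ->
  (forall x y, ip x y = ip' (phi x) (phi y)) ->
  generates ip' G -> generates ip (fun x y => G (phi x) (phi y)).
Proof.
move=> phil phiK psiK ipE [T [Tl Tb T0 TD Tc] TG].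
have nE x : ip_norm ip x = ip_norm ip' (phi x) by rewrite /ip_norm ipE.
have phi0 : phi 0 = 0.
  have := phil (-1) 0 0; rewrite scaler0 addr0 => {1}->.
  by rewrite scaleN1r addNr.
have phiZ a x : phi (a *: x) = a *: phi x.
  by have := phil a x 0; rewrite !addr0 phi0 addr0.
have phiB x y : phi (x - y) = phi x - phi y.
  by have := phil (-1) y x; rewrite !scaleN1r !(addrC (- _)).
have psil : linear psi.
  by move=> a x y; apply: (can_inj phiK); rewrite phil !psiK.
exists (fun t x => psi (T t (phi x))).
  split.
  - by move=> t t0 a x y; rewrite phil Tl// psil.
  - by move=> t t0; have [C HC] := Tb t t0; exists C => x; rewrite !nE psiK.
  - by move=> x; rewrite T0.
  - by move=> s t x s0 t0; rewrite TD// psiK.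
  - by move=> x; under eq_cvg do rewrite nE phiB psiK; exact: Tc.
move=> x y; rewrite -TG /generator_graph.
by under eq_cvg do rewrite nE phiB phiZ phiB psiK.
Qed.

(** The form of the symmetric matrix with rows (a, b) and (b, c) on pairs of vectors. It is used
    with b = 0 for the strain energy, with the entries of [Mb] over L^2 and with those of [Mt] over
    R. *)
Definition ip_mat (R : realType) (V : lmodType R) (ip : V -> V -> R) (a b c : R)
    (X Y : V * V) : R :=
  a * ip X.1 Y.1 + b * (ip X.1 Y.2 + ip X.2 Y.1) + c * ip X.2 Y.2.

Section ip_mat.
Context {R : realType} {U V : lmodType R} (ipu : U -> U -> R) (ip : V -> V -> R).
Hypothesis ipP : inner_product ip.

(* a * (a |x|^2 + 2 b <x, y> + c |y|^2) = |a x + b y|^2 + (a c - b^2) |y|^2 *)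
Lemma ip_quadratic_ge0 (a b c : R) x y : 0 < a -> b ^+ 2 <= a * c ->
  0 <= a * ip x x + b * (ip x y + ip y x) + c * ip y y.
Proof.
move=> a0 bac; rewrite -(pmulr_rge0 _ a0).
have := ip_ge0 ipP (a *: x + b *: y); rewrite !(ipE ipP) (ipC ipP y x).
have : 0 <= (a * c - b ^+ 2) * ip y y by rewrite mulr_ge0 ?ip_ge0// subr_ge0.
by lra.
Qed.

Variables (a b c : R).
Hypotheses (a0 : 0 < a) (bac : b ^+ 2 < a * c).

Lemma ip_mat_c_gt0 : 0 < c.
Proof. by have := le_lt_trans (sqr_ge0 b) bac; rewrite pmulr_rgt0. Qed.

Lemma ip_mat_equiv : exists2 C, 0 < C & forall X,
  ip_mat ip a b c X X <= C * ip_sum ip ip X X /\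
  ip_sum ip ip X X <= C * ip_mat ip a b c X X.
Proof.
have c0 := ip_mat_c_gt0; have ac0 : 0 < a + c by rewrite addr_gt0.
(* Determinant over trace is a lower bound for the smaller eigenvalue, since (a - k) (c - k) - b^2 =
   k^2 >= 0. The trace a + c bounds the form from above, so a + c + 1 / k serves in both
   directions. *)
pose k := (a * c - b ^+ 2) / (a + c).
have k0 : 0 < k by rewrite divr_gt0// subr_gt0.
have kE : k * (a + c) = a * c - b ^+ 2 by rewrite /k divfK// gt_eqF.
have b0 := sqr_ge0 b.
exists (a + c + k^-1); first by rewrite addr_gt0// invr_gt0.
move=> [x y]; rewrite /ip_mat /ip_sum /=.
have x0 := ip_ge0 ipP x; have y0 := ip_ge0 ipP y.
have H1 : 0 <= c * ip x x + (- b) * (ip x y + ip y x) + a * ip y y.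
  by apply: ip_quadratic_ge0 => //; rewrite sqrrN mulrC ltW.
have H2 : 0 <= (a - k) * ip x x + b * (ip x y + ip y x) + (c - k) * ip y y.
  apply: ip_quadratic_ge0.
    by rewrite subr_gt0 /k ltr_pdivrMr//; have := mulr_gt0 a0 a0; lra.
  by have := sqr_ge0 k; lra.
have kV : 0 < k^-1 by rewrite invr_gt0.
split.
  have := mulr_ge0 (ltW kV) (addr_ge0 x0 y0); lra.
have H3 : k * (ip x x + ip y y) <= a * ip x x + b * (ip x y + ip y x) + c * ip y y by lra.
have H4 := ler_wpM2l (ltW kV) H3; rewrite mulrA mulVf ?gt_eqF// mul1r in H4.
rewrite mulrDl; apply: le_trans H4 _; rewrite lerDr mulr_ge0 ?(ltW ac0)//.
by apply: le_trans H3; rewrite mulr_ge0 ?addr_ge0// ltW.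
Qed.

Lemma ip_mat_inner_product : inner_product (ip_mat ip a b c).
Proof.
have sumP := ip_sum_inner_product ipP ipP; split.
- by move=> X Y; rewrite /ip_mat !(ipC ipP Y.1) !(ipC ipP Y.2); ring.
- by move=> k X Y Z; rewrite /ip_mat /= !(ipZDl ipP); ring.
- move=> X /(ip_gt0 sumP) X0; have [C C0 /(_ X)[_ H]] := ip_mat_equiv.
  by rewrite -(pmulr_rgt0 _ C0); exact: lt_le_trans X0 H.
Qed.

Lemma ip_mat_norm_equiv : exists2 C, 0 <= C & forall X,
  ip_norm (ip_mat ip a b c) X <= C * ip_norm (ip_sum ip ip) X /\
  ip_norm (ip_sum ip ip) X <= C * ip_norm (ip_mat ip a b c) X.
Proof.
have [C C0 H] := ip_mat_equiv; exists (Num.sqrt C); first exact: sqrtr_ge0.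
move=> X; have [H1 H2] := H X; rewrite /ip_norm -!sqrtrM ?(ltW C0)//.
by rewrite !ler_wsqrtr.
Qed.

Lemma ip_mat_complete : complete_ip ip -> complete_ip (ip_mat ip a b c).
Proof.
move=> ipc; have [C _ H] := ip_mat_norm_equiv.
exact: complete_equiv (fun X => (H X).2) (fun X => (H X).1)
  (ip_sum_complete ipP ipP ipc ipc).
Qed.

Lemma bounded_op_mat_fst : bounded_op (ip_mat ip a b c) ip fst.
Proof.
have [C C0 H] := ip_mat_norm_equiv; split=> //; exists C => // X.
by have [_] := H X; apply: le_trans; have [] := ip_sum_norm ipP ipP X.
Qed.

Lemma bounded_op_mat_snd : bounded_op (ip_mat ip a b c) ip snd.
Proof.
have [C C0 H] := ip_mat_norm_equiv; split=> //; exists C => // X.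
by have [_] := H X; apply: le_trans; have [] := ip_sum_norm ipP ipP X.
Qed.

Lemma bounded_op_mat_pair f g : bounded_op ipu ip f -> bounded_op ipu ip g ->
  bounded_op ipu (ip_mat ip a b c) (fun x => (f x, g x)).
Proof.
move=> fb gb; have [l [D D0 HD]] := bounded_op_pair ipP ipP fb gb; split=> //.
have [C C0 H] := ip_mat_norm_equiv; exists (C * D) => [|x]; first exact: mulr_ge0.
by have [H1 _] := H (f x, g x); apply: le_trans H1 _; rewrite -mulrA ler_wpM2l.
Qed.

End ip_mat.

(** * Smooth bumps *)

Section bump.
Context {R : realType}.
Implicit Types (p q : {poly R}) (f g : R -> R) (x : R).

Lemma is_derive_cvg f x (d : R) :
  h^-1 *: (f (h *: (1 : R) + x) - f x) @[h --> (0 : R)^'] --> d -> is_derive x 1 f d.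
Proof.
move=> fd; apply: DeriveDef; first by apply/cvg_ex; exists d.
exact: cvg_lim.
Qed.

(* The derivatives of exp(-1/x) are of the form p(1/x) exp(-1/x). *)
Definition bump p x : R := if 0 < x then p.[x^-1] * expR (- x^-1) else 0.

(** The chain rule in p(1/x) exp(-1/x) produces a factor x^-2, which is X^2 in the variable 1/x. *)
Definition bump_deriv p : {poly R} := 'X^2 * (p - p^`()).

(** The exponential series is used at degree n + 1 rather than n: the spare factor 1 / y becomes the
    factor |x| of [bump_le] when y = 1/x. *)
Lemma exprn_expRN (y : R) n : 0 < y -> y ^+ n * expR (- y) <= n.+1`!%:R / y.
Proof.
move=> y0; have := expR_ge1Dxn n (ltW y0).
have f0 : 0 < n.+1`!%:R :> R by rewrite ltr0n fact_gt0.
rewrite expRN ler_pdivlMr// mulrAC ler_pdivrMr ?expR_gt0// -exprSr => H.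
have : y ^+ n.+1 / n.+1`!%:R <= expR y by lra.
by rewrite ler_pdivrMr// mulrC.
Qed.

(** The difference quotient of [bump p] at 0 is [bump ('X * p)], so a bound linear in |x|, valid for
    all polynomials, gives derivative 0 there. *)
Lemma bump_le p : exists2 C, 0 <= C & forall x, `|bump p x| <= C * `|x|.
Proof.
exists (\sum_(i < size p) `|p`_i| * i.+1`!%:R); first by rewrite sumr_ge0.
move=> x; rewrite /bump; case: ltP => x0; last by rewrite normr0 mulr_ge0// sumr_ge0.
have y0 : 0 < x^-1 by rewrite invr_gt0.
rewrite horner_coef mulr_suml mulr_suml (gtr0_norm x0).
apply: le_trans (ler_norm_sum _ _ _) _; apply: ler_sum => i _.
rewrite -mulrA normrM -mulrA ler_wpM2l// ger0_norm; last first.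
  by rewrite mulr_ge0 ?expR_ge0// exprn_ge0// ltW.
by have := exprn_expRN i y0; rewrite invrK.
Qed.

Lemma bump_is_derive p x : is_derive x 1 (bump p) (bump (bump_deriv p) x).
Proof.
have [x0|x0|->] := ltgtP x 0.
- rewrite {2}/bump ltNge (ltW x0) /=.
  apply: (near_eq_is_derive (f := cst (0 : R))).
  near=> y; rewrite /bump ltNge ltW//.
  by near: y; exact: lt_nbhsl.
- have xn0 : x != 0 by rewrite gt_eqF.
  have Hinv : is_derive x 1 (fun y : R => y^-1) (- x ^- 2).
    apply: DeriveDef; first exact: derivableV.
    by rewrite deriveV// derive_id /GRing.scale /= mulr1.
  have H1 := @is_derive1_comp _ (horner p) _ x _ _ (is_derive_poly p x^-1) Hinv.
  have H2 := @is_derive1_comp _ expR _ x _ _ (is_derive_expR (- x^-1)) (is_deriveN Hinv).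
  have := is_deriveM H1 H2.
  rewrite {2}/bump x0.
  have -> : (horner p \o (fun y => y^-1)) x *: (expR (- x^-1) * - - x ^- 2)
     + (expR \o - (fun y : R => y^-1)) x *: (p^`().[x^-1] * - x ^- 2) =
     (bump_deriv p).[x^-1] * expR (- x^-1).
    rewrite /bump_deriv /GRing.scale /= !hornerE /=.
    have -> : (- (fun y : R => y^-1)) x = - x^-1 by [].
    by rewrite -!exprVn; ring.
  apply: near_eq_is_derive; near=> y.
  rewrite /bump ifT//; near: y; exact: lt_nbhsr.
- apply: is_derive_cvg; rewrite {3}/bump ltxx.
  have [C C0 HC] := bump_le ('X * p).
  apply/cvgrPdist_lt => e e0; have C1 : 0 < e / (C + 1) by rewrite divr_gt0// ltr_wpDl.
  near=> h; rewrite sub0r normrN {2}/bump ltxx subr0 /GRing.scale /= mulr1 addr0.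
  have : `|h| < e / (C + 1) by near: h; exact: dnbhs0_lt.
  rewrite ltr_pdivlMr ?ltr_wpDl// => hC.
  suff -> : h^-1 * bump p h = bump ('X * p) h.
    by apply: le_lt_trans (HC h) _; have := normr_ge0 h; lra.
  by rewrite /bump; case: ltP => _; rewrite ?mulr0// hornerM hornerX mulrA.
Unshelve. all: by end_near. Qed.

(* Being closed under derivation, this class consists of smooth functions. *)
Inductive bump_span : (R -> R) -> Prop :=
| bump_prod k a b c p q : bump_span (fun x => c * (bump p (k * (x - a)) * bump q (k * (b - x))))
| bump_add f g : bump_span f -> bump_span g -> bump_span (fun x => f x + g x).

Lemma bump_span_derive f : bump_span f ->
  exists2 g, bump_span g & forall x, is_derive x 1 f (g x).
Proof.
elim=> [k a b c p q|f1 f2 _ [g1 s1 d1] _ [g2 s2 d2]]; last first.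
  exists (fun x => g1 x + g2 x); first exact: bump_add.
  by move=> x; exact: is_deriveD (d1 x) (d2 x).
exists (fun x => c * k * (bump (bump_deriv p) (k * (x - a)) * bump q (k * (b - x)))
  + - (c * k) * (bump p (k * (x - a)) * bump (bump_deriv q) (k * (b - x)))).
  exact: bump_add (bump_prod _ _ _ _ _ _) (bump_prod _ _ _ _ _ _).
move=> x.
have Ha : is_derive x 1 (fun y : R => k * (y - a)) k.
  have := is_deriveZ k (is_deriveB (is_derive_id x (1 : R)) (is_derive_cst a x 1)).
  by rewrite subr0 /GRing.scale /= mulr1.
have Hb : is_derive x 1 (fun y : R => k * (b - y)) (- k).
  have := is_deriveZ k (is_deriveB (is_derive_cst b x (1 : R)) (is_derive_id x 1)).
  by rewrite sub0r /GRing.scale /= mulrN mulr1.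
have H1 := @is_derive1_comp _ (bump p) _ x _ _ (bump_is_derive p _) Ha.
have H2 := @is_derive1_comp _ (bump q) _ x _ _ (bump_is_derive q _) Hb.
have := is_deriveZ c (is_deriveM H1 H2); rewrite /GRing.scale /=.
set d := (X in is_derive _ _ _ X -> _); set d' := (X in _ -> is_derive _ _ _ X).
by have -> : d = d' by rewrite /d /d'; ring.
Qed.

Lemma bump_span_smooth f : bump_span f ->
  forall n x, derivable (derive1n n f) x 1.
Proof.
move=> sf n; elim: n f sf => [|n IH] f sf x.
  by have [g _ /(_ x)[]] := bump_span_derive sf.
have [g sg fg] := bump_span_derive sf; rewrite derive1Sn.
suff -> : f^`()%classic = g by exact: IH.
by apply/funext => y; rewrite derive1E; have [] := fg y.
Qed.

(** A smooth approximation of the indicator of ]a, b[: it takes values in [0, 1], vanishes outside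
    ]a, b[, and the dilation by n + 1 drives both factors to 1 inside. *)
Definition theta (a b : R) (n : nat) (x : R) : R :=
  bump 1 (n.+1%:R * (x - a)) * bump 1 (n.+1%:R * (b - x)).

Lemma theta_span a b n : bump_span (theta a b n).
Proof.
have := bump_prod n.+1%:R a b 1 1 1; congr bump_span.
by apply/funext => x; rewrite mul1r.
Qed.

Lemma theta_out a b n x : x \notin `]a, b[ -> theta a b n x = 0.
Proof.
rewrite in_itv /= negb_and -!leNgt /theta /bump => /orP[xa|bx].
  by rewrite ltNge mulr_ge0_le0 ?mul0r// subr_le0.
by rewrite [X in _ * (if X then _ else _)]ltNge mulr_ge0_le0 ?mulr0// subr_le0.
Qed.

Lemma bump1_bounds x : 0 <= bump 1 x <= 1.
Proof.
rewrite /bump; case: ltP => x0; last by rewrite lexx ler01.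
rewrite hornerC mul1r expR_ge0 -[leRHS]expR0 ler_expR oppr_le0 invr_ge0.
exact: ltW.
Qed.

Lemma theta_bounds a b n x : `|theta a b n x| <= 1.
Proof.
have /andP[u0 u1] := bump1_bounds (n.+1%:R * (x - a)).
have /andP[v0 v1] := bump1_bounds (n.+1%:R * (b - x)).
by rewrite /theta ger0_norm ?mulr_ge0// mulr_ile1.
Qed.

Lemma bump1_cvg x : 0 < x -> bump 1 (n.+1%:R * x) @[n --> \oo] --> (1 : R).
Proof.
move=> x0; rewrite -[X in _ --> X]expR0.
have : expR (- (n.+1%:R^-1 * x^-1)) @[n --> \oo] --> expR (0 : R).
  apply: continuous_cvg; first exact: continuous_expR.
  rewrite -[X in _ --> X]oppr0; apply: cvgN; rewrite -[X in _ --> X](mul0r x^-1).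
  by apply: cvgMl; exact: cvg_harmonic.
apply: cvg_trans; apply: near_eq_cvg; near=> n.
by rewrite /bump mulr_gt0// hornerC mul1r invfM.
Unshelve. all: by end_near. Qed.

Lemma theta_cvg a b x : theta a b n x @[n --> \oo] --> (\1_(`]a, b[%classic) x : R).
Proof.
rewrite indicE mem_setE; have [|xab] := boolP (x \in _); last first.
  by under eq_cvg do rewrite theta_out//; exact: cvg_cst.
rewrite in_itv /= => /andP[ax xb]; rewrite -[X in _ --> X](mulr1 (1 : R)).
by apply: cvgM; apply: bump1_cvg; rewrite subr_gt0.
Qed.

End bump.

(** * The space L2(0, l) *)

Section L2_space.
Context {R : realType} (l : R).
Local Notation mu := (leb l).
Local Notation sq f := ((f : measurableTypeR R -> R) \in Lfun (leb l) 2%:E).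
Implicit Types (u v w : L2 l) (f g : R -> R).

Lemma leb_le (A : set R) : measurable A -> (leb l A <= @lebesgue_measure R A)%E.
Proof. by move=> mA; apply: le_measure; rewrite ?inE//; exact: measurableI. Qed.

Lemma ae_impl2 (P1 P2 Q : R -> Prop) : (forall y, P1 y -> P2 y -> Q y) ->
  {ae mu, forall y, P1 y} -> {ae mu, forall y, P2 y} -> {ae mu, forall y, Q y}.
Proof. by move=> PQ P1_ae P2_ae; exact: (ae_mono3 (fun y P1y P2y _ =>
  PQ y P1y P2y) P1_ae P2_ae P2_ae). Qed.

Lemma L2fun0 : {ae mu, forall y, L2fun (0 : L2 l) y = 0}.
Proof.
have := L2funZD (-1) (0 : L2 l) 0; rewrite scaler0 addr0.
by apply: ae_mono => y; rewrite mulN1r addNr.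
Qed.

Lemma ae_neq s : {ae mu, forall y, y != s}.
Proof.
exists [set s]; split; first exact: measurable_set1.
  apply/eqP; rewrite eq_le measure_ge0 andbT.
  by apply: le_trans (leb_le _) _; rewrite ?lebesgue_measure_set1.
by move=> y /= /negP; rewrite negbK => /eqP.
Qed.

Lemma ae_itv (P : R -> Prop) : (forall y, 0 < y < l -> P y) ->
  {ae mu, forall y, P y}.
Proof.
move=> H; exists (~` `]0, l[%classic); split.
- exact: measurableC.
- by rewrite /leb /= /mrestr setICl measure0.
- by move=> y /= nP yl; apply: nP; apply: H; move: yl; rewrite /= in_itv.
Qed.

Lemma sq_measurable f : sq f -> measurable_fun setT f.
Proof. by move=> /sub_Lfun_mfun; rewrite inE. Qed.

Lemma sqP f : measurable_fun setT f ->
  mu.-integrable setT (EFin \o (fun y => f y ^+ 2)) -> sq f.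
Proof.
move=> mf fi; rewrite inE; apply/andP; split; first by rewrite inE.
rewrite inE /finite_norm.
have : ('N[mu]_2%:E[EFin \o f] `^ 2 < +oo)%E.
  rewrite powR_Lnorm//; move/integrableP: fi => [_].
  congr (_ < _)%E; apply: eq_integral => y _ /=.
  by rewrite powR_mulrn// -normrX.
rewrite /=; move: (Lnorm _ _ _) => [r| |] //=; first by rewrite !ltry.
by rewrite pnatr_eq0 /= ltxx.
Qed.

Lemma L2fun_sq u : sq (L2fun u).
Proof. exact: LfunP. Qed.

Lemma L2fun_measurable u : measurable_fun setT (L2fun u).
Proof. exact: sq_measurable (L2fun_sq u). Qed.

Lemma L2fun_L1 u : mu.-integrable setT (EFin \o L2fun u).
Proof.
by apply/Lfun1_integrable; apply: (Lfun_subset12 (leb_fin l)); exact: LfunP.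
Qed.

(** Total on functions, so that classes can be written without carrying proofs; 0 is the junk value
    when [f] is not square integrable. *)
Definition L2of (f : R -> R) : L2 l :=
  if pselect (sq f) is left sf then \pi_(L2 l)%qT (Lfun_Sub (lee1n 2) sf) else 0.

Lemma L2ofE f : sq f -> {ae mu, forall y, L2fun (L2of f) y = f y}.
Proof.
move=> sf; rewrite /L2of; case: pselect => // sf'.
have /L2_ext_repr : repr (\pi_(L2 l)%qT (Lfun_Sub (lee1n 2) sf'))
  = (Lfun_Sub (lee1n 2) sf') %[mod L2 l]%qT by rewrite reprK.
by apply: ae_mono => y; rewrite Lfun_valP.
Qed.

Lemma L2_eq u v : {ae mu, forall y, L2fun u y = L2fun v y} -> u = v.
Proof. by move=> /L2_ext_repr; rewrite !reprK. Qed.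

Definition dot u v : R := \int[mu]_y (L2fun u y * L2fun v y).

Lemma dot_integrable u v :
  mu.-integrable setT (EFin \o (fun y => L2fun u y * L2fun v y)).
Proof.
by apply/Lfun1_integrable; exact: Lfun2_mul_Lfun1 (L2fun_sq u) (L2fun_sq v).
Qed.

Lemma ae_Rintegral (f g : R -> R) : measurable_fun setT f -> measurable_fun setT g ->
  {ae mu, forall y, f y = g y} -> \int[mu]_y f y = \int[mu]_y g y.
Proof.
move=> mf mg fg; congr fine; apply: ae_eq_integral => //.
- exact/measurable_EFinP.
- exact/measurable_EFinP.
- by apply: ae_mono fg => y /= ->.
Qed.

Lemma dotE u v f g : measurable_fun setT f -> measurable_fun setT g ->
  {ae mu, forall y, L2fun u y = f y} -> {ae mu, forall y, L2fun v y = g y} ->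
  dot u v = \int[mu]_y (f y * g y).
Proof.
move=> mf mg uf vg; apply: ae_Rintegral.
- exact: measurable_funM (L2fun_measurable u) (L2fun_measurable v).
- exact: measurable_funM.
- by apply: ae_impl2 uf vg => y -> ->.
Qed.

Lemma dot_inner_product : inner_product dot.
Proof.
split.
- by move=> u v; rewrite /dot; under eq_Rintegral do rewrite mulrC.
- move=> a u v w.
  have iaw : mu.-integrable setT (EFin \o (fun y => a * (L2fun u y * L2fun w y))).
    by have := integrableZl measurableT a (dot_integrable u w).
  rewrite /dot -RintegralZl//; last exact: dot_integrable.
  rewrite -RintegralD//; last exact: dot_integrable.
  have mM u' v' : measurable_fun setT (fun y => L2fun u' y * L2fun v' y).
    exact: measurable_funM (L2fun_measurable _) (L2fun_measurable _).
  apply: ae_Rintegral => //.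
    by apply: measurable_funD => //; apply: measurable_funM.
  by apply: ae_mono (L2funZD a u v) => y ->; rewrite mulrDl mulrA.
- move=> u u0; have i0 : 0 <= dot u u.
    by apply: Rintegral_ge0 => y _; rewrite -expr2 sqr_ge0.
  rewrite lt_neqAle i0 andbT eq_sym; apply: contra_neq u0 => uu0.
  apply: L2_eq; have := L2fun_sq u.
  have iu := dot_integrable u u.
  have : (\int[mu]_y `|(EFin \o (fun y => (L2fun u y * L2fun u y)%R)) y| = 0)%E.
    have <- : (dot u u)%:E = 0%E by rewrite uu0.
    rewrite /dot /Rintegral fineK; last exact: integrable_fin_num.
    by apply: eq_integral => y _; rewrite /= ger0_norm// -expr2 sqr_ge0.
  move/(ae_eq_integral_abs mu measurableT (measurable_int mu iu)) => H _.
  apply: ae_impl2 H L2fun0 => y /(_ I)/= [] /eqP; rewrite mulf_eq0 orbb => /eqP -> ->//.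
Qed.

Lemma L2of_eq f g : sq f -> sq g -> {ae mu, forall y, f y = g y} -> L2of f = L2of g.
Proof.
move=> sf sg fg; apply: L2_eq; apply: ae_mono3 (L2ofE sf) (L2ofE sg) fg.
by move=> y -> ->.
Qed.

Lemma dotE_of f g : sq f -> sq g -> dot (L2of f) (L2of g) = \int[mu]_y (f y * g y).
Proof.
by move=> sf sg; apply: dotE (L2ofE sf) (L2ofE sg); exact: sq_measurable.
Qed.

Lemma leb_fin_num_fun : fin_num_fun (leb l).
Proof.
move=> A mA; rewrite ge0_fin_numE//; apply: (@le_lt_trans _ _ (leb l setT)).
  by apply: le_measure; rewrite ?inE.
by have := leb_fin l; rewrite ge0_fin_numE.
Qed.

(** A copy of [leb l] that carries the structure of a finite measure, for the integrability of
    constants and for Fubini's theorem. *)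
Definition fin_leb (A : set (measurableTypeR R)) : \bar R := leb l A.

HB.instance Definition _ := Measure.copy fin_leb (leb l).

HB.instance Definition _ := Measure_isFinite.Build _ _ R fin_leb leb_fin_num_fun.

Lemma bounded_sq f (M : R) : measurable_fun setT f -> (forall y, `|f y| <= M) -> sq f.
Proof.
move=> mf fM; apply: sqP => //.
have M0 : 0 <= M by apply: le_trans (fM 0).
apply: (@le_integrable _ _ _ _ _ measurableT _ (EFin \o cst (M ^+ 2))).
- by apply/measurable_EFinP; apply: measurable_funX.
- move=> y _ /=; rewrite lee_fin !ger0_norm ?sqr_ge0//.
  by rewrite -real_normK ?num_real// ler_pXn2r ?nnegrE.
- exact: (@finite_measure_integrable_cst _ _ _ fin_leb).
Qed.

Lemma sqD f g : sq f -> sq g -> sq (fun y => f y + g y).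
Proof.
by move=> sf sg; have [_ H] := @Lfun_addr_closed _ _ _ mu _ (lee1n 2); exact: (H _ _ sf sg).
Qed.

Lemma sq_norm f : sq f -> sq (fun y => `|f y|).
Proof.
move=> sf; apply: sqP; first exact: measurableT_comp (sq_measurable sf).
have := Lfun2_integrable_sqr sf; congr (mu.-integrable setT _).
by apply/funext => y /=; rewrite real_normK ?num_real.
Qed.

Lemma one_sq : sq (cst 1).
Proof. by apply: (bounded_sq (M := 1)) => // y; rewrite normr1. Qed.

Lemma L1_le_nrm u : \int[mu]_y `|L2fun u y| <= ip_norm dot u * ip_norm dot (L2of (cst 1)).
Proof.
have dP := dot_inner_product; have su := sq_norm (L2fun_sq u).
have := cauchy_schwarz dP (L2of (fun y => `|L2fun u y|)) (L2of (cst 1)).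
rewrite dotE_of//; last exact: one_sq.
under eq_Rintegral do rewrite mulr1.
move=> H; apply: le_trans H _; rewrite ler_wpM2r ?nrm_ge0// nrm_le// dotE_of//.
rewrite le_eqVlt; apply/orP; left; apply/eqP; apply: eq_Rintegral => y _.
by rewrite -!expr2 real_normK ?num_real.
Qed.

(** Riesz-Fischer. Along a fast sequence the increments have summable L^1 norms, since |v|_1 <=
    |v|_2 |1|_2; their sum is thus finite almost everywhere and the sequence converges pointwise.
    Fatou's lemma turns pointwise convergence into convergence in norm. *)
Lemma L2_complete : complete_ip dot.
Proof.
have dP := dot_inner_product.
apply: geometric_complete => // u uq.
pose f k := L2fun (u k).
have mf k : measurable_fun setT (f k) by exact: L2fun_measurable.
pose d k (y : R) : R := `|f k.+1 y - f k y|.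
have md k : measurable_fun setT (d k).
  by apply: measurableT_comp => //; exact: measurable_funB.
have d0 k y : (0 <= (d k y)%:E)%E by rewrite lee_fin normr_ge0.
have fB k m : {ae mu, forall y, L2fun (u k - u m) y = f k y - f m y}.
  have := L2funZD (-1) (u m) (u k); rewrite scaleN1r addrC.
  by apply: ae_mono => y ->; rewrite mulN1r addrC.
(* The factor 2 writes |1| 2^-k as C / 2^(k+1), the summable terms of [epsilon_trick0]. *)
pose C := 2 * ip_norm dot (L2of (cst 1)).
have C0 : 0 <= C by rewrite mulr_ge0// nrm_ge0.
have dI k : (\int[mu]_y (d k y)%:E <= (C / (2 ^ k.+1)%:R)%:E)%E.
  have := L1_le_nrm (u k.+1 - u k); rewrite -lee_fin /Rintegral fineK; last first.
    apply: integrable_fin_num => //; apply/Lfun1_integrable/Lfun_norm.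
    by apply: (Lfun_subset12 (leb_fin l)); exact: LfunP.
  have -> : (\int[mu]_x `|L2fun (u k.+1 - u k) x|%:E = \int[mu]_y (d k y)%:E)%E.
    apply: ae_eq_integral => //.
    - by apply/measurable_EFinP; apply: measurableT_comp => //; exact: L2fun_measurable.
    - apply/measurable_EFinP; exact: md.
    - by apply: ae_mono (fB k.+1 k) => y /= ->.
  move/le_trans; apply; rewrite lee_fin /C natrX exprS invfM mulrACA mulfV// mul1r.
  by rewrite mulrC ler_wpM2l ?nrm_ge0// -exprVn; exact: uq.
have sumI : (\int[mu]_y (\sum_(0 <= k <oo) (d k y)%:E) <= C%:E)%E.
  rewrite integral_nneseries//; last by move=> k; apply/measurable_EFinP; exact: md.
  apply: le_trans (epsilon_trick0 xpredT C0); apply: lee_nneseries => //.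
  by move=> k _ _; apply: integral_ge0 => y _; exact: d0.
have fcvg : {ae mu, forall y, cvgn (fun k => f k y)}.
  have : mu.-integrable setT (fun y => \sum_(0 <= k <oo) (d k y)%:E)%E.
    apply/integrableP; split.
      apply: ge0_emeasurable_sum => k; first by move=> y _ _; exact: d0.
      by move=> _; apply/measurable_EFinP; exact: md.
    apply: le_lt_trans (ltry C); apply: le_trans sumI.
    rewrite le_eqVlt; apply/orP; left; apply/eqP; apply: eq_integral => y _.
    by rewrite gee0_abs// nneseries_ge0// => k _ _; exact: d0.
  move=> /(integrable_ae measurableT).
  apply: ae_mono => y /(_ I) fin.
  have : cvgn [normed series (telescope (fun k => f k y))].
    apply: nondecreasing_is_cvgn.
      apply/nondecreasing_seqP => n; rewrite /= /series/= big_nat_recr//=.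
      by rewrite lerDl.
    exists (fine (\sum_(0 <= k <oo) (d k y)%:E)%E) => _ [n _ <-].
    rewrite -lee_fin fineK// /series/= -sumEFin.
    by apply: nneseries_lim_ge => k _ _; exact: d0.
  move=> /normed_cvg; rewrite telescopeK => /(is_cvgD (is_cvg_cst (f 0%N y))).
  suff -> : cst (f 0%N y) + (fun n => f n y - f 0%N y) = fun n => f n y by [].
  by apply/funext => n /=; rewrite addrC subrK.
(* The upper limit is measurable on the whole line and agrees with the limit wherever the sequence
   converges. *)
pose F y := fine (limn_esup (fun k => (f k y)%:E)).
have mF : measurable_fun setT F.
  apply: measurableT_comp => //; apply: measurable_fun_limn_esup => k.
  apply/measurable_EFinP; exact: mf.
have fF : {ae mu, forall y, f k y @[k --> \oo] --> F y}.
  apply: ae_mono fcvg => y /cvg_ex[L fL].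
  suff -> : F y = L by [].
  have /cvg_limn_einf_sup[_ e] : (f k y)%:E @[k --> \oo] --> L%:E.
    by apply: cvg_EFin; [exact: nearW|exact: fL].
  by rewrite /F e.
have q01 : 0 <= (2^-1 : R) < 1 by apply/andP; split; lra.
have uq1 n : ip_norm dot (u n.+1 - u n) <= 1 * 2^-1 ^+ n by rewrite mul1r.
(* The square of the tail bound 2 * 2^-m given by [geometric_dist] with K = 1 and q = 1/2. *)
pose c m := (2 * 2^-1 ^+ m : R) ^+ 2.
have c0 m : 0 <= 2 * 2^-1 ^+ m :> R by rewrite mulr_ge0// exprn_ge0// invr_ge0.
have fatouE m : (\int[mu]_y ((F y - f m y) ^+ 2)%:E <= (c m)%:E)%E.
  pose g k y := ((f (k + m)%N y - f m y) ^+ 2)%:E.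
  have mg k : measurable_fun setT (g k).
    by apply/measurable_EFinP; apply: measurable_funX; exact: measurable_funB.
  have gI k : (\int[mu]_y g k y <= (c m)%:E)%E.
    have mk : (m <= k + m)%N by rewrite leq_addl.
    have := geometric_dist dP q01 uq1 mk.
    have -> : (1 / (1 - 2^-1) = 2 :> R) by field.
    move=> H; have {}H : dot (u (k + m)%N - u m) (u (k + m)%N - u m) <= c m.
      by rewrite -(sqr_nrm dP) ler_pXn2r// nnegrE ?nrm_ge0.
    move: H; rewrite -lee_fin /dot /Rintegral fineK; last first.
      by apply: integrable_fin_num => //; exact: dot_integrable.
    apply: le_trans; rewrite le_eqVlt; apply/orP; left; apply/eqP/esym.
    apply: ae_eq_integral => //.
      by apply/measurable_EFinP; apply: measurable_funM; exact: L2fun_measurable.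
      exact: mg.
    by apply: ae_mono (fB (k + m)%N m) => y /= -> _; rewrite /g expr2.
  have g0 k y : (0 <= g k y)%E by rewrite lee_fin sqr_ge0.
  have := fatou mu measurableT mg (fun k y _ => g0 k y).
  have -> : (\int[mu]_y limn_einf (g^~ y) = \int[mu]_y ((F y - f m y) ^+ 2)%:E)%E.
    apply: ae_eq_integral => //.
    - have -> : (fun y => limn_einf (g^~ y)) = (fun y => - limn_esup (fun k => - g k y))%E.
        by apply/funext => y; rewrite -[LHS]oppeK -limn_esupN.
      apply: measurableT_comp => //; apply: measurable_fun_limn_esup => k.
      by apply: measurableT_comp => //; exact: mg.
    - by apply/measurable_EFinP; apply: measurable_funX; exact: measurable_funB.
    - apply: ae_mono fF => y fy _.
      have : g k y @[k --> \oo] --> ((F y - f m y) ^+ 2)%:E.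
        apply: cvg_EFin; first exact: nearW.
        apply: cvgM; (apply: cvgB; last exact: cvg_cst);
        by rewrite (cvg_shiftn m (fun k => f k y)).
      by move=> /cvg_limn_einf_sup[].
  move/le_trans; apply; rewrite limn_einf_lim; apply: lime_le; first exact: is_cvg_einfs.
  apply: nearW => n; apply: le_trans (gI n); apply: ereal_inf_lbound.
  by exists n => /=.
have sB m : sq (fun y => F y - f m y).
  apply: sqP; first exact: measurable_funB.
  apply/integrableP; split.
    by apply/measurable_EFinP; apply: measurable_funX; exact: measurable_funB.
  apply: le_lt_trans (ltry (c m)); apply: le_trans (fatouE m).
  rewrite le_eqVlt; apply/orP; left; apply/eqP; apply: eq_integral => y _ /=.
  by rewrite ger0_norm// sqr_ge0.
have sF : sq F.
  have -> : F = fun y => F y - f 0%N y + f 0%N y by apply/funext => y; rewrite subrK.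
  exact: sqD (sB 0%N) (L2fun_sq _).
exists (L2of F).
apply: (tends_squeeze (b := fun m => 2 * 2^-1 ^+ m)) => [m|]; last first.
  rewrite -[X in _ --> X](mulr0 2); apply: cvgMr; apply: cvg_expr.
  by rewrite ger0_norm; lra.
rewrite nrmB// -(@ler_pXn2r _ 2)// ?nnegrE ?nrm_ge0//.
rewrite (sqr_nrm dP) -/(c m) -lee_fin.
have FmE : {ae mu, forall y, L2fun (L2of F - u m) y = F y - f m y}.
  have := L2funZD (-1) (u m) (L2of F); rewrite scaleN1r addrC => H.
  by apply: ae_impl2 H (L2ofE sF) => y -> ->; rewrite mulN1r addrC.
have mFm := measurable_funB mF (mf m).
rewrite (dotE mFm mFm FmE FmE) /Rintegral fineK.
  by apply: le_trans (fatouE m); under eq_integral do rewrite -expr2.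
apply: integrable_fin_num => //; under eq_fun do rewrite -expr2.
exact: Lfun2_integrable_sqr (sB m).
Qed.

(** * Primitives and absolutely continuous representatives *)

Definition L2one : L2 l := L2of (cst 1).

Lemma indic_sq (A : set R) : measurable A -> sq (\1_A).
Proof.
move=> mA; apply: (bounded_sq (M := 1)); first exact: measurable_indic.
by move=> y; rewrite indicE; case: (_ \in _); rewrite ?normr1 ?normr0.
Qed.

Lemma dot_indic (A B : set R) : measurable A -> measurable B ->
  dot (L2of \1_A) (L2of \1_B) = fine (leb l (A `&` B)).
Proof.
move=> mA mB; rewrite dotE_of; [|exact: indic_sq|exact: indic_sq].
have mAB : measurable (A `&` B) by exact: measurableI.
have <- : (\int[mu]_y (\1_(A `&` B) y)%:E = leb l (A `&` B))%E.
  by rewrite integral_indic// setIT.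
by congr fine; apply: eq_integral => y _; rewrite indicI.
Qed.

(** Integration from 0 to x is the inner product with this class, so bounds and moduli of continuity
    of primitives become instances of Cauchy-Schwarz. The half-line makes the primitive total: it is
    constant to the left of 0 and to the right of l. *)
Definition chi (x : R) : L2 l := L2of (\1_(`]-oo, x[%classic)).

Definition primitive u (x : R) : R := dot u (chi x).

Definition J u : L2 l := L2of (primitive u).

Let dP := dot_inner_product.
Local Notation ipE := (ipE dP).
Local Notation nrm := (ip_norm dot).

Lemma chiB s t : s <= t -> chi t - chi s = L2of (\1_(`[s, t[%classic)).
Proof.
move=> st; apply: L2_eq.
have mi i : measurable [set` (i : interval R)] by exact: measurable_itv.
have := L2funZD (-1) (chi s) (chi t); rewrite scaleN1r addrC => H.
have Hs := L2ofE (indic_sq (mi (Interval -oo%O (BLeft s)))).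
have Ht := L2ofE (indic_sq (mi (Interval -oo%O (BLeft t)))).
have Hst := L2ofE (indic_sq (mi (Interval (BLeft s) (BLeft t)))).
apply: ae_impl2 (ae_mono3 _ H Hs Ht) Hst; last first.
  by move=> y e1 e2 e3; exact: (And3 e1 e2 e3).
move=> y [-> e1 e2] ->; rewrite /chi e1 e2 !indicE !mem_setE !in_itv /=.
case: (ltP y s) => ys; case: (ltP y t) => yt; rewrite ?andbT ?andbF ?mulr1 ?mulr0 ?addrN
  ?addNr ?add0r ?oppr0//.
by move: (lt_le_trans ys st); rewrite ltNge yt.
Qed.

Lemma dot_chiB s t : s <= t -> dot (chi t - chi s) (chi t - chi s) <= t - s.
Proof.
move=> st; rewrite chiB// dot_indic// setIid -lee_fin fineK; last first.
  exact: leb_fin_num_fun.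
apply: le_trans (leb_le _) _ => //.
by rewrite lebesgue_measure_itv/=; case: ifP => _; rewrite lee_fin// subr_ge0.
Qed.

Lemma nrm_chi_le x : nrm (chi x) <= nrm L2one.
Proof.
rewrite nrm_le// /L2one -indicT !dot_indic// !setIid -lee_fin !fineK; last 2 first.
- exact: leb_fin_num_fun.
- exact: leb_fin_num_fun.
by apply: le_measure; rewrite ?inE.
Qed.

Lemma chi_le0 x : x <= 0 -> chi x = 0.
Proof.
move=> x0; apply/eqP; rewrite -(subr0 (chi x)); apply/eqP.
apply: L2_eq; have := L2ofE (indic_sq (measurable_itv `]-oo, x[)).
move=> H2; have H1 := L2fun0.
have H3 : {ae mu, forall y, (\1_(`]-oo, x[%classic) y = 0 :> R)}.
  apply: ae_itv => y /andP[y0 _]; rewrite indicE mem_setE in_itv /=.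
  by rewrite ltNge (le_trans x0 (ltW y0)).
rewrite subr0; apply: (ae_mono3 _ H1 H2 H3) => y e1 e2 e3.
by rewrite e1 /chi e2 e3.
Qed.

Lemma chi_ge x : l <= x -> chi x = L2one.
Proof.
move=> lx; apply: L2of_eq; [exact: indic_sq|exact: one_sq|].
apply: ae_itv => y /andP[_ yl]; rewrite indicE mem_setE in_itv /=.
by rewrite (lt_le_trans yl lx).
Qed.

Lemma primitive_lin a u v x : primitive (a *: u + v) x = a * primitive u x + primitive v x.
Proof. by rewrite /primitive !ipE. Qed.

Lemma primitive0 u : primitive u 0 = 0.
Proof. by rewrite /primitive chi_le0// ip0r. Qed.

Lemma primitive_l u : primitive u l = dot u L2one.
Proof. by rewrite /primitive chi_ge. Qed.

Lemma primitive_dist u s t : (primitive u t - primitive u s) ^+ 2 <= dot u u * `|t - s|.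
Proof.
wlog st : s t / s <= t.
  move=> H; have [st|/ltW ts] := leP s t; first exact: H.
  by rewrite -sqrrN opprB distrC H.
rewrite /primitive -ipNr// -ipDr//; apply: le_trans (sqr_cauchy_schwarz dP _ _) _.
by rewrite ler_wpM2l ?ip_ge0// (le_trans (dot_chiB st))// ler_norm.
Qed.

Lemma primitive_bounded u x : `|primitive u x| <= nrm u * nrm L2one.
Proof.
apply: le_trans (abs_cauchy_schwarz dP _ _) _.
by rewrite ler_wpM2l ?nrm_ge0// nrm_chi_le.
Qed.

Lemma primitive_continuous u : continuous (primitive u).
Proof.
move=> x; apply/cvgrPdist_lt => e e0.
have u0 : 0 < dot u u + 1 by rewrite ltr_wpDl ?ip_ge0.
have d0 : 0 < e ^+ 2 / (dot u u + 1) by rewrite divr_gt0 ?exprn_gt0.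
near=> y.
have : `|x - y| < e ^+ 2 / (dot u u + 1).
  by near: y; move: d0; apply: cvgr_dist_lt; exact: cvg_id.
rewrite ltr_pdivlMr// => H.
rewrite -(@ltr_pXn2r _ 2)// ?nnegrE ?(ltW e0)// real_normK ?num_real//.
apply: le_lt_trans (primitive_dist u y x) _; apply: le_lt_trans H.
by rewrite mulrC ler_wpM2l// lerDl.
Unshelve. all: by end_near. Qed.

Lemma primitive_sq u : sq (primitive u).
Proof.
apply: bounded_sq (primitive_bounded u).
by apply: continuous_measurable_fun; exact: primitive_continuous.
Qed.

Lemma JE u : {ae mu, forall y, L2fun (J u) y = primitive u y}.
Proof. exact: L2ofE (primitive_sq u). Qed.

Lemma J_linear : linear J.
Proof.
move=> a u v; apply: L2_eq.
have H1 := JE u; have H2 := JE v; have H3 := JE (a *: u + v).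
have H4 := L2funZD a (J u) (J v).
have H5 : {ae mu, forall y, L2fun (a *: J u + J v) y = a * primitive u y + primitive v y}.
  by apply: ae_mono3 H1 H2 H4 => y -> ->.
by apply: ae_impl2 H3 H5 => y -> ->; rewrite primitive_lin.
Qed.

Lemma ip_sumr (V : lmodType R) (ip : V -> V -> R) (ipP : inner_product ip)
    (I : Type) (r : seq I) (F : I -> V) x :
  ip x (\sum_(i <- r) F i) = \sum_(i <- r) ip x (F i).
Proof.
by elim/big_rec2: _ => [|i a b _ <-]; rewrite ?(ip0r ipP)// (ipDr ipP).
Qed.

(* With D_i = 1_[s_i, t_i[ the sum of the |F(t_i) - F(s_i)| is <u, w> for some
   w = sum_i +-D_i, and |w|^2 = sum_i |D_i|^2 because the D_i are orthogonal. *)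
Lemma primitive_abs_cont u : abs_cont 0 l (primitive u).
Proof.
move=> e e0; have u1 : 0 < nrm u + 1 by rewrite ltr_wpDl ?nrm_ge0.
exists ((e / (nrm u + 1)) ^+ 2); first by rewrite exprn_gt0// divr_gt0.
move=> n s t st dis lt_d.
pose D i := chi (t i) - chi (s i).
pose w := \sum_(i < n) Num.sg (dot u (D i)) *: D i.
have -> : \sum_i `|primitive u (t i) - primitive u (s i)| = dot u w.
  rewrite /w ip_sumr//; apply: eq_bigr => i _.
  by rewrite /primitive -ipNr// -ipDr// ipZr// -normrEsg.
have orth i j : i != j -> dot (D i) (D j) = 0.
  move=> ij; have [_ sti _] := st i; have [_ stj _] := st j.
  rewrite /D !chiB// dot_indic//.
  suff -> : `[s i, t i[%classic `&` `[s j, t j[%classic = set0 :> set R by rewrite measure0.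
  apply/seteqP; split => // y [] /=; rewrite !in_itv /= => /andP[a1 a2] /andP[b1 b2].
  (* The hypothesis is on open intervals while D i is the indicator of a half-open one. A common
     point y, possibly a left endpoint, is moved right to a point z common to the open intervals. *)
  pose z := (y + Num.min (t i) (t j)) / 2.
  have m1 : Num.min (t i) (t j) <= t i by rewrite ge_min lexx.
  have m2 : Num.min (t i) (t j) <= t j by rewrite ge_min lexx orbT.
  have m3 : y < Num.min (t i) (t j) by rewrite lt_min a2.
  have zi : `]s i, t i[%classic z by rewrite /= in_itv /= /z; apply/andP; split; lra.
  have zj : `]s j, t j[%classic z by rewrite /= in_itv /= /z; apply/andP; split; lra.
  by move/eqP: ij; apply; apply: (dis i j) => //; exists z.
have ww : dot w w <= \sum_i (t i - s i).
  rewrite {2}/w ip_sumr//; apply: ler_sum => i _.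
  have [_ sti _] := st i.
  rewrite ipZr// (ipC dP w) /w ip_sumr// (bigD1 i)//= big1 ?addr0; last first.
    by move=> j ji; rewrite ipZr// orth ?mulr0// eq_sym.
  rewrite ipZr// mulrA -expr2; apply: le_trans (dot_chiB sti).
  rewrite -/(D i) -[leRHS]mul1r ler_wpM2r ?ip_ge0// sqr_sg.
  by case: (_ == 0).
apply: le_lt_trans (cauchy_schwarz dP _ _) _.
have nw : nrm w < e / (nrm u + 1).
  rewrite -(@ltr_pXn2r _ 2)// ?nnegrE ?nrm_ge0 ?divr_ge0 ?(ltW e0) ?(ltW u1)//.
  by rewrite sqr_nrm//; exact: le_lt_trans ww lt_d.
have := nrm_ge0 dot u; have := nrm_ge0 dot w; move: nw; rewrite ltr_pdivlMr//; nra.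
Qed.

Hypothesis l_gt0 : 0 < l.

Lemma ae_dense (P : R -> Prop) a b : {ae mu, forall y, P y} -> 0 <= a -> a < b ->
  b <= l -> exists2 y, a < y < b & P y.
Proof.
move=> [N [mN N0 PN]] a0 ab bl; apply: contrapT => nP.
have : (leb l `]a, b[%classic <= leb l N)%E.
  apply: le_measure; rewrite ?inE// => y /=; rewrite in_itv /= => yab.
  by apply: PN => Py; apply: nP; exists y.
rewrite N0 /leb /= /mrestr.
have -> : `]a, b[%classic `&` `]0, l[%classic = `]a, b[%classic :> set R.
  apply/setIidPl => y /=; rewrite !in_itv /= => /andP[ay yb].
  by rewrite (le_lt_trans a0 ay) (lt_le_trans yb bl).
rewrite lebesgue_measure_itv /= lte_fin ab lee_fin; lra.
Qed.

Lemma abs_cont_dist (f : R -> R) e : abs_cont 0 l f -> 0 < e ->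
  exists2 d, 0 < d & forall x y, 0 <= x -> x <= y -> y <= l -> y - x < d ->
    `|f y - f x| < e.
Proof.
move=> acf e0; have [d d0 H] := acf e e0; exists d => // x y x0 xy yl yx.
have := H 1%N (fun=> x) (fun=> y); rewrite !big_ord1; apply=> //.
by move=> i j _ _ _; rewrite !ord1.
Qed.

(** Two representatives agree at points arbitrarily close to x. These are taken on the right of x
    when 2 x <= l and on the left otherwise, so that the endpoints 0 and l, where traces are read,
    are covered. *)
Lemma ac_rep_uniq u f g x : ac_rep u f -> ac_rep u g -> 0 <= x <= l -> f x = g x.
Proof.
move=> [acf uf] [acg ug] /andP[x0 xl]; apply/eqP; rewrite -subr_eq0 -normr_le0.
apply/ler_addgt0Pr => e e0; rewrite add0r; have e20 : 0 < e / 2 by lra.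
have [d d0 Hf] := abs_cont_dist acf e20; have [d' d'0 Hg] := abs_cont_dist acg e20.
have fg : {ae mu, forall y, f y = g y} by apply: ae_impl2 uf ug => y -> ->.
pose r := Num.min d d'; have r0 : 0 < r by rewrite lt_min d0.
have [rd rd'] : r <= d /\ r <= d' by rewrite !ge_min !lexx orbT.
have [xl2|xl2] := leP (x + x) l.
  have xl' : x < l by move: l_gt0 xl2; lra.
  have ml : x < Num.min (x + r) l by rewrite lt_min ltrDl r0 xl'.
  have [|y /andP[xy]] := ae_dense fg x0 ml; first by rewrite ge_min lexx orbT.
  rewrite lt_min => /andP[yr yl] fgy.
  have := Hf x y x0 (ltW xy) (ltW yl) ltac:(lra).
  have := Hg x y x0 (ltW xy) (ltW yl) ltac:(lra).
  rewrite fgy => A1 A2; have -> : f x - g x = (g y - g x) - (g y - f x) by ring.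
  apply: le_trans (ler_normB _ _) _; lra.
have ml : Num.max (x - r) 0 < x by rewrite gt_max; apply/andP; split; lra.
have r0l : 0 <= Num.max (x - r) 0 by rewrite le_max lexx orbT.
have [y /andP[]] := ae_dense fg r0l ml xl.
rewrite gt_max => /andP[yr y0] yx fgy.
have := Hf y x (ltW y0) (ltW yx) xl ltac:(lra).
have := Hg y x (ltW y0) (ltW yx) xl ltac:(lra).
rewrite fgy => A1 A2; have -> : f x - g x = (f x - g y) - (g x - g y) by ring.
apply: le_trans (ler_normB _ _) _; lra.
Qed.

Lemma has_value_uniq u x a b : 0 <= x <= l -> has_value u x a -> has_value u x b -> a = b.
Proof.
by move=> x0l [f uf <-] [g ug <-]; exact: ac_rep_uniq uf ug x0l.
Qed.

Lemma valueE u x a : 0 <= x <= l -> has_value u x a -> value u x = a.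
Proof.
move=> x0l ua; rewrite /value; case: xgetP => [y _ /= uy|/(_ a)//].
exact: has_value_uniq uy ua.
Qed.

Lemma abs_cont_cst (a b c : R) : abs_cont a b (cst c).
Proof.
by move=> e e0; exists 1 => // n s t _ _ _; rewrite big1// => i _; rewrite subrr normr0.
Qed.

Lemma affine_ac_rep c v : ac_rep (c *: L2one + J v) (fun x => c + primitive v x).
Proof.
split.
  have := abs_contZD c (abs_cont_cst 0 l 1) (primitive_abs_cont v).
  by congr abs_cont; apply/funext => x /=; rewrite mulr1.
have := L2funZD c L2one (J v); have := L2ofE one_sq; have := JE v.
by move=> H1 H2 H3; apply: ae_mono3 H1 H2 H3 => y -> -> -> /=; rewrite mulr1.
Qed.

Lemma affine_value c v x : 0 <= x <= l -> value (c *: L2one + J v) x = c + primitive v x.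
Proof.
by move=> x0l; apply: valueE => //; exists (fun x => c + primitive v x) => //;
  exact: affine_ac_rep.
Qed.

Lemma primitive_one x : 0 <= x <= l -> primitive L2one x = x.
Proof.
move=> /andP[x0 xl]; rewrite /primitive /L2one -indicT dot_indic// setTI.
rewrite /leb /= /mrestr.
have -> : `]-oo, x[%classic `&` `]0, l[%classic = `]0, x[%classic :> set R.
  apply/seteqP; split => y /=; rewrite !in_itv /=.
    by move=> [-> /andP[->]].
  by move=> /andP[-> yx]; split => //; rewrite (lt_le_trans yx xl).
rewrite lebesgue_measure_itv /= lte_fin; case: ltP => [x0'|x0'] /=.
  by rewrite subr0.
by apply/eqP; rewrite eq_le x0 x0'.
Qed.

Lemma primitive_sqr_le u x : 0 <= x <= l -> primitive u x ^+ 2 <= dot u u * x.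
Proof.
by move=> /andP[x0 _]; have := primitive_dist u 0 x; rewrite primitive0 !subr0 ger0_norm.
Qed.

Lemma dot_EFin u f : sq f ->
  (\int[mu]_y (L2fun u y * f y)%:E = (dot u (L2of f))%:E)%E.
Proof.
move=> sf; rewrite /dot /Rintegral fineK; last first.
  by apply: integrable_fin_num => //; exact: dot_integrable.
apply: ae_eq_integral => //.
- by apply/measurable_EFinP; apply: measurable_funM; [exact: L2fun_measurable|exact:
  sq_measurable].
- by apply/measurable_EFinP; apply: measurable_funM; exact: L2fun_measurable.
- by apply: ae_mono (L2ofE sf) => y /= ->.
Qed.

Lemma L2of_gt s : L2of (\1_(`]s, +oo[%classic)) = L2one - chi s.
Proof.
apply: L2_eq; have := L2funZD (-1) (chi s) L2one; rewrite scaleN1r addrC => H.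
have H1 := L2ofE one_sq; have H2 := L2ofE (indic_sq (measurable_itv `]s, +oo[)).
have H3 := L2ofE (indic_sq (measurable_itv `]-oo, s[)).
apply: ae_impl2 (ae_mono3 (fun y => @And3 _ _ _) H H1 (ae_neq s))
  (ae_impl2 (fun y => @conj _ _) H2 H3).
move=> y [-> e1 ys] [-> e3]; rewrite /chi e1 e3 !indicE !mem_setE !in_itv /= andbT.
by move: ys; case: ltgtP => //= _ _; rewrite ?mulr1 ?mulr0 ?addNr ?add0r.
Qed.

(* Fubini on the triangle s < x of the square ]0, l[^2. *)
Lemma J_adjoint u v : dot (J u) v = dot u (dot v L2one *: L2one - J v).
Proof.
(* The indicator of s < x is written as a function of x - s, so that its joint measurability reduces
   to that of a difference. *)
pose k (s x : R) : R := \1_(`]0, +oo[%classic) (x - s).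
have kl x : k^~ x = \1_(`]-oo, x[%classic).
  by apply/funext => s; rewrite /k !indicE !mem_setE !in_itv /= andbT subr_gt0.
have kr s : k s = \1_(`]s, +oo[%classic).
  by apply/funext => x; rewrite /k !indicE !mem_setE !in_itv /= !andbT subr_gt0.
pose f (p : measurableTypeR R * measurableTypeR R) :=
  (L2fun u p.1 * (L2fun v p.2 * k p.1 p.2))%:E.
have mf : measurable_fun setT f.
  apply/measurable_EFinP; apply: measurable_funM.
    exact: measurableT_comp (L2fun_measurable u) measurable_fst.
  apply: measurable_funM.
    exact: measurableT_comp (L2fun_measurable v) measurable_snd.
  apply: (measurableT_comp (measurable_indic (measurable_itv `]0, +oo[))).
  exact: measurable_funB measurable_snd measurable_fst.
have F1 s : (\int[mu]_x f (s, x) = (L2fun u s * (dot v (L2one - chi s)))%:E)%E.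
  rewrite /f /=; under eq_integral do rewrite EFinM.
  rewrite integralZl//; last first.
    apply/Lfun1_integrable; apply: Lfun2_mul_Lfun1 (L2fun_sq v) _.
    by rewrite kr; exact: indic_sq.
  by rewrite dot_EFin ?kr ?L2of_gt//; exact: indic_sq.
have F2 x : (\int[mu]_s f (s, x) = (L2fun v x * primitive u x)%:E)%E.
  rewrite /f /=; under eq_integral do rewrite mulrCA EFinM.
  rewrite integralZl//; last first.
    apply/Lfun1_integrable; apply: Lfun2_mul_Lfun1 (L2fun_sq u) _.
    by rewrite kl; exact: indic_sq.
  by rewrite dot_EFin ?kl//; exact: indic_sq.
have fi : ((fin_leb \x fin_leb)%E).-integrable setT f.
  apply/integrable12ltyP => //.
  have /integrableP[_ vfin] := L2fun_L1 v; have /integrableP[_ ufin] := L2fun_L1 u.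
  pose c := fine (\int[mu]_x `|(L2fun v x)%:E|)%E.
  have cE : (\int[mu]_x `|(L2fun v x)%:E| = c%:E)%E.
    by rewrite fineK// ge0_fin_numE ?integral_ge0.
  have c0 : 0 <= c by rewrite fine_ge0 ?integral_ge0.
  have mav w : measurable_fun setT (fun x => (`|L2fun w x|)%:E : \bar R).
    by apply/measurable_EFinP; apply: measurableT_comp => //; exact: L2fun_measurable.
  apply: (@le_lt_trans _ _ (\int[mu]_s (c%:E * `|(L2fun u s)%:E|)))%E; last first.
    by rewrite ge0_integralZl//; [exact: lte_mul_pinfty|exact: mav].
  apply: ge0_le_integral => //.
  - by move=> s _; apply: integral_ge0.
  - apply: (measurable_fun_fubini_tonelli_F (m2 := fin_leb) (abse \o f)).
      exact: measurableT_comp.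
    by move=> p; exact: abse_ge0.
  - by apply: emeasurable_funM => //; exact: mav.
  - move=> s _; rewrite -cE muleC -ge0_integralZl//; last exact: mav.
    apply: ge0_le_integral => //.
    - by apply: measurableT_comp => //; exact: measurableT_comp mf (measurable_pair1 s).
    - by apply: emeasurable_funM => //; exact: mav.
    - move=> x _; rewrite /f /= -EFinM lee_fin !normrM.
      apply: ler_wpM2l => //; rewrite ler_piMr// /k indicE.
      by case: (_ \in _); rewrite ?normr1 ?normr0.
have FE : (\int[mu]_s (\int[mu]_x f (s, x)) = \int[mu]_x (\int[mu]_s f (s, x)))%E.
  exact: (@Fubini _ _ _ _ R fin_leb fin_leb f fi).
have s1 : sq (fun s => dot v (L2one - chi s)).
  have -> : (fun s => dot v (L2one - chi s)) =
     (fun s => cst (dot v L2one) s + primitive (- v) s).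
    by apply/funext => s; rewrite /primitive /= !ipE.
  apply: sqD (primitive_sq _).
  by apply: (bounded_sq (M := `|dot v L2one|)).
have := dot_EFin v (primitive_sq u); have := dot_EFin u s1.
move: FE; rewrite (eq_integral _ _ (fun s _ => F1 s)) (eq_integral _ _ (fun x _ => F2 x)).
move=> E1 E2 E3; have /(congr1 fine) E4 := etrans (esym E2) (etrans E1 E3).
apply: (etrans (ipC dP (J u) v)); apply: (etrans (esym E4)).
congr (dot u _); apply: L2_eq.
have H1 := L2funZD (-1) (J v) (dot v L2one *: L2one).
have H2 := L2funZD (dot v L2one) L2one 0; have H3 := L2ofE one_sq; have H4 := JE v.
have H5 := L2ofE s1.
rewrite addr0 in H2; rewrite scaleN1r addrC in H1.
apply: ae_mono3 (ae_mono3 (fun y => @And3 _ _ _) H1 H2 H3)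
  (ae_impl2 (fun y => @conj _ _) H4 H5) L2fun0.
move=> y [-> -> e1] [-> ->] ->; rewrite e1 /primitive !ipE /=; ring.
Qed.

(** * Estimates for iterated primitives *)

Local Notation lam := (@lebesgue_measure R).

Lemma integral_leb (D : set R) (g : R -> \bar R) : D `<=` `]0, l[ ->
  (\int[mu]_(y in D) g y = \int[lam]_(y in D) g y)%E.
Proof.
move=> Dl; apply: eq_measure_integral => A mA AD; rewrite /leb /= /mrestr.
by congr (lam _); apply/setIidPl; exact: subset_trans AD Dl.
Qed.

Lemma ae_itv_mem : {ae mu, forall y, y \in `]0, l[}.
Proof. by apply: ae_itv => y; rewrite in_itv. Qed.

Lemma integral_lebT (g : R -> \bar R) : measurable_fun setT g ->
  (\int[mu]_y g y = \int[lam]_(y in `]0%R, l[) g y)%E.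
Proof.
move=> mg; rewrite -integral_leb// [RHS]integral_mkcond; apply: ae_eq_integral => //.
  apply/(measurable_restrictT _ _).1 => //; exact: measurable_funS mg.
by apply: ae_mono ae_itv_mem => y yl _; rewrite patchE mem_setE yl.
Qed.

Lemma continuous_sq f : continuous f -> sq f.
Proof.
move=> cf; have mf : measurable_fun setT f by exact: continuous_measurable_fun.
apply: sqP => //; apply/integrableP; split.
  by apply/measurable_EFinP; exact: measurable_funX.
rewrite integral_lebT; last first.
  by apply: measurableT_comp => //; apply/measurable_EFinP; exact: measurable_funX.
have : lam.-integrable `[0, l] (EFin \o (fun y => f y ^+ 2)).
  apply: continuous_compact_integrable; first exact: segment_compact.
  by apply: continuous_subspaceT => y; apply: cvgM; exact: cf.
move=> fi; have /integrableP[_] : lam.-integrable `]0, l[ (EFin \o (fun y => f y ^+ 2)).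
  by apply: integrableS fi => //; exact: subset_itv_oo_cc.
exact.
Qed.

Lemma primitive_integral f x : sq f -> 0 <= x <= l ->
  primitive (L2of f) x = \int[lam]_(y in `]0, x[) f y.
Proof.
move=> sf /andP[x0 xl]; have mx : measurable (`]0, x[%classic : set R) by [].
rewrite /primitive; have -> : chi x = L2of (\1_(`]0, x[%classic)).
  apply: L2of_eq; [exact: indic_sq|exact: indic_sq|].
  apply: ae_itv => y /andP[y0 _]; rewrite !indicE !mem_setE !in_itv /= y0//.
rewrite dotE_of//; last exact: indic_sq.
have xl' : `]0, x[ `<=` `]0, l[ by apply: subset_itvl; rewrite bnd_simp.
rewrite /Rintegral -(integral_leb _ xl') [in RHS]integral_mkcond; congr fine.
apply: eq_integral => y _; rewrite patchE indicE; case: (y \in _); first by rewrite mulr1.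
by rewrite mulr0.
Qed.

Lemma primitive_C1 (f F : R -> R) x : continuous f -> (forall y, derivable F y 1) ->
  (forall y, F^`()%classic y = f y) -> 0 <= x <= l ->
  primitive (L2of f) x = F x - F 0.
Proof.
move=> cf dF Ff x0l; rewrite primitive_integral//; last exact: continuous_sq.
have /andP[x0 xl] := x0l; move: x0; rewrite le_eqVlt => /predU1P[<-|x0].
  by rewrite set_itv_ge ?Rintegral_set0 ?subrr// bnd_simp ltxx.
have cF : continuous F by move=> y; apply: differentiable_continuous; exact/derivable1_diffP.
have cfx : {within `[0, x], continuous f} by exact: continuous_subspaceT.
have fi : lam.-integrable `[0, x] (EFin \o f).
  by apply: continuous_compact_integrable => //; exact: segment_compact.
rewrite Rintegral_itv_obnd_cbnd; last first.
  by apply: integrableS fi => //; exact: subset_itv_oo_cc.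
rewrite Rintegral_itv_bndo_bndc; last first.
  by apply: integrableS fi => //; exact: subset_itv_co_cc.
rewrite /Rintegral (continuous_FTC2 x0 cfx (F := F))//.
split; first by move=> y _.
  by apply: cvg_at_right_filter; exact: cF.
by apply: cvg_at_left_filter; exact: cF.
Qed.

Lemma integral_dot u f : sq f -> \int[mu]_y (L2fun u y * f y) = dot u (L2of f).
Proof. by move=> sf; have /(congr1 fine) := dot_EFin u sf. Qed.

Lemma sq_integrable f g : sq f -> sq g ->
  mu.-integrable setT (EFin \o (fun y => f y * g y)).
Proof. by move=> sf sg; apply/Lfun1_integrable; exact: Lfun2_mul_Lfun1 sf sg. Qed.

Lemma le_ae_Rintegral f g : mu.-integrable setT (EFin \o f) ->
  mu.-integrable setT (EFin \o g) -> {ae mu, forall y, f y <= g y} ->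
  \int[mu]_y f y <= \int[mu]_y g y.
Proof.
move=> fi gi fg; rewrite -subr_ge0 -RintegralB//.
have mf : measurable_fun setT f by apply/measurable_EFinP; exact: measurable_int fi.
have mg : measurable_fun setT g by apply/measurable_EFinP; exact: measurable_int gi.
have mgf := measurable_funB mg mf.
rewrite (ae_Rintegral (g := fun y => `|g y - f y|) mgf).
- by apply: Rintegral_ge0.
- exact: measurableT_comp.
- by apply: ae_mono fg => y fgy; rewrite ger0_norm// subr_ge0.
Qed.

Lemma derive_monomial (n : nat) (x : R) :
  is_derive x 1 (fun y : R => y ^+ n.+1 / n.+1%:R) (x ^+ n).
Proof.
have H : is_derive x 1 (fun y : R => y ^+ n.+1) (n.+1%:R * x ^+ n).
  by apply: DeriveDef; [exact: exprn_derivable|rewrite exp_derive /GRing.scale /= mulr1].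
have := @is_deriveZ R R^o R^o _ (n.+1%:R^-1) x 1 _ H.
rewrite /GRing.scale /= mulrA mulVf ?mul1r//.
suff -> : (fun y : R => y ^+ n.+1 / n.+1%:R) = n.+1%:R^-1 \*: @GRing.exp R ^~ n.+1 by [].
by apply/funext => y; rewrite mulrC.
Qed.

Lemma primitive_monomial n x : 0 <= x <= l ->
  primitive (L2of (fun y => y ^+ n)) x = x ^+ n.+1 / n.+1%:R.
Proof.
move=> x0l; have dm y := derive_monomial n y.
rewrite (@primitive_C1 _ (fun y => y ^+ n.+1 / n.+1%:R))//.
- by rewrite expr0n mul0r subr0.
- by move=> y; exact: exprn_continuous.
- by move=> y; rewrite derive1E; have [_ ->] := dm y.
Qed.

(** Cauchy-Schwarz on ]0, x[ against the constant 1 gives a factor x times the integral of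
    (primitive u)^2 up to x, which is at most that of |u|^2 y, namely |u|^2 x^2 / 2. The cut-off [r]
    restricts the first factor to ]0, x[ as well. *)
Lemma primitive_J_sqr u x : 0 <= x <= l ->
  primitive (J u) x ^+ 2 <= dot u u * (x ^+ 3 / 2).
Proof.
move=> x0l; have /andP[x0 xl] := x0l.
pose A : set R := `]-oo, x[%classic.
have mA : measurable A by exact: measurable_itv.
pose r y := primitive u y * \1_A y.
have sr : sq r.
  apply: bounded_sq (_ : forall y, `|r y| <= nrm u * nrm L2one).
    apply: measurable_funM; last exact: measurable_indic.
    by apply: continuous_measurable_fun; exact: primitive_continuous.
  move=> y; rewrite /r normrM indicE; apply: le_trans (primitive_bounded u y).
  by case: (_ \in _); rewrite ?normr1 ?mulr1 ?normr0 ?mulr0.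
have sx : sq (fun y => y ^+ 1) by apply: continuous_sq; exact: exprn_continuous.
have -> : primitive (J u) x = dot (L2of r) (chi x).
  rewrite /primitive /J /chi !dotE_of//; [|exact: indic_sq|exact: primitive_sq|exact: indic_sq].
  by apply: eq_Rintegral => y _; rewrite /r indicE -/A; case: (_ \in _); rewrite ?mulr1 ?mulr0.
apply: le_trans (sqr_cauchy_schwarz dP _ _) _.
have -> : dot (chi x) (chi x) = x.
  rewrite -[RHS](primitive_one x0l) /primitive /chi /L2one -indicT !dot_indic//.
  by rewrite setTI setIid.
have -> : dot u u * (x ^+ 3 / 2) = dot u u * (x ^+ 2 / 2) * x by field.
rewrite ler_wpM2r//.
have <- := primitive_monomial 1 x0l.
have sA : sq (\1_A) by exact: indic_sq.
rewrite /primitive /chi !dotE_of// -RintegralZl//; last exact: sq_integrable.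
apply: le_ae_Rintegral.
- exact: sq_integrable.
- have /(integrableZl measurableT (dot u u)) := sq_integrable sx sA.
  by congr (mu.-integrable setT _).
apply: ae_itv => y /andP[y0 yl].
have y0l : 0 <= y <= l by rewrite !ltW.
rewrite /r mulrACA -expr2 mulrA; have := primitive_sqr_le u y0l.
by move=> H; rewrite indicE; case: (_ \in _); rewrite ?mulr1// !mulr0.
Qed.

Lemma J_sqr u : dot (J u) (J u) <= l ^+ 2 / 2 * dot u u.
Proof.
have l0l : 0 <= l <= l by rewrite lexx (ltW l_gt0).
have <- := primitive_monomial 1 l0l; have sx : sq (fun y => y ^+ 1).
  by apply: continuous_sq; exact: exprn_continuous.
rewrite primitive_l mulrC /J /L2one !dotE_of//; [|exact: one_sq|exact: primitive_sq|exact: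
  primitive_sq].
rewrite -RintegralZl//; last exact: sq_integrable one_sq.
apply: le_ae_Rintegral.
- exact: sq_integrable (primitive_sq u) (primitive_sq u).
- have /(integrableZl measurableT (dot u u)) := sq_integrable sx one_sq.
  by congr (mu.-integrable setT _).
apply: ae_itv => y /andP[y0 yl]; rewrite -expr2 mulr1.
by apply: primitive_sqr_le; rewrite !ltW.
Qed.

(** The pointwise bound |u|^2 y^3 / 2 of [primitive_J_sqr], integrated over ]0, l[. *)
Lemma JJ_sqr u : dot (J (J u)) (J (J u)) <= l ^+ 4 / 8 * dot u u.
Proof.
have l0l : 0 <= l <= l by rewrite lexx (ltW l_gt0).
have -> : l ^+ 4 / 8 * dot u u = dot u u / 2 * (l ^+ 4 / 4%:R) by field.
have <- := primitive_monomial 3 l0l; have sx : sq (fun y => y ^+ 3).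
  by apply: continuous_sq; exact: exprn_continuous.
have sp := primitive_sq (J u).
rewrite primitive_l /J /L2one -/(J u) !dotE_of//; last exact: one_sq.
rewrite -RintegralZl//; last exact: sq_integrable one_sq.
apply: le_ae_Rintegral.
- exact: sq_integrable.
- have /(integrableZl measurableT (dot u u / 2)) := sq_integrable sx one_sq.
  by congr (mu.-integrable setT _).
apply: ae_itv => y /andP[y0 yl]; rewrite -expr2 mulr1 mulrAC -mulrA.
by apply: primitive_J_sqr; rewrite !ltW.
Qed.

Lemma bounded_op_J : bounded_op dot dot J.
Proof.
split; first exact: J_linear.
exists l; first exact: ltW.
move=> u; rewrite -(@ler_pXn2r _ 2)// ?nnegrE ?mulr_ge0 ?nrm_ge0 ?(ltW l_gt0)//.
rewrite exprMn !sqr_nrm//; apply: le_trans (J_sqr u) _.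
by rewrite ler_wpM2r ?ip_ge0//; have := sqr_ge0 l; lra.
Qed.

Lemma L2fun_integrable u : lam.-integrable setT (EFin \o (L2fun u \_ `]0, l[)).
Proof.
have mi : measurable (`]0, l[%classic : set R) by [].
have : lam.-integrable `]0, l[ (EFin \o L2fun u).
  apply/integrableP; split.
    by apply: measurable_funTS; apply/measurable_EFinP; exact: L2fun_measurable.
  have mu1 : measurable_fun setT (fun y => `|(L2fun u y)%:E|%E).
    by apply: measurableT_comp => //; apply/measurable_EFinP; exact: L2fun_measurable.
  by have /integrableP[_] := L2fun_L1 u; rewrite integral_lebT.
move/(integrable_mkcond (mu := lam) _ mi).
by congr (lam.-integrable setT _); apply/funext => y /=; rewrite !patchE; case: ifP.
Qed.

Lemma primitiveE u x :
  primitive u x = \int[lam]_(y in `]-oo, x]) (L2fun u \_ `]0, l[) y.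
Proof.
have ui := L2fun_integrable u.
rewrite -Rintegral_itv_bndo_bndc; last by apply: integrableS ui.
have sx : sq (\1_(`]-oo, x[%classic)) by exact: indic_sq.
have := dot_EFin u sx; rewrite integral_lebT; last first.
  by apply/measurable_EFinP; apply: measurable_funM; [exact: L2fun_measurable|exact:
    sq_measurable sx].
move=> /(congr1 fine) /= E; rewrite /primitive /chi; apply: (etrans (esym E)).
rewrite /Rintegral; congr fine; rewrite [LHS]integral_mkcond [RHS]integral_mkcond.
apply: eq_integral => y _; rewrite !patchE indicE.
by case: (y \in `]-oo, x[%classic); case: ifP => //; rewrite ?mulr1 ?mulr0.
Qed.

(** By Lebesgue's differentiation theorem u is almost everywhere the derivative of its primitive,
    which is locally constant on ]0, l[. *)
Lemma primitive_inj u (k : R) : (forall x : R, 0 < x < l -> primitive u x = k) -> u = 0.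
Proof.
move=> uk; apply: L2_eq.
have ui := L2fun_integrable u.
suff H1 : {ae mu, forall y, L2fun u y = 0} by apply: ae_impl2 L2fun0 H1 => y -> ->.
have ui1 y : lam.-integrable `]-oo, y] (EFin \o (L2fun u \_ `]0, l[)).
  by apply: integrableS ui.
have ui2 : locally_integrable setT (L2fun u \_ `]0, l[).
  exact: (open_integrable_locally openT ui).
have := FTC1Ny ui1 ui2; rewrite /=.
have -> : (fun x => \int[lam]_(t in `]-oo, x]) (L2fun u \_ `]0, l[) t) = primitive u.
  by apply/funext => x; rewrite primitiveE.
move=> [N [mN N0 PN]]; apply: (ae_impl2 _ ae_itv_mem); last first.
  exists N; split => //.
    by apply/eqP; rewrite eq_le measure_ge0 andbT -N0; exact: leb_le.
  exact: PN.
move=> y yl /= [_]; rewrite patchE mem_setE yl => <-.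
rewrite derive1E -(derive_cst k y 1); apply: near_eq_derive => //.
have : nbhs y `]0, l[%classic by apply: open_nbhs_nbhs; split => //; exact: itv_open.
by apply: filterS => z; rewrite /= in_itv /= => zl; exact: uk.
Qed.

(** * Test functions and weak derivatives *)

Lemma test_sq phi n : test_function l phi -> sq (derive1n n phi).
Proof. by move=> tphi; apply: continuous_sq; exact: (@test_continuous _ l phi n tphi). Qed.

Lemma test_sq0 phi : test_function l phi -> sq phi.
Proof. exact: (@test_sq phi 0). Qed.

Lemma weak_deriv_dot m u v : weak_deriv m u v <-> forall phi, test_function l phi ->
  dot u (L2of (derive1n m phi)) = (-1) ^+ m * dot v (L2of phi).
Proof.
by split=> H phi tphi; have := H phi tphi; rewrite (integral_dot _ (test_sq m tphi))
  (integral_dot _ (test_sq0 tphi)).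
Qed.

Lemma theta_test a b n : 0 < a -> b < l -> test_function l (theta a b n).
Proof.
move=> a0 bl; split; first exact: bump_span_smooth (theta_span a b n).
exists a, b; split => // x xab; apply: theta_out; apply: contra xab.
exact: subset_itv_oo_cc.
Qed.

Lemma bump_span_sq f : bump_span f -> sq f.
Proof.
move=> sf; have df (y : R) : derivable f y 1 := @bump_span_smooth _ _ sf 0%N y.
by apply: continuous_sq => x; apply: differentiable_continuous; exact/derivable1_diffP.
Qed.

Lemma theta_sq a b n : sq (theta a b n).
Proof. exact: bump_span_sq (theta_span a b n). Qed.

Lemma L2of_itv a b : a < b -> L2of (\1_(`]a, b[%classic)) = chi b - chi a.
Proof.
move=> ab; rewrite chiB ?(ltW ab)//; apply: L2of_eq; [exact: indic_sq|exact: indic_sq|].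
apply: ae_mono (ae_neq a) => y ya; rewrite !indicE !mem_setE !in_itv /= [a <= y]le_eqVlt.
by rewrite eq_sym (negbTE ya).
Qed.

(** Dominated convergence with dominating function |u|. This is the passage from pairings with test
    functions to increments of primitives. *)
Lemma dot_theta_cvg u a b : a < b ->
  dot u (L2of (theta a b n)) @[n --> \oo] --> primitive u b - primitive u a.
Proof.
move=> ab; have -> : primitive u b - primitive u a = dot u (L2of (\1_(`]a, b[%classic))).
  by rewrite L2of_itv// /primitive !ipE.
suff : (dot u (L2of (theta a b n)))%:E @[n --> \oo] --> (dot u (L2of (\1_(`]a,
  b[%classic))))%:E.
  by move=> /fine_cvg.
have iE f : sq f -> (dot u (L2of f))%:E = (\int[mu]_y (L2fun u y * f y)%:E)%E.
  by move=> sf; rewrite dot_EFin.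
rewrite iE; last exact: indic_sq.
under eq_cvg do rewrite (iE _ (theta_sq _ _ _)).
have mth n : measurable_fun setT (theta a b n) by exact: sq_measurable (theta_sq _ _ _).
apply: (@dominated_cvg _ _ _ mu setT measurableT _ _ (fun y => `|L2fun u y|%:E)).
- move=> n; apply/measurable_EFinP.
  by apply: measurable_funM; [exact: L2fun_measurable|exact: mth].
- move=> y _; apply: cvg_EFin; first exact: nearW.
  by apply: cvgMr; exact: theta_cvg.
- by [].
- apply/Lfun1_integrable/Lfun_norm.
  by apply: (Lfun_subset12 (leb_fin l)); exact: LfunP.
- move=> n y _; rewrite lee_fin normrM -[leRHS]mulr1.
  by apply: ler_wpM2l => //; exact: theta_bounds.
Qed.

Lemma primitive_const (w : L2 l) : (forall a b : R, 0 < a -> a < b -> b < l ->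
  primitive w b = primitive w a) -> w = 0.
Proof.
move=> H; apply: (@primitive_inj _ (primitive w (l / 2))) => x /andP[x0 xl].
have [?|?|->//] := ltgtP x (l / 2); last by apply: H => //; lra.
by apply/esym; apply: H => //; lra.
Qed.

(** The bumps [theta] with a, b inside ]0, l[ are test functions; pairing with them shows that the
    primitive of u is constant there. *)
Lemma test_dense u : (forall phi, test_function l phi -> dot u (L2of phi) = 0) -> u = 0.
Proof.
move=> H; apply: primitive_const => a b a0 ab bl; apply/eqP; rewrite -subr_eq0; apply/eqP.
have C := @dot_theta_cvg u a b ab; apply: (cvg_unique _ C); first exact: Rhausdorff.
rewrite /=; by under eq_cvg do rewrite (H _ (theta_test _ a0 bl)); exact: cvg_cst.
Qed.

Lemma weak_deriv_uniq m u v v' : weak_deriv m u v -> weak_deriv m u v' -> v = v'.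
Proof.
move=> /weak_deriv_dot Hv /weak_deriv_dot Hv'; apply/eqP; rewrite -subr_eq0; apply/eqP.
apply: test_dense => phi tphi; have := Hv phi tphi; rewrite (Hv' phi tphi) !ipE.
move/(congr1 ( *%R ((-1) ^+ m))); rewrite !mulrA -exprMn mulrNN mulr1 expr1n !mul1r => ->.
by rewrite subrr.
Qed.

Lemma wderivE m u v : weak_deriv m u v -> wderiv m u = v.
Proof.
move=> uv; rewrite /wderiv; case: xgetP => [y _ /= uy|/(_ v)//].
exact: weak_deriv_uniq uy uv.
Qed.

Lemma L2ofZD a f g : sq f -> sq g ->
  L2of (fun y => a * f y + g y) = a *: L2of f + L2of g.
Proof.
move=> sf sg; have s1 : sq (fun y => a * f y + g y).
  apply: sqD sg; have sa : sq (cst a) by exact: (bounded_sq (M := `|a|)).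
  apply: sqP; first exact: measurable_funM (measurable_cst _) (sq_measurable sf).
  have := integrableZl measurableT (a ^+ 2) (Lfun2_integrable_sqr sf).
  by congr (mu.-integrable setT _); apply/funext => y /=; rewrite exprMn.
apply: L2_eq; apply: ae_impl2 (ae_mono3 (fun y => @And3 _ _ _) (L2funZD a (L2of f) (L2of
  g)) (L2ofE sf) (L2ofE sg)) (L2ofE s1).
by move=> y [-> -> ->] ->.
Qed.

Lemma test_derive phi : test_function l phi -> test_function l (phi^`()%classic).
Proof.
move=> [dphi [a [b [a0 bl phi0]]]]; split.
  by move=> n x; rewrite -derive1Sn; exact: dphi.
exists a, b; split => // x xab; rewrite derive1E -(derive_cst (0 : R) x 1).
apply: near_eq_derive => //.
have oC : open (~` [set` `[a, b]]) by apply: closed_openC; exact: itv_closed.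
have : nbhs x (~` [set` `[a, b]]) by apply: open_nbhs_nbhs; split => //; exact/negP.
by apply: filterS => y /negP; exact: phi0.
Qed.

Lemma primitive_test phi x : test_function l phi -> 0 <= x <= l ->
  primitive (L2of (phi^`()%classic)) x = phi x.
Proof.
move=> tphi x0l; have [dphi [a [b [a0 bl phi0]]]] := tphi.
rewrite (@primitive_C1 _ phi)//; last first.
- by move=> y; exact: (dphi 0%N y).
- by have := @test_continuous _ l phi 1 tphi.
by rewrite (phi0 0) ?subr0// in_itv /= negb_and -ltNge a0.
Qed.

Lemma J_test phi : test_function l phi -> J (L2of (phi^`()%classic)) = L2of phi.
Proof.
move=> tphi; apply: L2of_eq; [exact: primitive_sq|exact: test_sq0|].
by apply: ae_itv => y /andP[y0 yl]; apply: primitive_test => //; rewrite !ltW.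
Qed.

(** The derivative of a test function phi has integral 0, which removes the constant c and reduces
    the adjoint of J on phi' to - J phi' = - phi. *)
Lemma weak_deriv_J c v : weak_deriv 1 (c *: L2one + J v) v.
Proof.
apply/weak_deriv_dot => phi tphi; rewrite !ipE.
have E : dot (L2of (phi^`()%classic)) L2one = 0.
  have l0l : 0 <= l <= l by rewrite lexx ltW.
  have [_ [a [b [a0 bl phi0]]]] := tphi.
  by rewrite -primitive_l primitive_test// phi0// in_itv /= negb_and orbC -ltNge bl.
rewrite (ipC dP L2one) J_adjoint E scale0r sub0r J_test// ipNr// expr1 mulN1r.
by rewrite mulr0 add0r.
Qed.

Lemma test_restrict psi y : test_function l psi -> (psi \_ `]0, l[%classic) y = psi y.
Proof.
move=> [_ [a [b [a0 bl psi0]]]].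
rewrite patchE mem_setE; case: ifPn => // yl; rewrite psi0//.
apply: contra yl; rewrite !in_itv /= => /andP[ay yb].
by rewrite (lt_le_trans a0 ay) (le_lt_trans yb bl).
Qed.

Lemma primitiveE_of psi (x : R) : test_function l psi ->
  primitive (L2of psi) x = \int[lam]_(y in `]-oo, x]) psi y.
Proof.
move=> tpsi; have spsi := test_sq0 tpsi.
have psiE y := test_restrict y tpsi.
have mpsi : measurable_fun setT psi by exact: sq_measurable.
rewrite primitiveE; congr fine; apply: ae_eq_integral => //.
- apply/measurable_EFinP; apply: measurable_funTS.
  apply/(measurable_restrictT _ _).1 => //.
  by apply: measurable_funTS; exact: L2fun_measurable.
- by apply/measurable_EFinP; exact: measurable_funTS.
have [N [mN N0 PN]] := L2ofE spsi.
exists (N `&` `]0, l[%classic); split; [exact: measurableI|exact: N0|].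
move=> y /= nP; have yl : y \in `]0, l[.
  apply: contrapT => /negP nyl; apply: nP => _; congr EFin.
  by rewrite -psiE !patchE mem_setE (negbTE nyl).
split => //; apply: PN => /= E; apply: nP => _.
by rewrite patchE mem_setE yl E.
Qed.

(** The primitive vanishes to the left of the support of psi by construction, and to its right
    because the total integral is 0. *)
Lemma test_primitive psi : test_function l psi -> dot (L2of psi) L2one = 0 ->
  test_function l (primitive (L2of psi)) /\ (primitive (L2of psi))^`()%classic = psi.
Proof.
move=> tpsi psi1; have [dpsi [a [b [a0 bl psi0]]]] := tpsi.
have spsi := test_sq0 tpsi.
have psiE y := test_restrict y tpsi.
have psii : lam.-integrable setT (EFin \o psi).
  have mi : measurable (`]0, l[%classic : set R) by [].
  have : lam.-integrable `]0, l[ (EFin \o psi).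
    have cpsi : continuous psi by exact: (@test_continuous _ l psi 0 tpsi).
    have : lam.-integrable `[0, l] (EFin \o psi).
      apply: continuous_compact_integrable; first exact: segment_compact.
      exact: continuous_subspaceT.
    by move=> H; apply: integrableS H => //; exact: subset_itv_oo_cc.
  move/(integrable_mkcond (mu := lam) _ mi).
  congr (lam.-integrable setT _); apply/funext => y /=; rewrite -[in RHS]psiE !patchE.
  by case: ifP.
have D x : derivable (primitive (L2of psi)) x 1 /\ (primitive (L2of psi))^`()%classic x = psi x.
  have xx : x < x + 1 by rewrite ltrDl.
  have psix : lam.-integrable [set` Interval -oo%O (BRight (x + 1))] (EFin \o psi).
    by apply: integrableS psii.
  have := continuous_FTC1 xx psix.
  have -> : (fun x => \int[lam]_(t in [set` Interval -oo%O (BRight x)]) psi t) = primitive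
    (L2of psi).
    by apply/funext => y; rewrite primitiveE_of.
  by apply; [rewrite ltNyr|exact: (@test_continuous _ l psi 0 tpsi)].
have dE : (primitive (L2of psi))^`()%classic = psi by apply/funext => x; have [] := D x.
split; last exact: dE.
split.
  by case=> [|n] x; [have [] := D x|rewrite derive1Sn dE; exact: dpsi].
exists a, b; split => // x.
have sone := one_sq; have sx := indic_sq (measurable_itv `]-oo, x[).
rewrite in_itv /= negb_and -!ltNge => /orP[xa|bx].
  rewrite /primitive /chi dotE_of//; under eq_Rintegral => y _.
    rewrite (_ : _ * _ = 0); last first.
      rewrite indicE mem_setE in_itv /=; case: ltP => [yx|]; last by rewrite mulr0.
      by rewrite psi0 ?mul0r// in_itv /= negb_and -ltNge (lt_trans yx xa).
    over.
  by rewrite Rintegral_cst// mul0r.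
rewrite -psi1 /primitive /chi /L2one !dotE_of//; apply: eq_Rintegral => y _.
rewrite indicE mem_setE in_itv /=; case: ltP => // xy.
by rewrite psi0 ?mul0r// in_itv /= negb_and orbC -ltNge (lt_le_trans bx xy).
Qed.

(* If [t1], [t2] are bumps and [m1], [m2] their integrals, then [m2 t1 - m1 t2] is the
   derivative of a test function. *)
Lemma weak_deriv1_theta w a1 b1 a2 b2 m n : weak_deriv 1 w 0 ->
  0 < a1 -> b1 < l -> 0 < a2 -> b2 < l ->
  dot L2one (L2of (theta a2 b2 n)) * dot w (L2of (theta a1 b1 m)) =
  dot L2one (L2of (theta a1 b1 m)) * dot w (L2of (theta a2 b2 n)).
Proof.
move=> /weak_deriv_dot w0 a10 b1l a20 b2l.
set t1 := theta a1 b1 m; set t2 := theta a2 b2 n.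
set m1 := dot L2one (L2of t1); set m2 := dot L2one (L2of t2).
have s1 : sq t1 by exact: theta_sq.
have s2 : sq t2 by exact: theta_sq.
pose t3 y := - m1 * (bump 1 (n.+1%:R * (y - a2)) * bump 1 (n.+1%:R * (b2 - y))).
have s3 : sq t3 by apply: bump_span_sq; exact: bump_prod.
pose psi y := m2 * t1 y + t3 y.
have psiE : L2of psi = m2 *: L2of t1 - m1 *: L2of t2.
  rewrite /psi L2ofZD//; congr (_ + _).
  have := @L2ofZD (- m1 - 1) t2 t2 s2 s2.
  rewrite -[in X in _ = X -> _](scale1r (L2of t2)) scalerA -scalerDl mulr1 subrK scaleNr => <-.
  congr L2of; apply/funext => y; rewrite /t3 /t2 /theta; ring.
have tpsi : test_function l psi.
  split.
    have := bump_add (bump_prod m.+1%:R a1 b1 m2 1 1) (bump_prod n.+1%:R a2 b2 (- m1) 1 1).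
    by move=> sp k y; exact: (@bump_span_smooth _ _ sp k y).
  exists (Num.min a1 a2), (Num.max b1 b2); split; [by rewrite lt_min a10|by rewrite gt_max
    b1l|].
  move=> y; rewrite in_itv /= negb_and -!ltNge lt_min gt_max => H.
  rewrite /psi /t1 /t3 -/(theta a2 b2 n y) !theta_out ?mulr0 ?addr0// in_itv /= negb_and
    -!leNgt.
    by case/orP: H => /andP[_ H]; rewrite (ltW H) ?orbT.
  by case/orP: H => /andP[H _]; rewrite (ltW H) ?orbT.
have [|tphi phiE] := test_primitive tpsi.
  rewrite psiE !ipE ![dot (L2of _) L2one](ipC dP) -/m1 -/m2; ring.
have := w0 _ tphi; rewrite derive1n1 phiE psiE !ipE mulr0 => /eqP.
by rewrite subr_eq0 => /eqP.
Qed.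

(** The du Bois-Reymond lemma. In the limit of the bumps, [weak_deriv1_theta] says that the
    increments of the primitive of w are proportional to the lengths of the intervals; subtracting
    the resulting constant from w leaves an element whose primitive is constant. *)
Lemma weak_deriv1_const w : weak_deriv 1 w 0 -> exists c, w = c *: L2one.
Proof.
move=> w0.
have H (a1 b1 a2 b2 : R) : 0 < a1 -> a1 < b1 -> b1 < l -> 0 < a2 -> a2 < b2 -> b2 < l ->
    (b2 - a2) * (primitive w b1 - primitive w a1) =
    (b1 - a1) * (primitive w b2 - primitive w a2).
  move=> a10 ab1 b1l a20 ab2 b2l.
  have one a b : 0 < a -> a < b -> b < l -> b - a = primitive L2one b - primitive L2one a.
    move=> a0 ab bl; rewrite !primitive_one//.
      by rewrite (ltW a0) (ltW (lt_trans ab bl)).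
    by rewrite (ltW bl) (ltW (lt_trans a0 ab)).
  rewrite (one _ _ a20 ab2 b2l) (one _ _ a10 ab1 b1l).
  have C1 := cvgM (@dot_theta_cvg L2one _ _ ab2) (@dot_theta_cvg w _ _ ab1).
  have C2 := cvgM (@dot_theta_cvg L2one _ _ ab1) (@dot_theta_cvg w _ _ ab2).
  apply: (cvg_unique _ (C1 _)); first exact: Rhausdorff.
  rewrite /=; suff -> : ((fun n => dot L2one (L2of (theta a2 b2 n))) \* (fun n =>
    dot w (L2of (theta a1 b1 n))))
    = ((fun n => dot L2one (L2of (theta a1 b1 n))) \* (fun n => dot w (L2of (theta a2 b2 n)))).
    exact: C2.
  by apply/funext => n /=; exact: weak_deriv1_theta.
(* The slope on one reference interval inside ]0, l[. *)
pose c := (primitive w (l / 2) - primitive w (l / 3)) / (l / 2 - l / 3).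
exists c; apply/eqP; rewrite -subr_eq0; apply/eqP; apply: primitive_const => a b a0 ab bl.
rewrite addrC -scaleNr !primitive_lin !primitive_one; last 2 first.
- by rewrite (ltW a0) (ltW (lt_trans ab bl)).
- by rewrite (ltW bl) (ltW (lt_trans a0 ab)).
have := H a b (l / 3) (l / 2) a0 ab bl ltac:(lra) ltac:(lra) ltac:(lra).
have l23 : l / 2 - l / 3 != 0 by rewrite gt_eqF//; lra.
move=> E; have : primitive w b - primitive w a = c * (b - a).
  by rewrite /c mulrAC [_ * (b - a)]mulrC -E mulrC mulKf.
move=> E2; apply/eqP; rewrite -subr_eq0; apply/eqP.
by rewrite opprD addrACA E2 -mulrBr mulNr addNr.
Qed.

Lemma weak_deriv1P u v : weak_deriv 1 u v <-> exists c, u = c *: L2one + J v.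
Proof.
split=> [uv|[c ->]]; last exact: weak_deriv_J.
have := weak_derivZD (-1) (weak_deriv_J 0 v) uv.
rewrite scale0r add0r !scaleN1r addNr => /weak_deriv1_const[c cE]; exists c.
by rewrite -cE addrAC addNr add0r.
Qed.

Lemma weak_deriv0P u v : weak_deriv 0 u v <-> v = u.
Proof.
have wu : weak_deriv 0 u u by apply/weak_deriv_dot => phi tphi; rewrite mul1r.
by split=> [uv|->//]; exact: weak_deriv_uniq uv wu.
Qed.

Lemma weak_deriv2 u v w : weak_deriv 1 u v -> weak_deriv 2 u w <-> weak_deriv 1 v w.
Proof.
move=> /weak_deriv_dot uv; split=> /weak_deriv_dot H; apply/weak_deriv_dot => phi tphi.
  have := uv _ (test_derive tphi); rewrite -derive1Sn H// expr2 mulrNN mulr1 mul1r.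
  by rewrite expr1 mulN1r => ->; rewrite mulN1r opprK.
rewrite derive1Sn uv ?expr1; last exact: test_derive.
by have := H _ tphi; rewrite expr1 derive1n1 => ->; rewrite mulrA expr2.
Qed.

(** * Sobolev spaces as ranges of iterated primitives *)

Lemma wderiv_J c v : wderiv 1 (c *: L2one + J v) = v.
Proof. by apply: wderivE; exact: weak_deriv_J. Qed.

Lemma weak_deriv_JJ c d v : weak_deriv 2 (c *: L2one + J (d *: L2one + J v)) v.
Proof. by apply/(weak_deriv2 _ (weak_deriv_J _ _)); exact: weak_deriv_J. Qed.

Lemma wderiv_JJ c d v : wderiv 2 (c *: L2one + J (d *: L2one + J v)) = v.
Proof. by apply: wderivE; exact: weak_deriv_JJ. Qed.

Lemma sobolev1P u : sobolev 1 u <-> exists c v, u = c *: L2one + J v.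
Proof.
split=> [H|[c [v ->]]]; first by have [v /weak_deriv1P[c ->]] := H 1%N (leqnn 1); exists c, v.
by case=> [|[|//]] _; [exists (c *: L2one + J v); exact/weak_deriv0P|exists v;
  exact: weak_deriv_J].
Qed.

Lemma sobolev2P u : sobolev 2 u <-> exists c d v, u = c *: L2one + J (d *: L2one + J v).
Proof.
split=> [H|[c [d [v ->]]]].
  have [v uv] := H 1%N (leqnSn 1); have [w uw] := H 2%N (leqnn 2).
  have /weak_deriv1P[d vE] := (weak_deriv2 w uv).1 uw.
  have /weak_deriv1P[c uE] := uv.
  by exists c, d, w; rewrite uE vE.
case=> [|[|[|//]]] _.
- by exists (c *: L2one + J (d *: L2one + J v)); exact/weak_deriv0P.
- by exists (d *: L2one + J v); exact: weak_deriv_J.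
- by exists v; exact: weak_deriv_JJ.
Qed.

Lemma has_value_affine0 c v : has_value (c *: L2one + J v) 0 0 -> c = 0.
Proof.
have l0 : 0 <= (0 : R) <= l by rewrite lexx ltW.
by move=> /(valueE l0); rewrite affine_value// primitive0 addr0.
Qed.

Lemma has_value_J0 v : has_value (J v) 0 0.
Proof.
exists (fun x => 0 + primitive v x); last by rewrite primitive0 addr0.
by have := affine_ac_rep 0 v; rewrite scale0r add0r.
Qed.

Lemma J0E v : J v = 0 *: L2one + J v. Proof. by rewrite scale0r add0r. Qed.

(** Vanishing traces at 0 remove the integration constants, so H^1_L is the range of J and, below,
    H^2_L that of J o J. The highest derivative is then a coordinate ranging over all of L^2. *)
Lemma sobolevL1P u : (u \in @sobolevL R 1 l) = `[< u = J (wderiv 1 u) >].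
Proof.
apply/asboolP/asboolP => [[/sobolev1P[c [v ->]] H]|->].
  rewrite wderiv_J; have [w /weak_deriv0P -> /has_value_affine0 ->] := H 0%N isT.
  by rewrite -J0E.
split; first by apply/sobolev1P; exists 0, (wderiv 1 u); exact: J0E.
case=> // _; exists (J (wderiv 1 u)); last exact: has_value_J0.
exact/weak_deriv0P.
Qed.

Lemma sobolevL2P u : (u \in @sobolevL R 2 l) = `[< u = J (J (wderiv 2 u)) >].
Proof.
apply/asboolP/asboolP => [[/sobolev2P[c [d [v ->]]] H]|->].
  rewrite wderiv_JJ; have [w /weak_deriv0P -> /has_value_affine0 ->] := H 0%N isT.
  have [w' wd] := H 1%N isT.
  rewrite (weak_deriv_uniq wd (weak_deriv_J _ _)) => /has_value_affine0 ->.
  by rewrite -!J0E.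
split; first by apply/sobolev2P; exists 0, 0, (wderiv 2 u); rewrite -!J0E.
case=> [|[|//]] _.
  by exists (J (J (wderiv 2 u))); [exact/weak_deriv0P|exact: has_value_J0].
by exists (J (wderiv 2 u)); [rewrite J0E; exact: weak_deriv_J|exact: has_value_J0].
Qed.

Lemma wderiv1_J v : wderiv 1 (J v) = v.
Proof. by rewrite J0E wderiv_J. Qed.

Lemma wderiv2_JJ v : wderiv 2 (J (J v)) = v.
Proof. by rewrite (J0E (J v)) (J0E v) wderiv_JJ. Qed.

Lemma J_sobolevL1 v : J v \in @sobolevL R 1 l.
Proof. by rewrite sobolevL1P; apply/asboolP; rewrite wderiv1_J. Qed.

Lemma JJ_sobolevL2 v : J (J v) \in @sobolevL R 2 l.
Proof.
by rewrite sobolevL2P; apply/asboolP; rewrite wderiv2_JJ.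
Qed.

Lemma wderiv_linear m a u v u' v' : weak_deriv m u u' -> weak_deriv m v v' ->
  wderiv m (a *: u + v) = a *: u' + v'.
Proof. by move=> uu' vv'; apply: wderivE; exact: weak_derivZD. Qed.

Lemma affine_has_ac c v : exists f, ac_rep (c *: L2one + J v) f.
Proof. by eexists; exact: affine_ac_rep. Qed.

Lemma affine_eq0 c v : c *: L2one + J v = 0 -> c = 0 /\ v = 0.
Proof.
move=> E; have v0 : v = 0.
  by rewrite -(wderiv_J c v) E; apply: wderivE; exact: weak_deriv0.
split=> //; have l0 : 0 <= (0 : R) <= l by rewrite lexx ltW.
have := affine_value c v l0; rewrite primitive0 addr0 E => <-.
by apply: valueE => //; exact: has_value0.
Qed.

End L2_space.

(** * The real line as an inner product space *)

Definition real_ip (R : realType) (x y : R^o) : R := x * y.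

Section real_ip.
Context {R : realType}.

Lemma real_ip_inner_product : inner_product (@real_ip R).
Proof.
split=> [x y|a x y z|x x0]; rewrite /real_ip.
- exact: mulrC.
- by rewrite mulrDl -mulrA.
- by rewrite -expr2 exprn_even_gt0.
Qed.

Lemma real_ip_norm (x : R^o) : ip_norm (@real_ip R) x = `|x|.
Proof. by rewrite /ip_norm /real_ip -expr2 sqrtr_sqr. Qed.

Lemma real_ip_complete : complete_ip (@real_ip R).
Proof.
move=> u uc; have : cvg ((u : nat -> R) @ \oo).
  apply/cauchy_cvgP/cauchy_exP => e e0; have [N H] := uc e e0; exists (u N : R).
  exists N => // n /= Nn; have := H N n (leqnn N) Nn; rewrite real_ip_norm.
  by rewrite /ball /=.
move=> /cvg_ex[x ux]; exists (x : R^o); apply/tendsP => e e0.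
have /cvgrPdist_lt/(_ e e0)[N _ H] := ux; exists N => n Nn.
by rewrite real_ip_norm distrC; exact: H.
Qed.

Lemma bounded_functional {V : lmodType R} (ip : V -> V -> R) w : inner_product ip ->
  bounded_op ip (@real_ip R) (fun v => ip v w : R^o).
Proof.
move=> ipP; split; first by move=> a x y; rewrite (ipDl ipP) (ipZl ipP).
exists (ip_norm ip w); first exact: nrm_ge0.
by move=> x; rewrite real_ip_norm mulrC abs_cauchy_schwarz.
Qed.

End real_ip.

Lemma mat2_inj (R : realType) (V : lmodType R) (a b c : R) (x y : V) :
  b ^+ 2 < a * c -> a *: x + b *: y = 0 -> b *: x + c *: y = 0 -> x = 0 /\ y = 0.
Proof.
move=> bac E1 E2; have d0 : a * c - b ^+ 2 != 0 by rewrite gt_eqF// subr_gt0.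
have H1 : (a * c - b ^+ 2) *: x = 0.
  have -> : (a * c - b ^+ 2) *: x = c *: (a *: x + b *: y) - b *: (b *: x + c *: y).
    rewrite !scalerDr !scalerA (mulrC b c) opprD addrACA subrr addr0 -scalerBl.
    by rewrite (mulrC a).
  by rewrite E1 E2 !scaler0 subrr.
have H2 : (a * c - b ^+ 2) *: y = 0.
  have -> : (a * c - b ^+ 2) *: y = a *: (b *: x + c *: y) - b *: (a *: x + b *: y).
    rewrite !scalerDr !scalerA (mulrC b a) opprD addrACA subrr add0r -scalerBl.
    by [].
  by rewrite E1 E2 !scaler0 subrr.
move/eqP: H1; move/eqP: H2; rewrite !scaler_eq0 (negbTE d0) /= => /eqP -> /eqP ->.
by [].
Qed.

(** * The beam *)

(** L^2(0, l) enters only through a complete inner product, a bounded J with adjoint v |-> <v, one>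
    one - J v, and the uniqueness of c and v in c one + J v. The weights p, q stand for rho
    c_omega^2 and I_w c_phi^2, and a, b, c and a', b', c' for the entries of M and M_s. *)
Section abstract_beam.
Context {R : realType} {V : lmodType R} (ip : V -> V -> R) (one : V) (J : V -> V).
Hypothesis ipP : inner_product ip.
Hypothesis ip_complete : complete_ip ip.
Hypothesis J_bounded : bounded_op ip ip J.
Hypothesis J_adj : forall u v, ip (J u) v = ip u (ip v one *: one - J v).
Hypothesis affine_eq0 : forall c v, c *: one + J v = 0 -> c = 0 /\ v = 0.
Local Notation rip := (@real_ip R).
Local Notation ipE := (ipE ipP).
Let ripP : inner_product rip := real_ip_inner_product.
Let Jlin : linear J := J_bounded.1.

(** In L^2(0, l) this is the adjoint of J, integration from x to l. *)
Definition Jadj v := ip v one *: one - J v.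

Lemma J0 : J 0 = 0.
Proof. by have := Jlin (-1) 0 0; rewrite scaler0 addr0 scaleN1r addNr. Qed.

Lemma JZ a v : J (a *: v) = a *: J v.
Proof. by have := Jlin a v 0; rewrite J0 !addr0. Qed.

Lemma JN v : J (- v) = - J v.
Proof. by rewrite -scaleN1r JZ scaleN1r. Qed.

Lemma ip_Jadj u v : ip u (Jadj v) = ip (J u) v.
Proof. by rewrite J_adj. Qed.

Lemma affine_inj c v : c *: one - J v = 0 -> c = 0 /\ v = 0.
Proof.
by rewrite -JN => /affine_eq0[-> /eqP]; rewrite oppr_eq0 => /eqP.
Qed.

Lemma Jadj_eq0 v : Jadj v = 0 -> v = 0.
Proof. by move=> /affine_inj[]. Qed.

Lemma J_eq0 v : J v = 0 -> v = 0.
Proof. by move=> Jv; have [] := @affine_eq0 0 v; rewrite ?scale0r ?add0r. Qed.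

Lemma bounded_Jadj : bounded_op ip ip Jadj.
Proof.
apply: bounded_opD => //; last exact: bounded_opN.
split; first by move=> a x y; rewrite !ipE scalerDl scalerA.
exists (ip_norm ip one * ip_norm ip one); first by rewrite mulr_ge0 ?nrm_ge0.
move=> x; rewrite nrmZ// mulrAC ler_wpM2r ?nrm_ge0//.
by rewrite mulrC abs_cauchy_schwarz.
Qed.

Variables (p q : R).
Hypotheses (p0 : 0 < p) (q0 : 0 < q).
Variables (a b c a' b' c' : R).
Hypotheses (a0 : 0 < a) (bac : b ^+ 2 < a * c) (a'0 : 0 < a') (b'ac : b' ^+ 2 < a' * c').
Variables (eta1 eta2 : R).
Hypotheses (eta1_ge0 : 0 <= eta1) (eta2_ge0 : 0 <= eta2).

Let pq : 0 ^+ 2 < p * q. Proof. by rewrite expr0n mulr_gt0. Qed.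

Definition strain_ip := ip_mat ip p 0 q.
Definition kinetic_ip := ip_sum (ip_mat ip a b c) (ip_mat rip a' b' c').

Lemma strain_ipP : inner_product strain_ip.
Proof. exact: ip_mat_inner_product. Qed.

Lemma kinetic_ipP : inner_product kinetic_ip.
Proof. by apply: ip_sum_inner_product; exact: ip_mat_inner_product. Qed.

(** The operator K: from the strain rates (g'', z') it recovers the velocities (g, z) and, as inner
    products with [one], their values at l. *)
Definition strain_rate_map (x : V * V) : (V * V) * (R^o * R^o) :=
  ((J (J x.1), J x.2), (ip (J x.1) one, ip x.2 one)).

(** The adjoint of K for the strain and kinetic products. The momenta M (g, z) are integrated back
    from l, with the tip momenta M_s (zeta_omega, zeta_phi) as integration constants; p^-1 and q^-1
    compensate the weights of the strain product. *)
Definition momentum_map (y : (V * V) * (R^o * R^o)) : V * V :=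
  (p^-1 *: Jadj (Jadj (a *: y.1.1 + b *: y.1.2) + (a' * y.2.1 + b' * y.2.2) *: one),
   q^-1 *: (Jadj (b *: y.1.1 + c *: y.1.2) + (b' * y.2.1 + c' * y.2.2) *: one)).

Definition damping (x : V * V) : V * V := (eta1 *: x.1, eta2 *: x.2).

Lemma strain_rate_momentum x y :
  kinetic_ip (strain_rate_map x) y = strain_ip x (momentum_map y).
Proof.
rewrite /strain_ip /kinetic_ip /ip_mat /ip_sum /strain_rate_map /momentum_map /real_ip /=.
rewrite !(ipZr ipP) mul0r addr0 !mulrA !mulfV ?gt_eqF// !mul1r.
have E u w k : ip u (Jadj w + k *: one) = ip (J u) w + k * ip u one.
  by rewrite -ip_Jadj (ipDr ipP _ (k *: one)) (ipZr ipP).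
rewrite ip_Jadj !E !ipE; ring.
Qed.

Lemma bounded_strain_rate_map : bounded_op strain_ip kinetic_ip strain_rate_map.
Proof.
have b1 : bounded_op strain_ip ip fst by exact: bounded_op_mat_fst.
have b2 : bounded_op strain_ip ip snd by exact: bounded_op_mat_snd.
apply: bounded_op_pair; [exact: ip_mat_inner_product|exact: ip_mat_inner_product| |].
  apply: bounded_op_mat_pair => //; last exact: bounded_op_comp b2.
  exact: bounded_op_comp J_bounded (bounded_op_comp J_bounded b1).
have bf := bounded_functional one ipP.
apply: bounded_op_mat_pair => //; last exact: bounded_op_comp bf b2.
exact: bounded_op_comp bf (bounded_op_comp J_bounded b1).
Qed.

Lemma bounded_momentum_map : bounded_op kinetic_ip strain_ip momentum_map.
Proof.
have mP := ip_mat_inner_product ipP a0 bac; have mP' := ip_mat_inner_product ripP a'0 b'ac.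
have bb1 : bounded_op kinetic_ip _ fst := bounded_op_fst mP mP'.
have bb2 : bounded_op kinetic_ip _ snd := bounded_op_snd mP mP'.
have g1 := bounded_op_comp (bounded_op_mat_fst ipP a0 bac) bb1.
have g2 := bounded_op_comp (bounded_op_mat_snd ipP a0 bac) bb1.
have g3 := bounded_op_comp (bounded_op_mat_fst ripP a'0 b'ac) bb2.
have g4 := bounded_op_comp (bounded_op_mat_snd ripP a'0 b'ac) bb2.
have bone : bounded_op rip ip (fun r : R^o => r *: one).
  split; first by move=> k x y; rewrite scalerDl scalerA.
  exists (ip_norm ip one); first exact: nrm_ge0.
  by move=> x; rewrite nrmZ// real_ip_norm mulrC.
apply: bounded_op_mat_pair => //; apply: bounded_opZ => //.
  apply: bounded_op_comp bounded_Jadj _; apply: bounded_opD => //.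
    apply: bounded_op_comp bounded_Jadj _.
    by apply: bounded_opD => //; exact: bounded_opZ.
  by apply: bounded_op_comp bone _; apply: bounded_opD => //; exact: (bounded_opZ ripP).
apply: bounded_opD => //.
  apply: bounded_op_comp bounded_Jadj _.
  by apply: bounded_opD => //; exact: bounded_opZ.
by apply: bounded_op_comp bone _; apply: bounded_opD => //; exact: (bounded_opZ ripP).
Qed.

(** The beam with its internal viscous damping but without couplings and boundary feedback.
    Injectivity of K is that of J; injectivity of K^* follows from that of (k, w) |-> k one + Jadj w
    and from the invertibility of the two mass matrices. *)
Lemma undamped_beam : m_dissipative (ip_sum strain_ip kinetic_ip)
  (damped_graph strain_rate_map momentum_map damping).
Proof.
apply: damped_m_dissipative.
- exact: strain_ipP.
- exact: kinetic_ipP.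
- exact: ip_mat_complete.
- exact: bounded_strain_rate_map.
- exact: bounded_momentum_map.
- have b1 : bounded_op strain_ip ip fst by exact: bounded_op_mat_fst.
  have b2 : bounded_op strain_ip ip snd by exact: bounded_op_mat_snd.
  by apply: bounded_op_mat_pair => //; exact: bounded_opZ.
- exact: strain_rate_momentum.
- move=> x; rewrite /strain_ip /ip_mat /damping /= !ipE mul0r addr0.
  by rewrite addr_ge0// !mulr_ge0 ?ip_ge0 ?(ltW p0) ?(ltW q0).
- case=> x y /= /(congr1 fst) [/J_eq0/J_eq0 -> /J_eq0 ->] //.
- move=> [[g z] [s t]] E.
  have E1 := congr1 fst E; have E2 := congr1 snd E; move: E1 E2 => {E} /= /eqP E1 /eqP E2.
  move: E1 E2; rewrite !scaler_eq0 !invr_eq0 !gt_eqF//= => /eqP/Jadj_eq0 E1 /eqP E2.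
  have aff w k : Jadj w + k *: one = 0 -> w = 0 /\ k = 0.
    rewrite /Jadj addrAC -scalerDl => /affine_inj[k0 w0].
    by move: k0; rewrite w0 (ip0l ipP) add0r.
  have [G1 O1] := aff _ _ E1; have [G2 O2] := aff _ _ E2.
  have [-> ->] := mat2_inj bac G1 G2.
  by have [-> ->] := @mat2_inj _ R^o _ _ _ s t b'ac O1 O2.
Qed.

Variables (A A' : 'M[R]_2) (al1 be1 ga1 al2 be2 ga2 k1 k2 e1 e2 : R).

Definition beam_ip := ip_sum strain_ip kinetic_ip.

(** The feedback reads the tip velocities from the state variables [x.2.2] and not as traces of g
    and z; this is what makes it bounded. The displacements at l are bounded functions of the
    strains. *)
Definition feedback (x : (V * V) * ((V * V) * (R^o * R^o))) :
    (V * V) * ((V * V) * (R^o * R^o)) :=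
  (0, (act2 A (al1 *: J x.1.2 + be1 *: x.2.1.2 + ga1 *: x.2.1.1)
              (al2 *: J x.1.2 + be2 *: x.2.1.2 + ga2 *: x.2.1.1),
       act2 A' (- k1 *: (x.2.2.1 + e1 *: (ip (J x.1.1) one : R^o)))
               (- k2 *: (x.2.2.2 + e2 *: (ip x.1.2 one : R^o))))).

Lemma bounded_feedback : bounded_op beam_ip beam_ip feedback.
Proof.
have mP := ip_mat_inner_product ipP a0 bac; have mP' := ip_mat_inner_product ripP a'0 b'ac.
have sP := strain_ipP; have kP := kinetic_ipP.
have c1 : bounded_op beam_ip _ fst := bounded_op_fst sP kP.
have c2 : bounded_op beam_ip _ snd := bounded_op_snd sP kP.
have c21 := bounded_op_comp (bounded_op_fst mP mP') c2.
have c22 := bounded_op_comp (bounded_op_snd mP mP') c2.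
have f1 := bounded_op_comp (bounded_op_mat_fst ipP p0 pq) c1.
have f2 := bounded_op_comp (bounded_op_mat_snd ipP p0 pq) c1.
have g1 := bounded_op_comp (bounded_op_mat_fst ipP a0 bac) c21.
have g2 := bounded_op_comp (bounded_op_mat_snd ipP a0 bac) c21.
have g3 := bounded_op_comp (bounded_op_mat_fst ripP a'0 b'ac) c22.
have g4 := bounded_op_comp (bounded_op_mat_snd ripP a'0 b'ac) c22.
have bf := bounded_functional one ipP.
have bZ k f : bounded_op beam_ip ip f -> bounded_op beam_ip ip (fun x => k *: f x).
  exact: bounded_opZ.
have bD f g : bounded_op beam_ip ip f -> bounded_op beam_ip ip g ->
    bounded_op beam_ip ip (fun x => f x + g x).
  exact: bounded_opD.
have rZ k f : bounded_op beam_ip rip f -> bounded_op beam_ip rip (fun x => k *: f x).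
  exact: bounded_opZ.
have rD f g : bounded_op beam_ip rip f -> bounded_op beam_ip rip g ->
    bounded_op beam_ip rip (fun x => f x + g x).
  exact: bounded_opD.
have F k1' k2' k3' : bounded_op beam_ip ip
    (fun x => k1' *: J x.1.2 + k2' *: x.2.1.2 + k3' *: x.2.1.1).
  apply: (bD _ _); last exact: bZ g1.
  by apply: (bD _ _); [apply: (bZ _ _); exact: bounded_op_comp J_bounded f2|exact: bZ g2].
have T1 : bounded_op beam_ip rip
    (fun x => - k1 *: (x.2.2.1 + e1 *: (ip (J x.1.1) one : R^o))).
  apply: (rZ _ _); apply: (rD _ _); first exact: g3.
  by apply: (rZ _ _); exact: bounded_op_comp bf (bounded_op_comp J_bounded f1).
have T2 : bounded_op beam_ip rip
    (fun x => - k2 *: (x.2.2.2 + e2 *: (ip x.1.2 one : R^o))).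
  apply: (rZ _ _); apply: (rD _ _); first exact: g4.
  by apply: (rZ _ _); exact: bounded_op_comp bf f2.
apply: bounded_op_pair => //; first exact: bounded_op0.
apply: bounded_op_pair => //.
  by apply: bounded_op_mat_pair => //; apply: (bD _ _); apply: (bZ _ _).
by apply: bounded_op_mat_pair => //; apply: (rD _ _); apply: (rZ _ _).
Qed.

Lemma beam_generates : generates beam_ip (fun x y =>
  damped_graph strain_rate_map momentum_map damping x (y - feedback x)).
Proof.
apply: bounded_perturbation undamped_beam bounded_feedback.
  exact: ip_sum_inner_product strain_ipP kinetic_ipP.
apply: ip_sum_complete strain_ipP kinetic_ipP _ _; first exact: ip_mat_complete.
apply: ip_sum_complete; [exact: ip_mat_inner_product|exact: ip_mat_inner_product| |].
  exact: ip_mat_complete.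
by apply: ip_mat_complete => //; exact: real_ip_complete.
Qed.

End abstract_beam.

(** * Two by two matrices acting on pairs of vectors *)

Section matrices2.
Context {R : realType}.

Lemma det_mx22 (a b c d : R) : \det (mx22 a b c d) = a * d - b * c.
Proof.
rewrite (expand_det_row _ ord0) !big_ord_recl big_ord0 /cofactor !det_mx11 !mxE /=.
by rewrite expr0 expr1 mul1r mulN1r mulrN addr0.
Qed.

Lemma act2M (V : lmodType R) (A A' : 'M[R]_2) (x y : V) :
  act2 A (act2 A' x y).1 (act2 A' x y).2 = act2 (A *m A') x y.
Proof.
rewrite /act2 /= !mxE !big_ord_recl !big_ord0 /= !addr0.
have -> : lift ord0 ord0 = 1 :> 'I_2 by exact/val_inj.
by rewrite !scalerDr !scalerA !scalerDl; congr (_, _); rewrite addrACA.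
Qed.

Lemma act2_1 (V : lmodType R) (x y : V) : act2 (1%:M : 'M[R]_2) x y = (x, y).
Proof. by rewrite /act2 !mxE /= !scale1r !scale0r addr0 add0r. Qed.

Lemma act2_inv (V : lmodType R) (A : 'M[R]_2) (x y u v : V) : A \in unitmx ->
  act2 (invmx A) x y = (u, v) <-> act2 A u v = (x, y).
Proof.
move=> uA; split=> E.
  by have := act2M A (invmx A) x y; rewrite E /= mulmxV// act2_1.
by have := act2M (invmx A) A u v; rewrite E /= mulVmx// act2_1.
Qed.

Lemma act2_mx22 (V : lmodType R) (a b c d : R) (x y : V) :
  act2 (mx22 a b c d) x y = (a *: x + b *: y, c *: x + d *: y).
Proof. by rewrite /act2 !mxE. Qed.

Lemma bil_mx22 (a b c d x y x' y' : R) :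
  bil (mx22 a b c d) (col2 x y) (col2 x' y') = (x * a + y * c) * x' + (x * b + y * d) * y'.
Proof.
rewrite /bil !mxE !big_ord_recl !big_ord0 !mxE !big_ord_recl !big_ord0 !mxE /=.
by rewrite !addr0.
Qed.

Lemma act2D (V : lmodType R) (A : 'M[R]_2) (x y x' y' : V) :
  act2 A (x + x') (y + y') =
  ((act2 A x y).1 + (act2 A x' y').1, (act2 A x y).2 + (act2 A x' y').2).
Proof. by rewrite /act2 !scalerDr /=; congr (_, _); rewrite addrACA. Qed.

Lemma act2N (V : lmodType R) (A : 'M[R]_2) (x y : V) :
  act2 A (- x) (- y) = (- (act2 A x y).1, - (act2 A x y).2).
Proof. by rewrite /act2 !scalerN /=; congr (_, _); rewrite opprD. Qed.

(** Relates the implicit equations of motion M (w - F) = - r, in which K^* expresses them, to the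
    solved form w = - M^-1 r + F of [opA]. The next lemma does the same for the tip. *)
Lemma act2_residual (V : lmodType R) (A : 'M[R]_2) (u v r1 r2 F1 F2 : V) : A \in unitmx ->
  act2 A (u - F1) (v - F2) = (- r1, - r2) <->
  (u, v) = (- (act2 (invmx A) r1 r2).1 + F1, - (act2 (invmx A) r1 r2).2 + F2).
Proof.
move=> uA; rewrite -act2_inv// act2N; split=> [[/eqP + /eqP]|[-> ->]]; last by rewrite !addrK.
by rewrite eq_sym subr_eq => /eqP -> /eqP E; rewrite E subrK.
Qed.

Lemma act2_tip (V : lmodType R) (A : 'M[R]_2) (u v s1 s2 p1 p2 : V) : A \in unitmx ->
  act2 A (u - (act2 (invmx A) p1 p2).1) (v - (act2 (invmx A) p1 p2).2) = (s1, s2) <->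
  (u, v) = ((act2 (invmx A) (s1 + p1) (s2 + p2)).1, (act2 (invmx A) (s1 + p1) (s2 + p2)).2).
Proof.
move=> uA; rewrite -act2_inv// act2D [(_, _).1]/= [(_, _).2]/=; split=> [E|[-> ->]].
  by rewrite E !subrK.
by rewrite !addrK.
Qed.

End matrices2.

(** * Boundary values at the free end and the adjoint integration *)

Section trace_at_l.
Context {R : realType} {l : R} (l_gt0 : 0 < l).
Local Notation one := (L2one l).
Local Notation Jad := (Jadj (dot (l := l)) one (J (l := l))).
Implicit Types u v w W : L2 l.

(** Integrating from l instead of from 0 changes only the constant, and makes it the value at l. *)
Lemma affine_Jadj (a : R) v : a *: one - Jad v = (a - dot v one) *: one + J v.
Proof. by rewrite /Jadj opprB addrCA addrA [J v + _]addrC scalerBl addrAC. Qed.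

Lemma Jadj_linear : linear Jad.
Proof. exact: (bounded_Jadj one (dot_inner_product l) (bounded_op_J l_gt0)).1. Qed.

Lemma l_itv : 0 <= l <= l. Proof. by rewrite lexx ltW. Qed.

Lemma value_affine_l (c : R) v : value (c *: one + J v) l = c + dot v one.
Proof. by rewrite affine_value ?l_itv// primitive_l. Qed.

Lemma value_Jadj (a : R) v : value (a *: one - Jad v) l = a.
Proof. by rewrite affine_Jadj value_affine_l subrK. Qed.

Lemma wderiv_Jadj (a : R) v : wderiv 1 (a *: one - Jad v) = v.
Proof. by rewrite affine_Jadj wderiv_J. Qed.

Lemma sobolev1_Jadj u : sobolev 1 u <-> u = value u l *: one - Jad (wderiv 1 u).
Proof.
split=> [/(sobolev1P l_gt0)[c [v ->]]|->].
  by rewrite wderiv_J// value_affine_l affine_Jadj addrK.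
by rewrite affine_Jadj; apply/(sobolev1P l_gt0); eexists; eexists.
Qed.

Lemma sobolev2_Jadj u : sobolev 2 u <->
  [/\ u = value u l *: one - Jad (wderiv 1 u), sobolev 1 (wderiv 1 u) &
      wderiv 2 u = wderiv 1 (wderiv 1 u)].
Proof.
split=> [/(sobolev2P l_gt0)[c [d [v ->]]]|].
  rewrite wderiv_JJ// wderiv_J// wderiv_J// value_affine_l affine_Jadj addrK; split => //.
  by apply/(sobolev1P l_gt0); exists d, v.
case=> uE /(sobolev1P l_gt0)[d [v E]] _; rewrite uE affine_Jadj E.
by apply/(sobolev2P l_gt0); exists (value u l - dot (d *: one + J v) one), d, v.
Qed.

Lemma sobolev2_wderiv1 u : sobolev 2 u ->
  wderiv 1 u = value (wderiv 1 u) l *: one - Jad (wderiv 2 u).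
Proof. by move=> /sobolev2_Jadj[_ /sobolev1_Jadj + ->]. Qed.

Lemma JadjZ (a : R) v : Jad (a *: v) = a *: Jad v.
Proof.
have J0 : Jad 0 = 0.
  by have := Jadj_linear (-1) 0 0; rewrite scaler0 addr0 scaleN1r addNr.
by have := Jadj_linear a v 0; rewrite J0 !addr0.
Qed.

Lemma JadjN v : Jad (- v) = - Jad v.
Proof. by rewrite -(scaleN1r v) JadjZ scaleN1r. Qed.

(** An element of H^1 is u(l) one minus the integral of u' from x to l. One equation therefore
    carries the regularity of u, the differential equation and the boundary value. *)
Lemma twistP (k s : R) W u : 0 < k -> k^-1 *: (Jad W + s *: one) = - u <->
  [/\ sobolev 1 u, k *: wderiv 1 u = W & - (k * value u l) = s].
Proof.
move=> k0; have kn0 : k != 0 by rewrite gt_eqF.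
split=> [/(congr1 -%R)|[su <- <-]].
  have -> : - (k^-1 *: (Jad W + s *: one)) = (- (k^-1 * s)) *: one - Jad (k^-1 *: W).
    by rewrite JadjZ scaleNr -scalerA scalerDr opprD addrC.
  rewrite opprK => <-; split.
  - by apply/sobolev1_Jadj; rewrite value_Jadj wderiv_Jadj.
  - by rewrite wderiv_Jadj scalerA mulfV// scale1r.
  - by rewrite value_Jadj mulrN opprK mulVKf.
rewrite JadjZ scaleNr -scalerA -scalerBr scalerA mulVf// scale1r.
by rewrite {3}(sobolev1_Jadj u).1// opprB.
Qed.

(** The second-order analogue of [twistP]: the inner integration constant is the value of k u' at l,
    and the absence of an outer one means u(l) = 0. *)
Lemma bendP (k s : R) W u : 0 < k -> k^-1 *: Jad (Jad W + s *: one) = - u <->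
  [/\ sobolev 2 u, value u l = 0, k *: wderiv 2 u = - W & k * value (wderiv 1 u) l = s].
Proof.
move=> k0; have kn0 : k != 0 by rewrite gt_eqF.
split=> [/(congr1 -%R)|[su u0 /(congr1 -%R) + <-]].
  have -> : - (k^-1 *: Jad (Jad W + s *: one)) =
      0 *: one - Jad ((k^-1 * s) *: one - Jad (- (k^-1 *: W))).
    by rewrite scale0r add0r -JadjZ scalerDr JadjN opprK JadjZ scalerA addrC.
  rewrite opprK => <-.
  have s1 : sobolev 1 ((k^-1 * s) *: one - Jad (- (k^-1 *: W))).
    by apply/sobolev1_Jadj; rewrite value_Jadj wderiv_Jadj.
  have s2 : sobolev 2 (0 *: one - Jad ((k^-1 * s) *: one - Jad (- (k^-1 *: W)))).
    move/(sobolev1P l_gt0): s1 => [c [v E]]; rewrite affine_Jadj.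
    apply/(sobolev2P l_gt0); exists (0 - dot ((k^-1 * s) *: one - Jad (- (k^-1 *: W)))
      one), c, v.
    by rewrite -E.
  split=> //.
  - by rewrite value_Jadj.
  - have [_ _ ->] := (sobolev2_Jadj _).1 s2.
    by rewrite !wderiv_Jadj scalerN scalerA mulfV// scale1r.
  - by rewrite wderiv_Jadj value_Jadj mulrA mulfV// mul1r.
rewrite opprK => <-.
have -> : Jad (- (k *: wderiv 2 u)) + (k * value (wderiv 1 u) l) *: one = k *: wderiv 1 u.
  by rewrite [in RHS](sobolev2_wderiv1 su) scalerBr scalerA JadjN JadjZ addrC.
rewrite JadjZ scalerA mulVf// scale1r.
have [uE _ _] := (sobolev2_Jadj u).1 su.
by rewrite [in RHS]uE u0 scale0r add0r opprK.
Qed.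

End trace_at_l.

Lemma ip_cross_le (R : realType) (V : lmodType R) (ip : V -> V -> R) (k : R) x y :
  inner_product ip -> k * (ip x y + ip y x) <= `|k| * (ip x x + ip y y).
Proof.
move=> ipP; apply: le_trans (ler_norm _) _; rewrite normrM ler_wpM2l// ler_norml.
have := ip_ge0 ipP (x + y); have := ip_ge0 ipP (x - y).
rewrite !(ipDl ipP) !(ipDr ipP) !(ipNl ipP) !(ipNr ipP) => H1 H2.
by apply/andP; split; lra.
Qed.

(** The off-diagonal entry is absorbed by |2 <x, y>| <= |x|^2 + |y|^2. With k = x_c, this produces
    factors such as 1 + |x_c| of the thresholds. *)
Lemma ip_mat_diag_le (R : realType) (V : lmodType R) (ip : V -> V -> R) (a k c : R) x y :
  inner_product ip -> 0 <= a ->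
  ip_mat ip a (a * k) c (x, y) (x, y) <=
  a * (1 + `|k|) * ip x x + (c + a * `|k|) * ip y y.
Proof.
move=> ipP a0; rewrite /ip_mat /=; have := ler_wpM2l a0 (ip_cross_le k x y ipP).
rewrite !mulrA; lra.
Qed.

Lemma ip_norm_equiv (R : realType) (V : lmodType R) (ip ip' : V -> V -> R) (C : R) :
  0 <= C -> (forall x, ip x x <= C ^+ 2 * ip' x x) ->
  forall x, ip_norm ip x <= C * ip_norm ip' x.
Proof.
move=> C0 H x; rewrite /ip_norm -{1}(ger0_norm C0) -sqrtr_sqr -sqrtrM ?sqr_ge0//.
by rewrite ler_wsqrtr.
Qed.

Lemma stateZD (R : realType) (U V W : lmodType R) (a : R)
    (x y : (U * U) * ((V * V) * (W * W))) :
  a *: x + y = ((a *: x.1.1 + y.1.1, a *: x.1.2 + y.1.2),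
    ((a *: x.2.1.1 + y.2.1.1, a *: x.2.1.2 + y.2.1.2),
     (a *: x.2.2.1 + y.2.2.1, a *: x.2.2.2 + y.2.2.2))).
Proof. by []. Qed.

(** * The thresholds K_{m,1} and K_{m,2} *)

Section thresholds.
Context {R : realType}.

Lemma eigenvalue_mx22 (a b c k : R) :
  eigenvalue (mx22 a b b c) k = ((a - k) * (c - k) == b ^+ 2).
Proof.
rewrite /eigenvalue /eigenspace kermx_eq0 row_free_unit unitmxE unitfE negbK.
have -> : mx22 a b b c - k%:M = mx22 (a - k) b b (c - k).
  apply/matrixP => i j; rewrite !mxE.
  case: i j => [[|[|//]] ?] [[|[|//]] ?]; rewrite /= ?subr0//.
by rewrite det_mx22 -expr2 subr_eq0.
Qed.

(** The smaller root k of the characteristic polynomial is an eigenvalue and bounds the others from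
    below, so the infimum is at most k. Moreover k is below both diagonal entries because the root
    of the discriminant is at least |a - c|. *)
Lemma min_eigenvalue_mx22 (a b c : R) :
  min_eigenvalue (mx22 a b b c) <= a /\ min_eigenvalue (mx22 a b b c) <= c.
Proof.
pose s : R := Num.sqrt ((a - c) ^+ 2 + 4 * b ^+ 2).
have s2 : s ^+ 2 = (a - c) ^+ 2 + 4 * b ^+ 2.
  by rewrite sqr_sqrtr//; have := sqr_ge0 (a - c); have := sqr_ge0 b; lra.
have s0 : 0 <= s by exact: sqrtr_ge0.
have sac : `|a - c| <= s.
  by rewrite -(@ler_pXn2r _ 2)// ?nnegrE// s2 real_normK ?num_real// lerDl mulr_ge0 ?sqr_ge0//.
pose k := (a + c - s) / 2.
have [ka kc] : k <= a /\ k <= c by move: sac; rewrite ler_norml /k => /andP[]; split; lra.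
have kE : (a - k) * (c - k) = b ^+ 2.
  have -> : b ^+ 2 = (s ^+ 2 - (a - c) ^+ 2) / 4 by rewrite s2; field.
  by rewrite /k; field.
suff H : min_eigenvalue (mx22 a b b c) <= k by split; exact: le_trans H _.
apply: ge_inf; last by rewrite /= eigenvalue_mx22 kE.
exists k => m /=; rewrite eigenvalue_mx22 -kE => /eqP mk; rewrite leNgt; apply/negP => mk'.
have := mk; nra.
Qed.

Lemma lt_quo (e a b : R) : 0 < b -> (e%:E < quo a b)%E -> e * b < a.
Proof. by move=> b0; rewrite /quo gt_eqF// lte_fin ltr_pdivlMr. Qed.

Lemma pi2_le16 : (pi : R) ^+ 2 <= 16.
Proof.
have := pi_ge0 R; have := pihalf_lt2 R; nra.
Qed.

Lemma powR32 (x : R) : 0 < x -> x `^ (3 / 2) = Num.sqrt x ^+ 3.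
Proof.
move=> x0; have -> : 3 / 2 = 1 + 2^-1 :> R by field.
rewrite powRD ?gt_eqF ?implybT// powRr1 ?(ltW x0)// powR12_sqrt ?(ltW x0)//.
by rewrite [RHS]exprSr sqr_sqrtr ?(ltW x0).
Qed.

(** P is pi, s the square root of rho and X = |x_c|. Of the two factors e on the left, one is
    bounded through the eigenvalue conditions, which give 2 e < c s and 2 e < 1; the other is left
    to the first entry of K_{m,1}. The polynomial constants l^4 / 8 and l^3 / 2 fit under those with
    powers of pi because P^2 <= 16. *)
Lemma om_threshold (l rho ms c X s P e lM lMs : R) :
  0 < l -> rho = s ^+ 2 -> 0 < s -> 0 < ms -> 0 < c -> 0 <= X -> 0 < P -> P ^+ 2 <= 16 ->
  0 < e -> lM <= rho -> lMs <= ms ->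
  e * (4 * l ^+ 3 * (1 + X) * (4 * l * s ^+ 3 * c + P ^+ 2 * ms)) < P ^+ 4 * rho * c ^+ 2 ->
  e * (2 * s) < c * lM -> e * (2 * ms) < lMs ->
  e ^+ 2 * ((1 + X) * (rho * (l ^+ 4 / 8) + ms * (l ^+ 3 / 2))) < rho * c ^+ 2.
Proof.
move=> l0 -> s0 m0 c0 X0 P0 P16 e0 lM1 lMs1 H1 H2 H3.
have P20 : 0 < P ^+ 2 by rewrite exprn_gt0.
have e1 : 2 * e < c * s.
  rewrite -(ltr_pM2r s0); have : c * lM <= c * s ^+ 2 by rewrite ler_wpM2l// ltW.
  rewrite expr2 mulrA; lra.
have e2 : 2 * e < 1 by rewrite -(ltr_pM2r m0); lra.
pose q := e * (1 + X) * l ^+ 3.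
have q0 : 0 < q by rewrite !mulr_gt0 ?exprn_gt0// ltr_pwDl.
have le1 : e ^+ 2 * ((1 + X) * (s ^+ 2 * (l ^+ 4 / 8) + ms * (l ^+ 3 / 2))) <=
    q * (s ^+ 3 * c * l / 16 + ms / 4).
  have -> : e ^+ 2 * ((1 + X) * (s ^+ 2 * (l ^+ 4 / 8) + ms * (l ^+ 3 / 2))) =
    q * ((2 * e) * (s ^+ 2 * l / 16) + (2 * e) * (ms / 4)) by rewrite /q; field.
  have -> : s ^+ 3 * c * l / 16 = (c * s) * (s ^+ 2 * l / 16) by field.
  rewrite ler_wpM2l ?(ltW q0)// lerD//.
    by rewrite ler_wpM2r ?(ltW e1)// !mulr_ge0 ?invr_ge0 ?exprn_ge0 ?(ltW l0) ?(ltW s0).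
  by rewrite -[leRHS]mul1r ler_wpM2r ?(ltW e2)// divr_ge0 ?(ltW m0).
apply: le_lt_trans le1 _.
have P40 : 0 < P ^+ 4 by rewrite exprn_gt0.
rewrite -(ltr_pM2l P40) [ltRHS]mulrA; apply: le_lt_trans _ H1.
have -> : e * (4 * l ^+ 3 * (1 + X) * (4 * l * s ^+ 3 * c + P ^+ 2 * ms)) =
  q * (16 * (s ^+ 3 * c * l) + 4 * P ^+ 2 * ms) by rewrite /q; ring.
rewrite mulrCA ler_wpM2l ?(ltW q0)// mulrDr lerD//.
  have A0 : 0 <= s ^+ 3 * c * l by rewrite !mulr_ge0 ?exprn_ge0 ?(ltW l0) ?(ltW s0) ?(ltW c0).
  have -> : P ^+ 4 * (s ^+ 3 * c * l / 16) = (P ^+ 2) ^+ 2 / 16 * (s ^+ 3 * c * l) by field.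
  by rewrite ler_wpM2r//; move: P16 P20; nra.
have -> : P ^+ 4 * (ms / 4) = (P ^+ 2) * (P ^+ 2) / 4 * ms by field.
by rewrite ler_wpM2r ?(ltW m0)//; move: P16 P20; nra.
Qed.

(** The same splitting of e^2, with X and Y standing for rho |x_c| and m_s |x_c|; here 2 e < s c and
    2 e < 1. *)
Lemma ph_threshold (l I Is Js X s c P e lM lMs : R) :
  0 < l -> I = s ^+ 2 -> 0 < s -> 0 < c -> 0 < P -> P ^+ 2 <= 16 -> 0 < e ->
  0 < Is -> 0 < Js -> 0 <= X -> lM <= Is -> lMs <= Js ->
  forall Y : R, 0 <= Y ->
  e * (4 * l ^+ 2 * (Is + X) * s * c + P ^+ 2 * l * (Js + Y)) < P ^+ 2 * I * c ^+ 2 ->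
  e * (2 * Is) < s * c * lM -> e * (2 * Js) < lMs ->
  e ^+ 2 * ((Is + X) * (l ^+ 2 / 2) + (Js + Y) * l) < I * c ^+ 2.
Proof.
move=> l0 -> s0 c0 P0 P16 e0 Is0 Js0 X0 lM1 lMs1 Y Y0 H1 H2 H3.
have P20 : 0 < P ^+ 2 by rewrite exprn_gt0.
have e1 : 2 * e < s * c.
  rewrite -(ltr_pM2r Is0); have : s * c * lM <= s * c * Is by rewrite ler_wpM2l// mulr_ge0 ?ltW.
  lra.
have e2 : 2 * e < 1 by rewrite -(ltr_pM2r Js0); lra.
pose A := (Is + X) * l ^+ 2 * e; pose D := (Js + Y) * l * e.
have A0 : 0 <= A by rewrite !mulr_ge0 ?exprn_ge0 ?addr_ge0 ?(ltW Is0) ?(ltW l0) ?(ltW e0)//.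
have D0 : 0 <= D by rewrite !mulr_ge0 ?addr_ge0 ?(ltW Js0) ?(ltW l0) ?(ltW e0)//.
have -> : e ^+ 2 * ((Is + X) * (l ^+ 2 / 2) + (Js + Y) * l) =
  A * (2 * e) / 4 + D * (2 * e) / 2 by rewrite /A /D; field.
have le1 : A * (2 * e) <= A * (s * c) by rewrite ler_wpM2l// ltW.
have le2 : D * (2 * e) <= D * 1 by rewrite ler_wpM2l// ltW.
rewrite -(ltr_pM2l P20) [ltRHS]mulrA; apply: le_lt_trans _ H1.
have -> : e * (4 * l ^+ 2 * (Is + X) * s * c + P ^+ 2 * l * (Js + Y)) =
  4 * (A * (s * c)) + P ^+ 2 * D by rewrite /A /D; ring.
have As0 : 0 <= A * (s * c) by rewrite mulr_ge0// mulr_ge0// ltW.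
have le3 : P ^+ 2 * (A * (2 * e) / 4) <= 16 * (A * (s * c) / 4).
  apply: ler_pM => //; [exact: ltW| |lra].
  by rewrite mulr_ge0 ?invr_ge0// mulr_ge0// mulr_ge0// ltW.
have le4 : P ^+ 2 * (D * (2 * e) / 2) <= P ^+ 2 * D.
  rewrite ler_wpM2l ?(ltW P20)//; lra.
rewrite mulrDr; lra.
Qed.

End thresholds.

Lemma stateB (R : realType) (U V W : lmodType R) (x : (U * U) * ((V * V) * (W * W)))
    (y : V * V) (z : W * W) :
  x - (0, (y, z)) = (x.1, ((x.2.1.1 - y.1, x.2.1.2 - y.2), (x.2.2.1 - z.1, x.2.2.2 - z.2))).
Proof. by congr (_, _); exact: subr0. Qed.

Lemma tuple6D (R : realType) (V1 V2 V3 V4 V5 V6 : lmodType R)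
    (X Y : V1 * V2 * V3 * V4 * V5 * V6) :
  X + Y = (X.1.1.1.1.1 + Y.1.1.1.1.1, X.1.1.1.1.2 + Y.1.1.1.1.2,
           X.1.1.1.2 + Y.1.1.1.2, X.1.1.2 + Y.1.1.2, X.1.2 + Y.1.2, X.2 + Y.2).
Proof. by []. Qed.

(** * The concrete beam in strain and velocity coordinates *)

Section beam_semigroup.
Context {R : realType} (B : beam R).
Local Notation l := (len B).
Local Notation one := (L2one l).
Local Notation Jl := (J (l := l)).
Local Notation dt := (dot (l := l)).
Local Notation rh := (rho B).
Local Notation x_c := (xc B).
Local Notation kom := (rho B * c_om B ^+ 2).
Local Notation kph := (Iw B * c_ph B ^+ 2).
Let l0 : 0 < l := len_gt0 B.
Let dP : inner_product dt := dot_inner_product l.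

Lemma kom_gt0 : 0 < kom. Proof. by rewrite mulr_gt0 ?exprn_gt0// ?rho_gt0 ?c_om_gt0. Qed.

Lemma kph_gt0 : 0 < kph. Proof. by rewrite mulr_gt0 ?exprn_gt0// ?Iw_gt0 ?c_ph_gt0. Qed.

Lemma Mb_pos : (rh * x_c) ^+ 2 < rh * Iws B.
Proof.
rewrite /Iws mulrDr exprMn mulrA -expr2 ltrDr mulr_gt0 ?rho_gt0 ?Iw_gt0//.
Qed.

Lemma Mt_pos : (ms B * x_c) ^+ 2 < ms B * Jss B.
Proof.
rewrite /Jss mulrDr exprMn mulrA -expr2 ltrDr mulr_gt0 ?ms_gt0 ?Js_gt0//.
Qed.

Lemma Mb_unit : Mb B \in unitmx.
Proof. by rewrite unitmxE det_mx22 unitfE subr_eq0 gt_eqF// -expr2 Mb_pos. Qed.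

Lemma Mt_unit : Mt B \in unitmx.
Proof. by rewrite unitmxE det_mx22 unitfE subr_eq0 gt_eqF// -expr2 Mt_pos. Qed.

Lemma HL2E (f : HL 2 l) : HLval f = Jl (Jl (wderiv 2 f)).
Proof. by have := HLvalP f; rewrite sobolevL2P// => /asboolP. Qed.

Lemma HL1E (h : HL 1 l) : HLval h = Jl (wderiv 1 h).
Proof. by have := HLvalP h; rewrite sobolevL1P// => /asboolP. Qed.

Definition state : lmodType R := ((L2 l * L2 l) * ((L2 l * L2 l) * (R^o * R^o)))%type.

Definition coords (X : Hsp B) : state :=
  let: (f, g, h, z, zo, zp) := X in
  ((wderiv 2 (HLval f), wderiv 1 (HLval h)), ((g, z), (zo, zp))).

Definition of_coords (x : state) : Hsp B :=
  (MkHL (JJ_sobolevL2 l0 x.1.1), x.2.1.1, MkHL (J_sobolevL1 l0 x.1.2), x.2.1.2,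
   x.2.2.1, x.2.2.2).

Lemma HL2_weak_deriv (f : HL 2 l) : weak_deriv 2 (HLval f) (wderiv 2 f).
Proof. by rewrite {1}HL2E; have := weak_deriv_JJ l0 0 0 (wderiv 2 f); rewrite -!J0E. Qed.

Lemma HL1_weak_deriv (f : HL 1 l) : weak_deriv 1 (HLval f) (wderiv 1 f).
Proof. by rewrite {1}HL1E; have := weak_deriv_J l0 0 (wderiv 1 f); rewrite -!J0E. Qed.

Lemma coords_linear : linear coords.
Proof.
move=> a [[[[[f g] h] z] zo] zp] [[[[[f' g'] h'] z'] zo'] zp'].
rewrite [a *: (_ : Hsp B)  + _]tuple6ZD [RHS]stateZD /coords /=.
rewrite (wderiv_linear a (HL2_weak_deriv f) (HL2_weak_deriv f')).
by rewrite (wderiv_linear a (HL1_weak_deriv h) (HL1_weak_deriv h')).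
Qed.

Lemma coordsK : cancel coords of_coords.
Proof.
move=> [[[[[f g] h] z] zo] zp]; rewrite /of_coords /coords /=.
by congr (_, _, _, _, _, _); apply: val_inj => /=; rewrite -?HL2E -?HL1E.
Qed.

Lemma of_coordsK : cancel of_coords coords.
Proof.
move=> [[a c] [[g z] [zo zp]]]; rewrite /of_coords /coords /=.
by rewrite wderiv2_JJ// wderiv1_J.
Qed.

Definition ip_state : state -> state -> R :=
  beam_ip dt kom kph rh (rh * x_c) (Iws B) (ms B) (ms B * x_c) (Jss B).

Lemma dotZ_integrable (k : R) (u v : L2 l) :
  (leb l).-integrable setT (EFin \o (fun y => k * (L2fun u y * L2fun v y))).
Proof. by have := integrableZl measurableT k (dot_integrable u v). Qed.

Lemma dotZD_integrable (k k' : R) (u v u' v' : L2 l) : (leb l).-integrable setT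
  (EFin \o (fun y => k * (L2fun u y * L2fun v y) + k' * (L2fun u' y * L2fun v' y))).
Proof.
by have := integrableD measurableT (dotZ_integrable k u v) (dotZ_integrable k' u' v').
Qed.

Lemma Rintegral_dotZD (k k' : R) (u v u' v' : L2 l) :
  \int[leb l]_y (k * (L2fun u y * L2fun v y) + k' * (L2fun u' y * L2fun v' y)) =
  k * dot u v + k' * dot u' v'.
Proof.
rewrite RintegralD//; [|exact: dotZ_integrable|exact: dotZ_integrable].
by rewrite !RintegralZl//; exact: dot_integrable.
Qed.

Lemma ip1E X Y : ip1 B X Y = ip_state (coords X) (coords Y).
Proof.
move: X Y => [[[[[f g] h] z] zo] zp] [[[[[f' g'] h'] z'] zo'] zp'].
rewrite /ip1 /ip_state /beam_ip /strain_ip /kinetic_ip /ip_sum /ip_mat /coords /=.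
rewrite mul0r addr0 -addrA; congr (_ + _).
  by rewrite -Rintegral_dotZD; apply: eq_Rintegral => y _; rewrite !mulrA.
congr (_ + _); last by rewrite /Mt bil_mx22 /real_ip; ring.
have -> : rh * dot g g' + rh * x_c * (dot g z' + dot z g') + Iws B * dot z z' =
  \int[leb l]_y (rh * (L2fun g y * L2fun g' y) + rh * x_c * (L2fun g y * L2fun z' y)) +
  \int[leb l]_y (rh * x_c * (L2fun z y * L2fun g' y) + Iws B * (L2fun z y * L2fun z' y)).
  by rewrite !Rintegral_dotZD mulrDr !addrA.
rewrite -RintegralD//; [|exact: dotZD_integrable|exact: dotZD_integrable].
by apply: eq_Rintegral => y _; rewrite /Mb bil_mx22; ring.
Qed.

Variables e1 e2 : R.

Lemma opAE f g h z zo zp : opA B e1 e2 (f, g, h, z, zo, zp) =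
  (insubd 0 g,
   - (act2 (invmx (Mb B)) (kom *: wderiv 2 (bend f g)) (- (kph *: wderiv 1 (twist h z)))).1
   + (act2 (invmx (Mb B)) (al_om B *: HLval h + be_om B *: z + ga_om B *: g)
        (al_ph B *: HLval h + be_ph B *: z + ga_ph B *: g)).1,
   insubd 0 z,
   - (act2 (invmx (Mb B)) (kom *: wderiv 2 (bend f g)) (- (kph *: wderiv 1 (twist h z)))).2
   + (act2 (invmx (Mb B)) (al_om B *: HLval h + be_om B *: z + ga_om B *: g)
        (al_ph B *: HLval h + be_ph B *: z + ga_ph B *: g)).2,
   (act2 (invmx (Mt B))
      (kom * value (wderiv 1 (bend f g)) l + - k1 B * (value g l + e1 * value f l) : R^o)
      (- (kph * value (twist h z) l) + - k2 B * (value z l + e2 * value h l))).1,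
   (act2 (invmx (Mt B))
      (kom * value (wderiv 1 (bend f g)) l + - k1 B * (value g l + e1 * value f l) : R^o)
      (- (kph * value (twist h z) l) + - k2 B * (value z l + e2 * value h l))).2).
Proof. by rewrite /opA [LHS]tuple6D /opA1 /opA2 /= !addr0 !mulNr. Qed.

Definition beam_feedback : state -> state :=
  feedback dt one Jl (invmx (Mb B)) (invmx (Mt B)) (al_om B) (be_om B) (ga_om B)
    (al_ph B) (be_ph B) (ga_ph B) (k1 B) (k2 B) e1 e2.

Definition beam_graph : state -> state -> Prop :=
  damped_graph (strain_rate_map dt one Jl)
    (momentum_map dt one Jl kom kph rh (rh * x_c) (Iws B) (ms B) (ms B * x_c) (Jss B))
    (damping (eta_om B) (eta_ph B)).

Lemma beam_graph_generates :
  generates (ip1 B) (fun X Y => beam_graph (coords X) (coords Y - beam_feedback (coords X))).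
Proof.
apply: (generates_iso (G := fun x y => beam_graph x (y - beam_feedback x))
  coords_linear coordsK of_coordsK ip1E).
exact (beam_generates dP (@L2_complete R l) (bounded_op_J l0) (@J_adjoint R l)
  (affine_eq0 l0) kom_gt0 kph_gt0 (rho_gt0 B) Mb_pos (ms_gt0 B) Mt_pos
  (ltW (eta_om_gt0 B)) (ltW (eta_ph_gt0 B)) (invmx (Mb B)) (invmx (Mt B))
  (al_om B) (be_om B) (ga_om B) (al_ph B) (be_ph B) (ga_ph B) (k1 B) (k2 B) e1 e2).
Qed.

Lemma HL2_value (f : HL 2 l) : value (HLval f) l = dt (Jl (wderiv 2 (HLval f))) one.
Proof.
by have := value_affine_l l0 0 (Jl (wderiv 2 (HLval f))); rewrite -J0E -HL2E add0r.
Qed.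

Lemma HL1_value (h : HL 1 l) : value (HLval h) l = dt (wderiv 1 (HLval h)) one.
Proof.
by have := value_affine_l l0 0 (wderiv 1 (HLval h)); rewrite -J0E -HL1E add0r.
Qed.

(** [bendP] and [twistP] decode the two components of K^* w = - (a + S b) into regularity, boundary
    conditions and equations of motion, which [act2_residual] and [act2_tip] solve for the
    accelerations. The feedback is still expressed by zo and zp. *)
Lemma beam_graphE f g h z zo zp f' g' h' z' zo' zp' :
  let X := (f, g, h, z, zo, zp) : Hsp B in
  let Y := (f', g', h', z', zo', zp') : Hsp B in
  let b := wderiv 2 (HLval f') in let d := wderiv 1 (HLval h') in
  let r1 := kom *: wderiv 2 (wderiv 2 (HLval f) + eta_om B *: b) in
  let r2 := - (kph *: wderiv 1 (wderiv 1 (HLval h) + eta_ph B *: d)) in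
  let s1 := kom * value (wderiv 1 (wderiv 2 (HLval f) + eta_om B *: b)) l : R^o in
  let s2 := - (kph * value (wderiv 1 (HLval h) + eta_ph B *: d) l) : R^o in
  let F := act2 (invmx (Mb B)) (al_om B *: HLval h + be_om B *: z + ga_om B *: g)
    (al_ph B *: HLval h + be_ph B *: z + ga_ph B *: g) in
  beam_graph (coords X) (coords Y - beam_feedback (coords X)) <->
  [/\ [/\ g = HLval f', z = HLval h', zo = value (HLval f') l & zp = value (HLval h') l],
      sobolev 2 (wderiv 2 (HLval f) + eta_om B *: b) /\
      sobolev 1 (wderiv 1 (HLval h) + eta_ph B *: d),
      value (wderiv 2 (HLval f) + eta_om B *: b) l = 0,
      (g', z') =
        (- (act2 (invmx (Mb B)) r1 r2).1 + F.1, - (act2 (invmx (Mb B)) r1 r2).2 + F.2) &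
      (zo', zp') =
        ((act2 (invmx (Mt B)) (s1 + - k1 B * (zo + e1 * value (HLval f) l))
            (s2 + - k2 B * (zp + e2 * value (HLval h) l))).1,
         (act2 (invmx (Mt B)) (s1 + - k1 B * (zo + e1 * value (HLval f) l))
            (s2 + - k2 B * (zp + e2 * value (HLval h) l))).2)].
Proof.
move=> X Y b d r1 r2 s1 s2 F.
rewrite /beam_graph /damped_graph /beam_feedback /feedback stateB [coords X]/= [coords Y]/=.
set F0 := act2 (invmx (Mb B)) _ _.
have -> : F0 = F by rewrite /F0 /F /= -HL1E.
set T0 := act2 (invmx (Mt B)) (- k1 B *: _) _.
pose T := act2 (invmx (Mt B)) (- k1 B * (zo + e1 * value (HLval f) l) : R^o)
  (- k2 B * (zp + e2 * value (HLval h) l)).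
have -> : T0 = T by rewrite /T0 /T /= -HL2_value -HL1_value.
set D1 := g' - F.1; set D2 := z' - F.2; set P1 := zo' - T.1; set P2 := zp' - T.2.
have EM := act2_mx22 rh (rh * x_c) (rh * x_c) (Iws B) D1 D2.
have ET := act2_mx22 (ms B) (ms B * x_c) (ms B * x_c) (Jss B) P1 P2.
rewrite -/(Mb B) in EM; rewrite -/(Mt B) in ET.
have [R1 R1'] := act2_residual g' z' r1 r2 F.1 F.2 Mb_unit.
have [R2 R2'] := act2_tip zo' zp' s1 s2 (- k1 B * (zo + e1 * value (HLval f) l) : R^o)
  (- k2 B * (zp + e2 * value (HLval h) l)) Mt_unit.
rewrite -/D1 -/D2 EM in R1 R1'; rewrite -/T -/P1 -/P2 ET in R2 R2'.
rewrite /momentum_map /damping [fst]lock [snd]lock /= -!lock /=.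
have pairND (u v u' v' : L2 l) : - ((u, v) + (u', v')) = (- (u + u'), - (v + v')) by [].
rewrite pairND.
split.
  move=> [[Eg Ez Eo Ep] [/(bendP l0 _ _ _ kom_gt0)[sb vb db tb] /(twistP l0 _ _ _
    kph_gt0)[st dt' tt]]].
  split => //.
  - split; [by rewrite Eg -HL2E|by rewrite Ez -HL1E| |].
      by rewrite Eo -HL2_value.
    by rewrite Ep -HL1_value.
  - by apply: R1; rewrite /r1 /r2 db -dt' !opprK.
  - by apply: R2; rewrite /s1 /s2 tb tt.
move=> [[Eg Ez Eo Ep] [sb st] vb /R1'[E1 E2] /R2'[E3 E4]]; split.
  by rewrite /strain_rate_map /= -HL2E -HL1E -HL2_value -HL1_value Eg Ez Eo Ep.
congr (_, _).
  by apply/(bendP l0 _ _ _ kom_gt0); split => //; rewrite ?E1 ?opprK// E3.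
by apply/(twistP l0 _ _ _ kph_gt0); split => //; rewrite ?E2 ?E4 ?opprK.
Qed.

Lemma J_has_ac v : has_ac (Jl v : L2 (len B)).
Proof. by rewrite J0E; exact: affine_has_ac. Qed.

Lemma HL2_wderiv1 (f : HL 2 l) : wderiv 1 (HLval f) = Jl (wderiv 2 (HLval f)).
Proof. by rewrite {1}HL2E wderiv1_J. Qed.

Lemma sobolev1_has_ac (u : L2 l) : sobolev 1 u -> has_ac u.
Proof. by move=> /(sobolev1P l0)[c [v ->]]; exact: affine_has_ac. Qed.

(** On the domain zo = g(l) and zp = z(l), which identifies the feedback in the state variables with
    the one in [opA1], written with traces. *)
Lemma beam_graphP X Y :
  beam_graph (coords X) (coords Y - beam_feedback (coords X)) <->
  domA B X /\ opA B e1 e2 X = Y.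
Proof.
move: X Y => [[[[[f g] h] z] zo] zp] [[[[[f' g'] h'] z'] zo'] zp'].
split.
  move=> /beam_graphE[[-> -> Eo Ep] [sb st] vb [Eg Ez] [Eo' Ep']]; split.
    split => //; first by split; exact: HLvalP.
    have [_ sb1 _] := (sobolev2_Jadj l0 _).1 sb.
    have sb0 : sobolev 1 (bend (HLval f) (HLval f') : L2 l).
      by move=> k k1; apply: sb; exact: leq_trans k1 _.
    (* Each of the nine functions is of the form c one + J v, hence has an absolutely continuous
       representative. *)
    move=> u; rewrite !inE.
    case/orP=> [/eqP->|/orP[/eqP->|/orP[/eqP->|/orP[/eqP->|/orP[/eqP->|/orP[/eqP->|
      /orP[/eqP->|/orP[/eqP->|/eqP->]]]]]]]].
    - by rewrite HL2E; exact: J_has_ac.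
    - by rewrite HL2_wderiv1; exact: J_has_ac.
    - by rewrite HL2E; exact: J_has_ac.
    - by rewrite HL2_wderiv1; exact: J_has_ac.
    - by rewrite HL1E; exact: J_has_ac.
    - by rewrite HL1E; exact: J_has_ac.
    - exact: sobolev1_has_ac.
    - exact: sobolev1_has_ac.
    - exact: sobolev1_has_ac.
  rewrite opAE !valKd Eg Ez Eo' Ep' Eo Ep.
  by [].
move=> [[[sg sz] [sb st] vb [Eo Ep] _]]; rewrite opAE => -[Ef Eg Eh Ez Eo' Ep'].
(* Since g lies in H^2_L, and z in H^1_L, [insubd] returns its argument and not the default 0. *)
have gE : HLval f' = g by rewrite -Ef; exact: (insubdK 0 sg).
have zE : HLval h' = z by rewrite -Eh; exact: (insubdK 0 sz).
apply/beam_graphE; rewrite gE zE; split => //.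
- by rewrite -Eg -Ez.
- by rewrite -Eo' -Ep' Eo Ep.
Qed.

Theorem generates_ip1 :
  generates (ip1 B) (fun X Y => domA B X /\ opA B e1 e2 X = Y).
Proof.
have [T TC TG] := beam_graph_generates; exists T => // X Y.
by rewrite TG; exact: beam_graphP.
Qed.

Definition lift (X : Hsp B) : (L2 l * L2 l) * (R^o * R^o) :=
  let: (f, g, h, z, zo, zp) := X in
  ((e1 *: HLval f, e2 *: HLval h), (e1 * value (HLval f) l, e2 * value (HLval h) l)).

Local Notation kin := (kinetic_ip dt rh (rh * x_c) (Iws B) (ms B) (ms B * x_c) (Jss B)).
Local Notation strain := (strain_ip dt kom kph).

Lemma kinP : inner_product kin.
Proof.
apply: kinetic_ipP; [exact: dP|exact: rho_gt0|exact: Mb_pos|exact: ms_gt0|exact: Mt_pos].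
Qed.

Lemma ip2E X : ip2 B e1 e2 X X = ip1 B X X + 2 * kin (coords X).2 (lift X).
Proof.
move: X => [[[[[f g] h] z] zo] zp]; congr (_ + _).
rewrite /Psi /kinetic_ip /ip_sum mulrDr -addrA; congr (_ + _); last first.
  by rewrite /ip_mat /= /Mt bil_mx22 /real_ip; ring.
rewrite /ip_mat /= !(ipZr dP).
have -> : 2 * (rh * (e1 * dot g (HLval f)) + rh * x_c * (e2 * dot g (HLval h) + e1 * dot z
  (HLval f))
    + Iws B * (e2 * dot z (HLval h))) =
  \int[leb l]_y (2 * rh * e1 * (L2fun g y * L2fun f y) + 2 * rh * x_c * e1 * (L2fun z y *
    L2fun f y)) +
  \int[leb l]_y (2 * rh * x_c * e2 * (L2fun g y * L2fun h y) + 2 * Iws B * e2 * (L2fun z y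
    * L2fun h y)).
  by rewrite !Rintegral_dotZD; ring.
rewrite -RintegralD//; [|exact: dotZD_integrable|exact: dotZD_integrable].
by apply: eq_Rintegral => y _; rewrite /Mb bil_mx22; ring.
Qed.

Lemma ip1_state X :
  ip1 B X X = strain (coords X).1 (coords X).1 + kin (coords X).2 (coords X).2.
Proof. exact: ip1E. Qed.

Lemma Iws_gt0 : 0 < Iws B.
Proof. by rewrite /Iws ltr_pwDl ?Iw_gt0// mulr_ge0 ?sqr_ge0// ltW ?rho_gt0. Qed.

Lemma Jss_gt0 : 0 < Jss B.
Proof. by rewrite /Jss ltr_pwDl ?Js_gt0// mulr_ge0 ?sqr_ge0// ltW ?ms_gt0. Qed.

(** Here l^4 / 8 and l^2 / 2 bound the squared L^2 norms of f and h by those of f'' and h', while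
    l^3 / 2 and l bound the squares of f(l) and h(l). The factors with |x_c| come from
    [ip_mat_diag_le]. *)
Lemma kin_lift_le X : kin (lift X) (lift X) <=
  e1 ^+ 2 * ((1 + `|x_c|) * (rh * (l ^+ 4 / 8) + ms B * (l ^+ 3 / 2)))
    * dt (coords X).1.1 (coords X).1.1 +
  e2 ^+ 2 * ((Iws B + rh * `|x_c|) * (l ^+ 2 / 2) + (Jss B + ms B * `|x_c|) * l)
    * dt (coords X).1.2 (coords X).1.2.
Proof.
move: X => [[[[[f g] h] z] zo] zp]; rewrite [coords _]/= [lift _]/=.
set a := wderiv 2 _; set c := wderiv 1 _.
have r0 := ltW (rho_gt0 B); have m0 := ltW (ms_gt0 B).
have H1 := ip_mat_diag_le x_c (Iws B) (e1 *: HLval f) (e2 *: HLval h) dP r0.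
have H2 := @ip_mat_diag_le R R^o _ (ms B) x_c (Jss B) (e1 * value (HLval f) l) (e2 * value
  (HLval h) l)
  real_ip_inner_product m0.
apply: le_trans (lerD H1 H2) _; rewrite !(ipZl dP) !(ipZr dP) /real_ip.
have l0l := l_itv l0.
have F1 : dt (HLval f) (HLval f) <= l ^+ 4 / 8 * dt a a by rewrite HL2E; exact: JJ_sqr.
have F2 : dt (HLval h) (HLval h) <= l ^+ 2 / 2 * dt c c by rewrite HL1E; exact: J_sqr.
have F3 : value (HLval f) l ^+ 2 <= dt a a * (l ^+ 3 / 2).
  by rewrite HL2_value -primitive_l; exact: primitive_J_sqr.
have F4 : value (HLval h) l ^+ 2 <= dt c c * l.
  by rewrite HL1_value -primitive_l; exact: primitive_sqr_le.
have X0 := normr_ge0 x_c.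
have I0 := ltW Iws_gt0; have J0 := ltW Jss_gt0.
have c1 : 0 <= e1 ^+ 2 * (rh * (1 + `|x_c|)) by rewrite mulr_ge0 ?sqr_ge0// mulr_ge0// addr_ge0.
have c2 : 0 <= e2 ^+ 2 * (Iws B + rh * `|x_c|) by rewrite mulr_ge0 ?sqr_ge0// addr_ge0//
  mulr_ge0.
have c3 : 0 <= e1 ^+ 2 * (ms B * (1 + `|x_c|)) by rewrite mulr_ge0 ?sqr_ge0// mulr_ge0//
  addr_ge0.
have c4 : 0 <= e2 ^+ 2 * (Jss B + ms B * `|x_c|) by rewrite mulr_ge0 ?sqr_ge0// addr_ge0//
  mulr_ge0.
have G1 := ler_wpM2l c1 F1; have G2 := ler_wpM2l c2 F2.
have G3 := ler_wpM2l c3 F3; have G4 := ler_wpM2l c4 F4.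
have := lerD (lerD G1 G2) (lerD G3 G4).
set lhs := (X in X <= _ -> _); set rhs := (X in _ <= X -> _).
set lhs' := (X in _ -> X <= _); set rhs' := (X in _ -> _ <= X).
have -> : lhs' = lhs by rewrite /lhs' /lhs; ring.
by have -> : rhs' = rhs by rewrite /rhs' /rhs; field.
Qed.

Hypotheses
  (e1_small : e1 ^+ 2 * ((1 + `|x_c|) * (rh * (l ^+ 4 / 8) + ms B * (l ^+ 3 / 2))) < kom)
  (e2_small : e2 ^+ 2 * ((Iws B + rh * `|x_c|) * (l ^+ 2 / 2) +
    (Jss B + ms B * `|x_c|) * l) < kph).

(** Expanding the squares of th Y + lift X and th Y - lift X in the kinetic product gives 2 th |<Y,
    lift X>| <= th^2 |Y|^2 + |lift X|^2, and the last term is at most th^2 times the strain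
    energy. *)
Lemma Psi_small : exists2 th : R, 0 < th < 1 &
  forall X, `|2 * kin (coords X).2 (lift X)| <= th * ip1 B X X.
Proof.
move: e1_small e2_small; set E1 := e1 ^+ 2 * _; set E2 := e2 ^+ 2 * _ => lt1 lt2.
have k10 := kom_gt0; have k20 := kph_gt0.
pose t := Num.max 0 (Num.max (E1 / kom) (E2 / kph)).
have t0 : 0 <= t by rewrite le_max lexx.
have t1 : t < 1 by rewrite !gt_max ltr01 !ltr_pdivrMr// !mul1r lt1.
have tE1 : E1 <= t * kom by rewrite -ler_pdivrMr// !le_max lexx orbT.
have tE2 : E2 <= t * kph by rewrite -ler_pdivrMr// !le_max lexx !orbT.
(* A positive number below 1 whose square is at least t, by the inequality of the means; a square
   root of t could vanish. *)
pose th := (1 + t) / 2.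
have th01 : 0 < th < 1 by apply/andP; split; rewrite /th; lra.
have tth : t <= th ^+ 2 by have := sqr_ge0 (1 - t); rewrite /th !expr2; nra.
exists th => // X; have /andP[th0 _] := th01.
have V : kin (lift X) (lift X) <= th ^+ 2 * strain (coords X).1 (coords X).1.
  apply: le_trans (kin_lift_le X) _.
  have a0 := ip_ge0 dP (coords X).1.1; have c0 := ip_ge0 dP (coords X).1.2.
  apply: le_trans (lerD (ler_wpM2r a0 tE1) (ler_wpM2r c0 tE2)) _.
  rewrite -[t * _ * _]mulrA -[t * kph * _]mulrA -mulrDr /strain_ip /ip_mat mul0r addr0.
  by rewrite ler_wpM2r// addr_ge0// mulr_ge0// ltW.
rewrite -(ler_pM2l th0) mulrA -expr2 ip1_state.
have kP := kinP; set Y := (coords X).2 in V *.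
have := ip_ge0 kP (th *: Y + lift X); have := ip_ge0 kP (th *: Y - lift X).
rewrite !(ipE kP) (ipC kP (lift X) Y) -[X in X * `|_|](ger0_norm (ltW th0)) -normrM ler_norml.
move=> H1 H2; apply/andP; split; rewrite !expr2 in V *; nra.
Qed.

Lemma generates_ip2 :
  generates (ip2 B e1 e2) (fun X Y => domA B X /\ opA B e1 e2 X = Y).
Proof.
have [th /andP[th0 th1] H] := Psi_small.
have d0 : 0 < 1 - th by rewrite subr_gt0.
(* The squared norms satisfy (1 - th) |X|_1^2 <= |X|_2^2 <= 2 |X|_1^2. As C >= 2, its square exceeds
   both 1 / (1 - th) and 2. *)
pose C := 2 / (1 - th).
have C0 : 0 <= C by rewrite divr_ge0// ltW.
have C2 : 2 <= C by rewrite /C ler_pdivlMr//; lra.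
have dC : (1 - th) * C = 2 by rewrite /C mulrC divfK ?gt_eqF.
have ip10 X : 0 <= ip1 B X X.
  rewrite ip1_state addr_ge0 ?(ip_ge0 kinP)//.
  by apply: ip_ge0; apply: strain_ipP; [exact: dP|exact: kom_gt0|exact: kph_gt0].
apply: (@generates_equiv _ _ (ip1 B) _ C) generates_ip1.
- apply: ip_norm_equiv => // X; rewrite ip2E.
  have := H X; have := ip10 X; rewrite ler_norml => P0 /andP[H1 H2].
  set Q : R := ip1 B X X + _.
  have HQ : (1 - th) * ip1 B X X <= Q by rewrite /Q; lra.
  have Q0 : 0 <= Q by apply: le_trans HQ; rewrite mulr_ge0// ltW.
  have : (1 - th) * C * ip1 B X X <= C * Q by rewrite mulrAC [leLHS]mulrC ler_wpM2l.
  rewrite dC expr2 -mulrA => HQ'; have : C * Q <= C * (C * Q).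
    by rewrite ler_wpM2l// -{1}(mul1r Q) ler_wpM2r//; lra.
  have := mulr_ge0 C0 Q0; lra.
- apply: ip_norm_equiv => // X; rewrite ip2E.
  have := H X; have := ip10 X; rewrite ler_norml => P0 /andP[H1 H2].
  have : ip1 B X X + 2 * kin (coords X).2 (lift X) <= 2 * ip1 B X X by nra.
  move/le_trans; apply; rewrite ler_wpM2r// expr2; nra.
Qed.

End beam_semigroup.

(** The first, second and fourth entries of the minimum are used; their denominators are positive
    whatever x_c is, so [quo] is an ordinary quotient there. For K_{m,2} they are the first, third
    and fifth. *)
Lemma Km1_small (R : realType) (B : beam R) (e : R) : 0 < e -> (e%:E < Km1 B)%E ->
  e ^+ 2 * ((1 + `|xc B|) * (rho B * (len B ^+ 4 / 8) + ms B * (len B ^+ 3 / 2)))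
  < rho B * c_om B ^+ 2.
Proof.
move=> e0; have X0 := normr_ge0 (xc B); have r0 := rho_gt0 B; have m0 := ms_gt0 B.
have l0 := len_gt0 B; have c0 := c_om_gt0 B; have p0 := pi_gt0 R.
have s0 : 0 < Num.sqrt (rho B) by rewrite sqrtr_gt0.
have [lM _] := min_eigenvalue_mx22 (rho B) (rho B * xc B) (Iws B).
have [lMs _] := min_eigenvalue_mx22 (ms B) (ms B * xc B) (Jss B).
rewrite /Km1 /min_list !big_cons !lt_min => /andP[q1 /andP[q2 /andP[_ /andP[q4 _]]]].
have X1 : 0 < 1 + `|xc B| by rewrite ltr_pwDl.
have rE : rho B = Num.sqrt (rho B) ^+ 2 by rewrite sqr_sqrtr// ltW.
have := om_threshold l0 rE s0 m0 c0 X0 p0 pi2_le16 e0 lM lMs; apply.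
- rewrite -powR32//; apply: lt_quo q1.
  rewrite mulr_gt0//; first by rewrite !mulr_gt0 ?exprn_gt0.
  by rewrite addr_gt0// !mulr_gt0 ?exprn_gt0 ?powR_gt0.
- by apply: lt_quo q2; rewrite mulr_gt0.
- by apply: lt_quo q4; rewrite mulr_gt0.
Qed.

Lemma Km2_small (R : realType) (B : beam R) (e : R) : 0 < e -> (e%:E < Km2 B)%E ->
  e ^+ 2 * ((Iws B + rho B * `|xc B|) * (len B ^+ 2 / 2) + (Jss B + ms B * `|xc B|) * len B)
  < Iw B * c_ph B ^+ 2.
Proof.
move=> e0; have X0 := normr_ge0 (xc B); have r0 := rho_gt0 B; have m0 := ms_gt0 B.
have l0 := len_gt0 B; have c0 := c_ph_gt0 B; have p0 := pi_gt0 R; have I0 := Iw_gt0 B.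
have Is0 := Iws_gt0 B; have Js0 := Jss_gt0 B.
have s0 : 0 < Num.sqrt (Iw B) by rewrite sqrtr_gt0.
have [_ lM] := min_eigenvalue_mx22 (rho B) (rho B * xc B) (Iws B).
have [_ lMs] := min_eigenvalue_mx22 (ms B) (ms B * xc B) (Jss B).
rewrite /Km2 /min_list !big_cons !lt_min.
move=> /andP[q1 /andP[_ /andP[q3 /andP[_ /andP[q5 _]]]]].
have rX : 0 <= rho B * `|xc B| by rewrite mulr_ge0// ltW.
have mX : 0 <= ms B * `|xc B| by rewrite mulr_ge0// ltW.
have IE : Iw B = Num.sqrt (Iw B) ^+ 2 by rewrite sqr_sqrtr// ltW.
have := ph_threshold l0 IE s0 c0 p0 pi2_le16 e0 Is0 Js0 rX lM lMs mX; apply.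
- apply: lt_quo q1; rewrite addr_gt0// mulr_gt0 ?exprn_gt0//.
  + by rewrite !mulr_gt0 ?exprn_gt0// ltr_pwDl.
  + by rewrite mulr_gt0// exprn_gt0.
  + by rewrite ltr_pwDl.
- by apply: lt_quo q3; rewrite mulr_gt0.
- by apply: lt_quo q5; rewrite mulr_gt0.
Qed.

Theorem theorem12 (R : realType) (B : beam R) (e1 e2 : R) :
  (0 < e1)%R -> (0 < e2)%R ->
  (e1%:E < Order.min (eps1_star B) (Km1 B))%E ->
  (e2%:E < Order.min (eps2_star B) (Km2 B))%E ->
  generates_C0_semigroup (ip1 B) (domA B) (opA B e1 e2) /\
  generates_C0_semigroup (ip2 B e1 e2) (domA B) (opA B e1 e2).
Proof.
move=> e10 e20; rewrite !lt_min => /andP[_ h1] /andP[_ h2].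
split; first exact: generates_ip1.
exact: (generates_ip2 (Km1_small e10 h1) (Km2_small e20 h2)).
Qed.
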